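(* Let $1<m<2$ and $\theta_0\in L^1(\mathbb{R}^2)\cap L^\infty(\mathbb{R}^2)$. Then there is a weak solution $\theta$ on $[0,\infty)$ of \[ \partial_t\theta+\operatorname{div}(u\theta)=0,\qquad u=k_m\star\theta, \] with initial condition $\theta_0$, and moreover $\|\theta(t)\|_{L^p}\le\|\theta_0\|_{L^p}$ for every $p\in[1,\infty]$ and all $t>0$.
   Context: $G_m(x)=\frac{\Gamma(\frac{2-m}{2})}{2^{m/2}\pi|\Gamma(\frac m2)|}|x|^{m-2}$ is the Green function of $(-\Delta)^{m/2}$ on $\mathbb{R}^2$ and $k_m=\nabla^\perp G_m$ with $\nabla^\perp=(-\partial_{x_2},\partial_{x_1})$. A weak solution with initial datum $\theta_0\in L^1_{\mathrm{loc}}(\mathbb{R}^2)$ is a distribution $\theta$ such that for all $t>0$ and $\varphi\in C_c^\infty(\mathbb{R}^2)$, $\int_{\mathbb{R}^2}(\theta(t,x)-\theta_0(x))\varphi(x)\,dx-\int_0^t\int_{\mathbb{R}^2}\theta(s,x)u(s,x)\cdot\nabla\varphi(x)\,dx\,ds=0$, where $u=k_m\star\theta$. *)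

(* Defs.v *)
From HB Require Import structures.
From mathcomp Require Import all_boot all_order all_algebra.
From mathcomp Require Import all_classical all_reals all_analysis.
Set Implicit Arguments. Unset Strict Implicit. Unset Printing Implicit Defensive.
Import Order.TTheory GRing.Theory Num.Theory.
Import numFieldNormedType.Exports.
Local Open Scope classical_set_scope.
Local Open Scope ring_scope.

Section Defs.
Variable R : realType.

Definition leb1 := @lebesgue_measure R.
Definition leb2 := (leb1 \x leb1)%E.

Definition enorm (x : R * R) : R := Num.sqrt (x.1 ^+ 2 + x.2 ^+ 2).

Definition Gamma (s : R) : R :=
  Rintegral leb1 `]0, +oo[ (fun x => x `^ (s - 1) * expR (- x)).

(* Green function of (-Delta)^(m/2) on R^2. *)
Definition Gm (m : R) (x : R * R) : R :=
  Gamma ((2 - m) / 2) / (2 `^ (m / 2) * pi * `|Gamma (m / 2)|)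
  * enorm x `^ (m - 2).

Definition d1 (f : R * R -> R) (x : R * R) : R := 'D_((1 : R), (0 : R)) f x.
Definition d2 (f : R * R -> R) (x : R * R) : R := 'D_((0 : R), (1 : R)) f x.

Definition km (m : R) (x : R * R) : R * R := (- d2 (Gm m) x, d1 (Gm m) x).

Fixpoint Ck (k : nat) (f : R * R -> R) : Prop :=
  continuous f /\
  match k with
  | 0 => True
  | k'.+1 => (forall x, derivable f x ((1 : R), (0 : R)) /\
                        derivable f x ((0 : R), (1 : R)))
             /\ Ck k' (d1 f) /\ Ck k' (d2 f)
  end.

Definition test_fun (phi : R * R -> R) : Prop :=
  (forall k, Ck k phi) /\ compact (closure [set x | phi x != 0]).

Definition vel (m : R) (theta : R -> R * R -> R) (s : R) (x : R * R) : R * R :=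
  (Rintegral leb2 setT (fun y => (km m (x - y)).1 * theta s y),
   Rintegral leb2 setT (fun y => (km m (x - y)).2 * theta s y)).

Definition flux (m : R) (theta : R -> R * R -> R) (phi : R * R -> R)
  (s : R) (x : R * R) : R :=
  theta s x * ((vel m theta s x).1 * d1 phi x + (vel m theta s x).2 * d2 phi x).

(* Weak solution on [0, oo) with initial datum theta0.  The integrability
   conditions express that all integrals in the weak formulation make sense. *)
Definition weak_solution (m : R) (theta0 : R * R -> R)
  (theta : R -> R * R -> R) : Prop :=
  (forall s, 0 <= s -> measurable_fun setT (theta s)) /\
  (forall s x, 0 <= s ->
     leb2.-integrable setT (fun y => ((km m (x - y)).1 * theta s y)%:E) /\
     leb2.-integrable setT (fun y => ((km m (x - y)).2 * theta s y)%:E)) /\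
  forall t, 0 < t -> forall phi, test_fun phi ->
    leb2.-integrable setT (fun x => ((theta t x - theta0 x) * phi x)%:E) /\
    (forall s, 0 <= s <= t ->
       leb2.-integrable setT (fun x => (flux m theta phi s x)%:E)) /\
    leb1.-integrable `[0, t]
      (fun s => (Rintegral leb2 setT (flux m theta phi s))%:E) /\
    Rintegral leb2 setT (fun x => (theta t x - theta0 x) * phi x)
    - Rintegral leb1 `[0, t] (fun s => Rintegral leb2 setT (flux m theta phi s))
    = 0.

End Defs.

(* Main.v *)
(** The solution is a limit of a random-walk scheme on the whole plane.  Replace
    G_m by the smooth kernel in which |x|^2 becomes |x|^2 + d^2, and take as velocity
    the discrete perpendicular gradient (central differences of step h) of its
    convolution with theta.  One step moves the mass at x to x + h e, e = +-e1, +-e2,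
    with probability 1/4 + lam (u(x) . e).  The discrete velocity is discretely
    divergence free, so the transition kernel is doubly stochastic, and by convexity
    no L^p norm increases.  With d, h -> 0 the time-t iterates are bounded in
    L^1 and L^oo and have a weak-* limit theta(t) along a fixed ultrafilter on nat,
    which avoids extracting subsequences.  Since k_m is locally integrable, decays at
    infinity and is approximated in weighted sup norm by Lipschitz kernels, the
    velocities converge locally uniformly, so the nonlinear flux passes to the limit.
    For a test function phi, A(t) = int theta(t) phi then satisfies
    |A(t) - A(s) - (t - s) F(s)| <= eps |t - s| for |t - s| small, F being the flux;
    hence F is continuous, A' = F, and the fundamental theorem of calculus gives the
    weak formulation. *)

(* The walk is run in hyperbolic scaling: a jump of length h takes a time [tau] proportional to h,
   so each step adds a second-order error of size h^2 and only O(h) of it survives over a fixed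
   time; the diffusion of the walk vanishes in the limit. Nonnegative jump probabilities ask for a
   velocity bound known in advance; it depends only on the sup bound M and the L^1 bound N, and both
   survive every step. The scheme uses d and h tied to n, while the limit equation has no
   regularization, so the two fluxes are not compared directly. Both are compared with the flux of a
   kernel regularized at a fixed scale e: the error is small with e and 1/n, while for fixed e this
   flux is Lipschitz along the scheme and continuous under weak convergence. Since k_m is of order
   |z|^(m-3), the condition m > 1 leaves room for the slightly stronger singularity that measures
   the error in e. Taking all limits along one ultrafilter also yields theta(t) for uncountably many
   t at once. *)
Require Import Defs.
From HB Require Import structures.
From mathcomp Require Import all_boot all_order all_algebra.
From mathcomp Require Import all_classical all_reals all_analysis.
From mathcomp Require Import measurable_realfun lebesgue_integral ess_sup_inf.
From mathcomp Require Import ring lra.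
Set Implicit Arguments. Unset Strict Implicit. Unset Printing Implicit Defensive.
Import Order.TTheory GRing.Theory Num.Theory.
Import numFieldNormedType.Exports.
Local Open Scope classical_set_scope.
Local Open Scope ring_scope.

(** * Lebesgue measure on the plane *)

Section Plane.
Variable R : realType.
Implicit Types (a b : R) (f g : R * R -> R).

Local Notation mu := (@leb2 R).

Lemma leb1_shift a (A : set R) : measurable A ->
  @leb1 R ((fun x => x + a) @^-1` A) = leb1 A.
Proof.
move=> mA; rewrite /leb1.
pose f : measurableTypeR R -> measurableTypeR R := fun x => x + a.
have mf : measurable_fun setT f by exact: measurable_funD.
pose f' : {mfun measurableTypeR R >-> measurableTypeR R} :=
  HB.pack f (isMeasurableFun.Build _ _ _ _ f mf).
apply/esym/(@lebesgue_measure_unique R (pushforward lebesgue_measure f')) => //.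
move=> _ [[u v]] _ <-; rewrite /pushforward.
rewrite [X in _ = lebesgue_measure X](_ : _ = [set` `](u - a), (v - a)]]); last first.
  by apply/seteqP; split => x /=; rewrite !in_itv /= /f ltrBlDr lerBrDr.
rewrite !lebesgue_measure_itv /= !lte_fin ltrD2r.
by case: ifP => // _; rewrite -!EFinB; congr EFin; ring.
Qed.

Lemma measurable_shift (a : R * R) :
  measurable_fun setT (fun x : measurableTypeR R * measurableTypeR R =>
    (x.1 + a.1, x.2 + a.2) : measurableTypeR R * measurableTypeR R).
Proof.
apply: measurable_fun_pair; apply: measurable_funD => //.
Qed.

(** By uniqueness of the product measure, it is enough that the pushforward under the shift agrees
    with it on rectangles. *)
Lemma leb2_shift (a : R * R) (A : set (R * R)) : measurable A ->
  mu ((fun x => x + a) @^-1` A) = mu A.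
Proof.
move=> mA.
pose f := (fun x : measurableTypeR R * measurableTypeR R =>
    (x.1 + a.1, x.2 + a.2) : measurableTypeR R * measurableTypeR R).
pose f' : {mfun (measurableTypeR R * measurableTypeR R)%type >-> (measurableTypeR R * measurableTypeR R)%type} :=
  HB.pack f (isMeasurableFun.Build _ _ _ _ f (measurable_shift a)).
apply/esym.
apply: (@product_measure_unique _ _ _ _ _ _ _ (pushforward mu f')) => // B C mB mC.
rewrite /pushforward.
change (mu (((fun x : measurableTypeR R => x + a.1) @^-1` B) `*` ((fun x : measurableTypeR R => x + a.2) @^-1` C)) = (leb1 B * leb1 C)%E).
have mt (b : R) (D : set (measurableTypeR R)) : measurable D ->
    measurable ((fun x : measurableTypeR R => x + b) @^-1` D).
  by move=> mD; rewrite -[X in measurable X]setTI; apply: (measurable_funD _ _) => //.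
rewrite /leb2 product_measure1E; [|exact: mt..].
by congr (_ * _)%E; exact: leb1_shift.
Qed.

Lemma ge0_integral_shift (a : R * R) (F : R * R -> \bar R) :
  measurable_fun setT F -> (forall x, 0 <= F x)%E ->
  (\int[mu]_x F ((x : R * R) + a)%R = \int[mu]_x F x)%E.
Proof.
move=> mF F0.
have := @ge0_integral_pushforward _ _ _ _ _ _ (measurable_shift a) mu setT F measurableT mF (fun y _ => F0 y).
rewrite preimage_setT => <-.
by apply: eq_measure_integral => [|mf A mA _]; [exact: measurable_shift|exact: leb2_shift].
Qed.

Lemma measurable_fun_shift (a : R * R) d (T : measurableType d) (F : R * R -> T) :
  measurable_fun setT F -> measurable_fun setT (fun x : R * R => F (x + a)).
Proof. by move=> mF; exact: (measurableT_comp mF (measurable_shift a)). Qed.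

Lemma integrable_shift (a : R * R) (F : R * R -> \bar R) :
  mu.-integrable setT F -> mu.-integrable setT (fun x : R * R => F (x + a)).
Proof.
move=> /integrableP[mF iF]; apply/integrableP; split.
  exact: measurable_fun_shift.
by rewrite (@ge0_integral_shift _ (fun x => `|F x|)%E)//; exact: measurableT_comp.
Qed.

Lemma integral_shift (a : R * R) (F : R * R -> \bar R) :
  mu.-integrable setT F ->
  (\int[mu]_x F ((x : R * R) + a)%R = \int[mu]_x F x)%E.
Proof.
move=> /integrableP[mF iF].
have hp := @ge0_integral_shift a F^\+%E (measurable_funepos mF) (fun x => funepos_ge0 F x).
have hn := @ge0_integral_shift a F^\-%E (measurable_funeneg mF) (fun x => funeneg_ge0 F x).
rewrite integralE [RHS]integralE -hp -hn.
by congr (_ - _)%E; apply: eq_integral => x _; rewrite unlock.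
Qed.

(** The sigma-algebra of the plane is the product one, so open sets have to be shown measurable: an
    open set is the countable union of the squares with rational centre and radius 1/(n+1) that it
    contains. *)
Lemma continuous_measurable_fun2 f : continuous f -> measurable_fun setT f.
Proof.
move=> cf.
apply: (measurability _ (RGenOInfty.measurableE R)) => //= _ [_ [r ->]] <-.
rewrite setTI.
set U := (X in measurable X).
have oU : open U by apply: open_comp => // x _; exact: cf.
pose P (q1 q2 : rat) (n : nat) : set (R * R) :=
  if pselect (ball (ratr q1 : R, ratr q2 : R) n.+1%:R^-1 `<=` U)
  then ball (ratr q1 : R) n.+1%:R^-1 `*` ball (ratr q2 : R) n.+1%:R^-1 else set0.
have -> : U = \bigcup_q1 \bigcup_q2 \bigcup_n P q1 q2 n.
  apply/seteqP; split => [x Ux|x [q1 _ [q2 _ [n _]]]]; last first.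
    by rewrite /P; case: pselect => // sub [xP1 xP2]; apply: sub.
  have /nbhs_ballP[e /= e0 xeU] : nbhs x U by exact: open_nbhs_nbhs.
  have [n ne] : exists n, n.+1%:R^-1 < e / 2.
    have [n _ /(_ _ (leqnn _))] := near_infty_natSinv_lt (PosNum (divr_gt0 e0 (ltr0n _ 2))).
    by move=> ?; exists n.
  have n0 : 0 < n.+1%:R^-1 :> R by rewrite invr_gt0.
  set s := n.+1%:R^-1 in ne n0.
  have ltc (z : R) : z - s < z + s by lra.
  have [q1] := rat_in_itvoo (ltc x.1).
  have [q2] := rat_in_itvoo (ltc x.2).
  rewrite !in_itv /= => /andP[q2l q2r] /andP[q1l q1r].
  exists q1 => //; exists q2 => //; exists n => //.
  rewrite /P -/s; case: pselect => [?|]; last first.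
    move=> nsub; exfalso; apply: nsub => y [y1 y2]; apply: xeU; split.
      move: y1; rewrite /ball /= => y1.
      have -> : x.1 - y.1 = (x.1 - ratr q1) + (ratr q1 - y.1) by ring.
      rewrite (le_lt_trans (ler_normD _ _))// (splitr e) ltrD//.
        by rewrite ltr_norml; apply/andP; split; lra.
      by rewrite (lt_trans y1).
    move: y2; rewrite /ball /= => y2.
    have -> : x.2 - y.2 = (x.2 - ratr q2) + (ratr q2 - y.2) by ring.
    rewrite (le_lt_trans (ler_normD _ _))// (splitr e) ltrD//.
      by rewrite ltr_norml; apply/andP; split; lra.
    by rewrite (lt_trans y2).
  by split; rewrite /ball /= ltr_norml; apply/andP; split; lra.
apply: bigcupT_measurable_rat => q1; apply: bigcupT_measurable_rat => q2.
apply: bigcupT_measurable => n; rewrite /P; case: pselect => ? //=.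
by apply: measurableX; exact: measurable_ball.
Qed.

End Plane.

(** * Convolution with singular kernels *)

Section PowerSingularity.
Variable R : realType.
Implicit Types (a s : R) (z : R * R).
Local Notation leb := (@lebesgue_measure R).
Local Notation mu := (@leb2 R).

(* The value +oo at 0 lets [ppow] dominate the kernel even at the origin, where
   [km m 0] is a junk value. *)
Definition hpow a s : \bar R :=
  if s == 0 then +oo%E else if 0 < s <= 1 then (s `^ (- a))%:E else 0%E.

Definition spow a s : \bar R := (hpow a s + hpow a (- s))%E.

(* Product weight with the singularity of |z|^(-2 a), up to an additive constant
   (see [sqd_le_ppow]); its integral splits by Tonelli. *)
Definition ppow a z : \bar R := (spow a z.1 * spow a z.2)%E.

Lemma hpow_ge0 a s : (0 <= hpow a s)%E.
Proof. by rewrite /hpow; case: ifP => // _; case: ifP => // _; rewrite lee_fin powR_ge0. Qed.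

Lemma spow_ge0 a s : (0 <= spow a s)%E.
Proof. by rewrite adde_ge0// hpow_ge0. Qed.

Lemma ppow_ge0 a z : (0 <= ppow a z)%E.
Proof. by rewrite mule_ge0// spow_ge0. Qed.

Lemma spowN a s : spow a (- s) = spow a s.
Proof. by rewrite /spow opprK addeC. Qed.

Lemma ppowN a z : ppow a (- z) = ppow a z.
Proof. by rewrite /ppow /= !spowN. Qed.

Lemma measurable_hpow a : measurable_fun setT (hpow a).
Proof.
apply: measurable_fun_ifT => //=.
  exact: measurable_fun_eqr.
apply: measurable_fun_ifT => //=.
  by apply: measurable_and; [exact: measurable_fun_ltr|exact: measurable_fun_ler].
by apply/measurable_EFinP; exact: measurable_powR.
Qed.

Lemma measurable_spow a : measurable_fun setT (spow a).
Proof.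
apply: emeasurable_funD; first exact: measurable_hpow.
by apply: (measurableT_comp (measurable_hpow a)); exact: oppr_measurable.
Qed.

Lemma measurable_ppow a : measurable_fun setT (ppow a).
Proof.
apply: emeasurable_funM; apply: (measurableT_comp (measurable_spow a)).
  exact: measurable_fst.
exact: measurable_snd.
Qed.

(** The fundamental theorem of calculus is applied away from the singularity, on [[1/(n+2), 1]],
    where it gives at most 1/(1-a); monotone convergence then reaches []0, 1]]. The index n+2 keeps
    these intervals nondegenerate. *)
Lemma integral_hpow_lty a : 0 < a < 1 -> (\int[leb]_s hpow a s < +oo)%E.
Proof.
move=> /andP[a0 a1].
have -> : (\int[leb]_s hpow a s = \int[leb]_(s in `]0%R, 1%R]) hpow a s)%E.
  transitivity (\int[leb]_(s in `[0%R, 1%R]) hpow a s)%E.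
    rewrite [RHS]integral_mkcond; apply: eq_integral => s _.
    rewrite patchE; case: ifPn => //.
    rewrite notin_setE /= in_itv /= => /negP; rewrite negb_and -!ltNge => h.
    rewrite /hpow; case: eqP => [s0|_]; first by move: h; rewrite s0 ltxx ltr10.
    by case: ifP => // /andP[s0 s1]; move: h; rewrite !ltNge s1 (ltW s0).
  rewrite -integral_itv_obnd_cbnd//.
  by apply: measurable_funTS; exact: measurable_hpow.
have E : `]0%R, 1%R]%classic = \bigcup_n `[(n.+2%:R^-1%R : R), 1%R]%classic.
  apply/seteqP; split => [s|s [n _]] /=; rewrite !in_itv /=; last first.
    by move=> /andP[s0 ->]; rewrite andbT (lt_le_trans _ s0).
  move=> /andP[s0 s1].
  have [n _ /(_ n.+1)] := near_infty_natSinv_lt (PosNum s0).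
  rewrite /= leqnSn => /(_ isT) ns; exists n => //=.
  by rewrite in_itv /= s1 (ltW ns).
have nd : nondecreasing_seq (fun n => `[(n.+2%:R^-1%R : R), 1%R]%classic).
  apply/nondecreasing_seqP => n; rewrite subsetEset => s /=; rewrite !in_itv /=.
  move=> /andP[ns ->]; rewrite andbT (le_trans _ ns)// lef_pV2 ?posrE//.
  by rewrite ler_nat.
have bd n : (\int[leb]_(s in `[(n.+2%:R^-1%R : R), 1%R]) hpow a s <= ((1 - a)^-1)%:E)%E.
  have n0 : 0 < n.+2%:R^-1 :> R by rewrite invr_gt0.
  have n1 : n.+2%:R^-1 < 1 :> R by rewrite invf_lt1// ltr1n.
  have -> : (\int[leb]_(s in `[(n.+2%:R^-1%R : R), 1%R]) hpow a s =
     \int[leb]_(s in `[(n.+2%:R^-1%R : R), 1%R]) (s `^ (- a))%:E)%E.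
    apply: eq_integral => s; rewrite inE /= in_itv /= => /andP[ns s1].
    have s0 : 0 < s by exact: lt_le_trans ns.
    by rewrite /hpow gt_eqF// s0 s1.
  pose F s := (1 - a)^-1 * s `^ (1 - a).
  have dF s : 0 < s -> is_derive s 1 F (s `^ (- a)).
    move=> s0; have := is_deriveZ ((1 - a)^-1) (is_derive1_powR (1 - a) s0).
    rewrite /GRing.scale /= mulrA mulVf ?mul1r; last by rewrite subr_eq0 gt_eqF.
    by have -> : 1 - a - 1 = - a by ring.
  have cF s : 0 < s -> {for s, continuous F}.
    by move=> s0; apply: differentiable_continuous; apply/derivable1_diffP; have [] := dF _ s0.
  rewrite (@continuous_FTC2 _ _ F) //.
  - rewrite -EFinB lee_fin /F powR1 mulr1 lerBlDr lerDl mulr_ge0 ?powR_ge0// invr_ge0.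
    by lra.
  - apply: continuous_in_subspaceT => s; rewrite inE /= in_itv /= => /andP[ns _].
    have s0 : 0 < s by exact: lt_le_trans ns.
    apply: differentiable_continuous; apply/derivable1_diffP.
    by apply: derivable_powR; rewrite in_itv /= s0.
  - split.
    + by move=> s; rewrite in_itv /= => /andP[ns _]; have [] := dF s (lt_trans n0 ns).
    + by apply: cvg_at_right_filter; exact: cF.
    + by apply: cvg_at_left_filter; exact: cF.
  - move=> s; rewrite in_itv /= => /andP[ns _].
    by rewrite derive1E; have [_ ->] := dF s (lt_trans n0 ns).
rewrite E; have mI n : measurable `[(n.+2%:R^-1%R : R), 1%R]%classic by exact: measurable_itv.
pose I n : set (measurableTypeR R) := `[(n.+2%:R^-1 : R), 1%R]%classic.
have mh n : @measurable_fun _ _ (measurableTypeR R) _ (I n) (hpow a).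
  by apply: measurable_funTS; exact: measurable_hpow.
have h0 n (s : measurableTypeR R) : I n s -> (0 <= hpow a s)%E by move=> _; exact: hpow_ge0.
have := @ge0_nondecreasing_set_cvg_integral _ (measurableTypeR R) R I (hpow a) leb nd mI mh h0.
move=> /cvg_lim <-//; apply: (@le_lt_trans _ _ ((1 - a)^-1)%:E); last by rewrite ltry.
apply: lime_le; last by apply: nearW; exact: bd.
apply: ereal_nondecreasing_is_cvgn.
exact: (@ge0_nondecreasing_set_nondecreasing_integral _ (measurableTypeR R) R I (hpow a) leb nd mI mh h0).
Qed.

Lemma integral_spow_lty a : 0 < a < 1 -> (\int[leb]_s spow a s < +oo)%E.
Proof.
move=> a01; rewrite ge0_integralD//; last 4 first.
- by move=> s _; exact: hpow_ge0.
- exact: measurable_hpow.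
- by move=> s _; exact: hpow_ge0.
- by apply: (measurableT_comp (measurable_hpow a)); exact: oppr_measurable.
rewrite lte_add_pinfty//; first exact: integral_hpow_lty.
have := @ge0_integral_pushforward _ _ _ _ R (-%R : measurableTypeR R -> measurableTypeR R) (@oppr_measurable R setT) leb setT (hpow a)
  measurableT (measurable_hpow a) (fun s _ => hpow_ge0 a s).
rewrite preimage_setT => <-.
rewrite (_ : (\int[_]_s _ s)%E = (\int[leb]_s hpow a s)%E); first exact: integral_hpow_lty.
by apply: eq_measure_integral => A mA _; exact: lebesgue_measureN.
Qed.

Lemma integral_ppow_lty a : 0 < a < 1 -> (\int[mu]_z ppow a z < +oo)%E.
Proof.
move=> a01; rewrite /leb2 fubini_tonelli1//=; last 2 first.
- exact: measurable_ppow.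
- exact: ppow_ge0.
rewrite /fubini_F /=.
under eq_integral => x _.
  rewrite /ppow /= ge0_integralZl//; last 3 first.
  - exact: measurable_spow.
  - by move=> s _; exact: spow_ge0.
  - exact: spow_ge0.
  over.
have i0 : (0 <= \int[leb]_s spow a s)%E by apply: integral_ge0 => s _; exact: spow_ge0.
rewrite ge0_integralZr//; last 2 first.
- exact: measurable_spow.
- by move=> s _; exact: spow_ge0.
apply: lte_mul_pinfty => //; last exact: integral_spow_lty.
by rewrite ge0_fin_numE//; exact: integral_spow_lty.
Qed.

End PowerSingularity.

(** * Convolution of a dominated kernel with a bounded integrable function *)

Section Integrals.
Variable R : realType.
Implicit Types (M N C B : R) (f g k th : R * R -> R).
Local Notation mu := (@leb2 R).

Definition box (r : R) : set (R * R) := `[- r, r]%classic `*` `[- r, r]%classic.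

Lemma measurable_box r : measurable (box r).
Proof. by apply: measurableX; exact: measurable_itv. Qed.

Lemma leb2_box_lty r : (mu (box r) < +oo)%E.
Proof.
rewrite /leb2 product_measure1E; [|exact: measurable_itv..].
have h : (@leb1 R `[(- r)%R, r%R]%classic < +oo)%E by rewrite /leb1 lebesgue_measure_itv /=; case: ifP => _ //; rewrite -EFinB ltry.
by rewrite lte_mul_pinfty// ge0_fin_numE.
Qed.

Lemma leb2_sigma_finite : sigma_finite setT mu.
Proof.
exists (fun n : nat => box n%:R).
  apply/seteqP; split => // x _.
  exists (Num.bound (Num.max `|x.1| `|x.2|)) => //=.
  have h0 : 0 <= Num.max `|x.1| `|x.2| by rewrite le_max normr_ge0.
  have := archi_boundP h0; set n := Num.bound _ => h.
  by split; rewrite /= in_itv /= -ler_norml (le_trans _ (ltW h))// le_max lexx ?orbT.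
by move=> n; split; [exact: measurable_box|exact: leb2_box_lty].
Qed.

(** [leb2] with its sigma-finiteness attached, as Tonelli on the product of two planes and
    Radon-Nikodym require. *)
Definition leb2s : {sigma_finite_measure set (measurableTypeR R * measurableTypeR R)%type -> \bar R} :=
  HB.pack (mu : set (measurableTypeR R * measurableTypeR R)%type -> \bar R)
  (Measure.on mu)
  (Measure_isSigmaFinite.Build _ _ _ mu leb2_sigma_finite).

Definition convol k th (x : R * R) : R := \int[mu]_y (k (x - y) * th y).

Lemma measurable_subl (x : R * R) :
  measurable_fun setT (fun y : R * R => x - y).
Proof.
apply: (@measurable_fun_pair _ _ _ _ _ _ (fun y : measurableTypeR R * measurableTypeR R => x.1 - y.1 : R) (fun y => x.2 - y.2 : R)).
  by apply: measurable_funB => //; exact: measurable_fst.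
by apply: measurable_funB => //; exact: measurable_snd.
Qed.

Lemma measurable_conv_integrand k th x : measurable_fun setT k -> measurable_fun setT th ->
  measurable_fun setT (fun y : R * R => k (x - y) * th y).
Proof.
by move=> mk mth; apply: measurable_funM => //; apply: (measurableT_comp mk); exact: measurable_subl.
Qed.

(** Integrability plays no part: Tonelli handles the positive and the negative part of the integrand
    separately, and [fine] of the difference is measurable whatever its value. *)
Lemma measurable_conv k th : measurable_fun setT k -> measurable_fun setT th ->
  measurable_fun setT (convol k th).
Proof.
move=> mk mth; rewrite /convol /Rintegral.
pose F := fun z : (measurableTypeR R * measurableTypeR R) * (measurableTypeR R * measurableTypeR R) =>
   (k ((z.1 : R * R) - (z.2 : R * R)) * th z.2)%:E.
have mF : measurable_fun setT F.
  apply/measurable_EFinP; apply: measurable_funM; last first.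
    by apply: measurableT_comp => //; exact: measurable_snd.
  apply: (measurableT_comp mk).
  have m1 (p : R * R -> R) : measurable_fun setT p ->
     measurable_fun setT (fun z : (measurableTypeR R * measurableTypeR R) * (measurableTypeR R * measurableTypeR R) => p z.1).
    by move=> mp; apply: (measurableT_comp mp); exact: measurable_fst.
  have m2 (p : R * R -> R) : measurable_fun setT p ->
     measurable_fun setT (fun z : (measurableTypeR R * measurableTypeR R) * (measurableTypeR R * measurableTypeR R) => p z.2).
    by move=> mp; apply: (measurableT_comp mp); exact: measurable_snd.
  apply: (@measurable_fun_pair _ _ _ _ _ _ (fun z : (measurableTypeR R * measurableTypeR R) * (measurableTypeR R * measurableTypeR R) => z.1.1 - z.2.1 : R) (fun z => z.1.2 - z.2.2 : R)).
    by apply: measurable_funB; [apply: m1|apply: m2]; exact: measurable_fst.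
  by apply: measurable_funB; [apply: m1|apply: m2]; exact: measurable_snd.
apply: (@measurableT_comp _ _ _ _ _ _ fine).
  exact: fine_measurable.
under eq_fun do rewrite integralE.
apply: emeasurable_funB.
  have mp := measurable_funepos mF.
  have := @measurable_fun_fubini_tonelli_F _ _ _ _ R leb2s F^\+%E mp (funepos_ge0 F).
  rewrite /fubini_F.
  apply: eq_measurable_fun => x _; apply: eq_integral => y _.
  by rewrite unlock.
have mp := measurable_funeneg mF.
have := @measurable_fun_fubini_tonelli_F _ _ _ _ R leb2s F^\-%E mp (funeneg_ge0 F).
rewrite /fubini_F.
apply: eq_measurable_fun => x _; apply: eq_integral => y _.
by rewrite unlock.
Qed.

Lemma Rintegral_dominated f (G : R * R -> \bar R) B :
  measurable_fun setT f -> measurable_fun setT G ->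
  (forall x, (`|f x|)%:E <= G x)%E -> (\int[mu]_x G x <= B%:E)%E ->
  mu.-integrable setT (EFin \o f) /\ `|\int[mu]_x f x| <= B.
Proof.
move=> mf mG fG GB.
have iabs : (\int[mu]_x `|(EFin \o f) x| <= B%:E)%E.
  apply: le_trans GB; apply: ge0_le_integral => //.
  - by apply: measurableT_comp => //; exact/measurable_EFinP.
  - by move=> x _; exact: le_trans (fG x).
have i1 : mu.-integrable setT (EFin \o f).
  apply/integrableP; split; first exact/measurable_EFinP.
  by rewrite (le_lt_trans iabs)// ltry.
split => //; rewrite -lee_fin (le_trans _ iabs)//.
rewrite (@EFin_normr_Rintegral _ _ _ mu setT f)//.
apply: le_abse_integral => //; exact/measurable_EFinP.
Qed.

(** [ppow] carries the local singularity and the constant 1 the behaviour at infinity. Against a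
    function in [bddL1] the first is paired with the sup bound, the second with the L^1 bound. *)
Definition kdom (a C : R) k :=
  measurable_fun setT k /\ forall z, ((`|k z|)%:E <= C%:E * (ppow a z + 1))%E.

(** The sup bound is asked at every point, not almost everywhere, so that it passes pointwise
    through a step of the scheme. *)
Definition bddL1 M N th :=
  [/\ measurable_fun setT th, forall x, `|th x| <= M &
      (\int[mu]_x (`|th x|)%:E <= N%:E)%E].

Definition ppow_mass (a : R) : R := fine (\int[mu]_z ppow a z)%E.

Lemma kdom_conv a C k M N th x : 0 < a < 1 -> 0 <= C -> 0 <= M -> kdom a C k -> bddL1 M N th ->
  mu.-integrable setT (fun y : R * R => (k (x - y) * th y)%:E) /\
  `|convol k th x| <= C * (ppow_mass a * M + N).
Proof.
move=> a01 C0 M0 [mk kC] [mth thM thN].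
pose G (y : R * R) : \bar R := (C%:E * (M%:E * ppow a (y - x)%R + (`|th y|)%:E))%E.
have mp : measurable_fun setT (fun y : R * R => ppow a (y - x)%R).
  by apply: measurable_fun_shift; exact: measurable_ppow.
have mth' : measurable_fun setT (fun y : R * R => (`|th y|)%:E).
  by apply/measurable_EFinP; exact: measurableT_comp.
have mG1 : measurable_fun setT (fun y : R * R => M%:E * ppow a (y - x)%R + (`|th y|)%:E)%E.
  by apply: emeasurable_funD => //; exact: measurable_funeM.
have Mp0 (y : R * R) : (0 <= M%:E * ppow a (y - x)%R)%E.
  by apply: mule_ge0; [rewrite lee_fin|exact: ppow_ge0].
apply: (@Rintegral_dominated (fun y => k (x - y) * th y) G).
- exact: measurable_conv_integrand.
- exact: measurable_funeM.
- move=> y; rewrite normrM EFinM /G.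
  apply: (@le_trans _ _ (C%:E * (ppow a (x - y)%R + 1) * `|th y|%:E)%E).
    by rewrite lee_wpmul2r ?lee_fin.
  rewrite -muleA lee_wpmul2l ?lee_fin// muleDl//; last by apply: ge0_adde_def; rewrite inE ?ppow_ge0 ?lee_fin.
  rewrite mul1e leeD// muleC -ppowN opprB lee_wpmul2r ?ppow_ge0// lee_fin.
  exact: thM.
- rewrite /G ge0_integralZl//; last first.
    by move=> y _; apply: adde_ge0; [exact: Mp0|rewrite lee_fin].
  rewrite EFinM lee_wpmul2l ?lee_fin//.
  rewrite ge0_integralD//; last first.
    exact: measurable_funeM.
  rewrite EFinD leeD//.
  rewrite ge0_integralZl//; last by move=> y _; exact: ppow_ge0.
  rewrite (@ge0_integral_shift _ (- x) (ppow a)); last 2 first.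
  - exact: measurable_ppow.
  - exact: ppow_ge0.
  rewrite EFinM muleC /ppow_mass fineK// ge0_fin_numE; first exact: integral_ppow_lty.
  by apply: integral_ge0 => z _; exact: ppow_ge0.
Qed.

End Integrals.

(** * Kernel estimates *)

Section Lines.
Variable R : realType.
Implicit Types (f : R * R -> R) (x v : R * R) (t : R).

Lemma is_derive_line f x v t (df : R) :
  is_derive (x + t *: v) v f df <-> is_derive t 1 (fun s => f (x + s *: v)) df.
Proof.
have E : (fun h : R => h^-1 *: ((f \o shift (x + t *: v)) (h *: v) - f (x + t *: v))) =
  (fun h : R => h^-1 *: (((fun s => f (x + s *: v)) \o shift t) (h *: (1 : R)) - f (x + t *: v))).
  apply/funext => h /=; congr (_ *: (f _ - _)).
  by rewrite [X in _ = x + X]scalerDl /GRing.scale /= mulr1 addrCA addrC; congr (_ + _); rewrite addrC.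
split; case=> D V; split.
- by move: D; rewrite /derivable E.
- by move: V; rewrite /derive E.
- by move: D; rewrite /derivable E.
- by move: V; rewrite /derive E.
Qed.

Lemma mvt_line f v : (forall y, derivable f y v) ->
  forall x t, exists s, `|s| <= `|t| /\ f (x + t *: v) - f x = t * 'D_v f (x + s *: v).
Proof.
move=> df x t.
pose g (s : R) := f (x + s *: v).
have dg (s : R) : is_derive s (1 : R) g ('D_v f (x + s *: v)).
  by apply/(is_derive_line f x v s); apply/derivableP; exact: df.
have cg : continuous g.
  by move=> s; apply: differentiable_continuous; apply/derivable1_diffP; case: (dg s).
have g0 : g 0 = f x by rewrite /g scale0r addr0.
case: (ltgtP t 0) => t0.
- have [|s] := @MVT _ g (fun s => 'D_v f (x + s *: v)) t 0 t0 (fun s _ => dg s).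
    exact: continuous_subspaceT.
  rewrite in_itv /= => /andP[ts s0] E; exists s; split.
    by rewrite !ltr0_norm// lerN2 ltW.
  by rewrite -g0 -[LHS]opprB E sub0r mulrN opprK mulrC.
- have [|s] := @MVT _ g (fun s => 'D_v f (x + s *: v)) 0 t t0 (fun s _ => dg s).
    exact: continuous_subspaceT.
  rewrite in_itv /= => /andP[s0 st] E; exists s; split.
    by rewrite !gtr0_norm// ltW.
  by rewrite -g0 E subr0 mulrC.
- by exists 0; rewrite t0 !scale0r addr0 subrr mul0r normr0.
Qed.

Lemma lipschitz_line f v (L : R) : (forall y, derivable f y v) ->
  (forall y, `|'D_v f y| <= L) ->
  forall x t, `|f (x + t *: v) - f x| <= L * `|t|.
Proof.
move=> df dL x t; have [s [_ ->]] := mvt_line df x t.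
by rewrite normrM mulrC ler_wpM2r.
Qed.

Lemma taylor_line f v (L : R) : (forall y, derivable f y v) ->
  (forall x t, `|'D_v f (x + t *: v) - 'D_v f x| <= L * `|t|) -> 0 <= L ->
  forall x t, `|f (x + t *: v) - f x - t * 'D_v f x| <= L * t ^+ 2.
Proof.
move=> df dL L0 x t; have [s [st ->]] := mvt_line df x t.
rewrite -mulrBr normrM -real_normK ?num_real// expr2 mulrA [leRHS]mulrC ler_wpM2l//.
by rewrite (le_trans (dL x s))// ler_wpM2l.
Qed.

(** Subtracting the Taylor bounds at h and -h leaves an error [2 * L * h ^+ 2], which is divided by
    [2 * h]. *)
Lemma central_difference_line f v (L : R) : (forall y, derivable f y v) ->
  (forall x t, `|'D_v f (x + t *: v) - 'D_v f x| <= L * `|t|) -> 0 <= L ->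
  forall x h, 0 < h ->
  `|(f (x + h *: v) - f (x - h *: v)) / (2 * h) - 'D_v f x| <= L * h.
Proof.
move=> df dL L0 x h h0.
have := taylor_line df dL L0 x h; have := taylor_line df dL L0 x (- h).
rewrite scaleNr sqrrN !ler_norml => /andP[a1 a2] /andP[b1 b2].
have h2 : 0 < 2 * h by rewrite mulr_gt0.
rewrite lerBlDr lerBrDr ler_pdivrMr// ler_pdivlMr//.
by apply/andP; split; lra.
Qed.

End Lines.

Section Kernels.
Variable R : realType.
Implicit Types (x z : R * R) (t b c d : R).
Local Notation e1 := ((1 : R), (0 : R)).
Local Notation e2 := ((0 : R), (1 : R)).

Definition sqd d z : R := z.1 ^+ 2 + z.2 ^+ 2 + d ^+ 2.

Lemma shift_e1 x t : x + t *: e1 = (x.1 + t, x.2).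
Proof.
apply/pair_equal_spec; split.
  by change (x.1 + t * 1 = x.1 + t); rewrite mulr1.
by change (x.2 + t * 0 = x.2); rewrite mulr0 addr0.
Qed.

Lemma shift_e2 x t : x + t *: e2 = (x.1, x.2 + t).
Proof.
apply/pair_equal_spec; split.
  by change (x.1 + t * 0 = x.1); rewrite mulr0 addr0.
by change (x.2 + t * 1 = x.2 + t); rewrite mulr1.
Qed.

Lemma is_derive_line0 (f : R * R -> R) x v (df : R) :
  is_derive (0 : R) 1 (fun s => f (x + s *: v)) df -> is_derive x v f df.
Proof. by move/(is_derive_line f x v 0); rewrite scale0r addr0. Qed.

Lemma is_derive_quadratic_powR (p q b t : R) : 0 < (p + t) ^+ 2 + q ->
  is_derive t 1 (fun s : R => ((p + s) ^+ 2 + q) `^ b)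
    (b * (2 * (p + t)) * ((p + t) ^+ 2 + q) `^ (b - 1)).
Proof.
move=> h.
have d0 : is_derive t 1 (cst p + id : R -> R) 1.
  by apply: is_derive_eq; rewrite add0r.
have d1 : is_derive t 1 (fun s : R => (p + s) ^+ 2 + q) (2 * (p + t)).
  have := @is_deriveD R R R ((cst p + id) ^+ 2) (cst q) t 1 _ _ (is_deriveX 2 d0) (is_derive_cst q t 1).
  by rewrite /= expr1 addr0 /GRing.scale /= mulr1.
have := @is_derive1_comp R (@powR R ^~ b) (fun s => (p + s) ^+ 2 + q) t _ _ (is_derive1_powR b h) d1.
by move=> H; apply: (is_derive_eq H); ring.
Qed.

Lemma is_derive_linear_powR (p q b t : R) : 0 < (p + t) ^+ 2 + q ->
  is_derive t 1 (fun s : R => (p + s) * ((p + s) ^+ 2 + q) `^ b)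
    (((p + t) ^+ 2 + q) `^ b + (p + t) * (b * (2 * (p + t)) * ((p + t) ^+ 2 + q) `^ (b - 1))).
Proof.
move=> h.
have d0 : is_derive t 1 (cst p + id : R -> R) 1.
  by apply: is_derive_eq; rewrite add0r.
have := is_deriveM d0 (is_derive_quadratic_powR b h).
by move=> H; apply: (is_derive_eq H); rewrite /GRing.scale /= mulr1 addrC.
Qed.

Lemma sqd_gt0 d z : 0 < d -> 0 < sqd d z.
Proof. by move=> d0; rewrite /sqd ltr_wpDl ?exprn_gt0// addr_ge0 ?sqr_ge0. Qed.

Lemma sqd0_gt0 z : z != 0 -> 0 < sqd 0 z.
Proof.
move=> z0; rewrite /sqd expr0n addr0 lt_neqAle addr_ge0 ?sqr_ge0// andbT eq_sym.
rewrite paddr_eq0 ?sqr_ge0// !sqrf_eq0; apply: contra z0 => /andP[/eqP h1 /eqP h2].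
by apply/eqP; move: h1 h2; case: (z) => a b' /= -> ->.
Qed.

Lemma le_sqd d z : sqd 0 z <= sqd d z.
Proof. by rewrite /sqd lerD2l expr0n sqr_ge0. Qed.

Lemma is_derive_powR_e1 b d x : 0 < sqd d x ->
  is_derive x e1 (fun z => sqd d z `^ b) (b * (2 * x.1) * sqd d x `^ (b - 1)).
Proof.
move=> h; apply: is_derive_line0.
rewrite (_ : (fun s => _) = (fun s => ((x.1 + s) ^+ 2 + (x.2 ^+ 2 + d ^+ 2)) `^ b)).
  have := @is_derive_quadratic_powR x.1 (x.2 ^+ 2 + d ^+ 2) b 0.
  by rewrite addr0 addrA => /(_ h).
by apply/funext => s; rewrite shift_e1 /sqd /= addrA.
Qed.

Lemma is_derive_powR_e2 b d x : 0 < sqd d x ->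
  is_derive x e2 (fun z => sqd d z `^ b) (b * (2 * x.2) * sqd d x `^ (b - 1)).
Proof.
move=> h; apply: is_derive_line0.
have E s : sqd d (x + s *: e2) = (x.2 + s) ^+ 2 + (x.1 ^+ 2 + d ^+ 2).
  by rewrite shift_e2 /sqd /=; ring.
under eq_fun do rewrite E.
have Ex : sqd d x = (x.2 + 0) ^+ 2 + (x.1 ^+ 2 + d ^+ 2) by rewrite /sqd; ring.
rewrite Ex in h *; have := is_derive_quadratic_powR b h.
by rewrite [in 2 * _]addr0.
Qed.

(* The common shape of both components of the regularized kernel. *)
Definition rker c b d z : R := c * z.1 * sqd d z `^ b.

Lemma is_derive_rker_e1 c b d x : 0 < sqd d x ->
  is_derive x e1 (rker c b d) (c * (sqd d x `^ b + x.1 * (b * (2 * x.1) * sqd d x `^ (b - 1)))).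
Proof.
move=> h; apply: is_derive_line0.
have Ex : sqd d x = (x.1 + 0) ^+ 2 + (x.2 ^+ 2 + d ^+ 2) by rewrite /sqd; ring.
rewrite Ex in h *; have := is_deriveZ c (is_derive_linear_powR b h).
rewrite [in 2 * _]addr0 [in X in _ -> X]addr0 => H; rewrite -/(GRing.scale c _).
rewrite (_ : (fun s => _) = c \*: (fun s => (x.1 + s) * ((x.1 + s) ^+ 2 + (x.2 ^+ 2 + d ^+ 2)) `^ b)) //.
  by apply: (is_derive_eq H); rewrite !addr0.
apply/funext => s; rewrite shift_e1 /rker /sqd /= addrA /GRing.scale /=; ring.
Qed.

Lemma is_derive_rker_e2 c b d x : 0 < sqd d x ->
  is_derive x e2 (rker c b d) (c * (x.1 * (b * (2 * x.2) * sqd d x `^ (b - 1)))).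
Proof.
move=> h; apply: is_derive_line0.
have Ex : sqd d x = (x.2 + 0) ^+ 2 + (x.1 ^+ 2 + d ^+ 2) by rewrite /sqd; ring.
rewrite Ex in h *; have H := is_deriveZ (c * x.1) (is_derive_quadratic_powR b h).
rewrite (_ : (fun s => _) = (c * x.1) \*: (fun s => ((x.2 + s) ^+ 2 + (x.1 ^+ 2 + d ^+ 2)) `^ b)).
  by apply: (is_derive_eq H); rewrite !addr0 /GRing.scale /= -!mulrA.
apply/funext => s; rewrite shift_e2 /rker /sqd /= /GRing.scale /=; congr (_ * _ `^ _); ring.
Qed.

Lemma npowR_le (u v b : R) : 0 < u -> u <= v -> b <= 0 -> v `^ b <= u `^ b.
Proof.
move=> u0 uv b0; have v0 := lt_le_trans u0 uv.
have [b' b'0 ->] : exists2 b', 0 <= b' & b = - b' by exists (- b); rewrite ?oppr_ge0 ?opprK.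
by rewrite !powRN lef_pV2 ?posrE ?powR_gt0// ge0_ler_powR ?nnegrE ?(ltW u0) ?(ltW v0).
Qed.

Lemma powR_le_sqd b d z : 0 < d -> b <= 0 -> sqd d z `^ b <= (d ^+ 2) `^ b.
Proof.
move=> d0 b0; have d2 : 0 < d ^+ 2 by rewrite exprn_gt0.
by rewrite npowR_le// /sqd lerDr addr_ge0 ?sqr_ge0.
Qed.

Lemma powR_subr1 (s b : R) : 0 < s -> s `^ (b - 1) = s `^ b / s.
Proof. by move=> s0; rewrite powRB ?(gt_eqF s0) ?implybT// powRr1// ltW. Qed.

Lemma powRD_gt0 (s a b : R) : 0 < s -> s `^ (a + b) = s `^ a * s `^ b.
Proof. by move=> s0; rewrite powRD// (gt_eqF s0) implybT. Qed.

Lemma rker_bound c b d z : 0 < d -> b + 2^-1 <= 0 -> `|rker c b d z| <= `|c| * (d ^+ 2) `^ (b + 2^-1).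
Proof.
move=> d0 b0; rewrite /rker normrM normrM -mulrA ler_wpM2l//.
rewrite (ger0_norm (powR_ge0 _ _)).
have s0 := sqd_gt0 z d0.
have zs : `|z.1| <= sqd d z `^ 2^-1.
  rewrite powR12_sqrt ?(ltW s0)// -sqrtr_sqr ler_wsqrtr// /sqd -addrA lerDl.
  by rewrite addr_ge0 ?sqr_ge0.
apply: (@le_trans _ _ (sqd d z `^ 2^-1 * sqd d z `^ b)).
  by rewrite ler_wpM2r ?powR_ge0.
by rewrite -powRD_gt0// addrC powR_le_sqd.
Qed.

Lemma rker_dom c b d z : z != 0 -> b <= 0 -> `|rker c b d z| <= `|c| * sqd 0 z `^ (b + 2^-1).
Proof.
move=> z0 b0; rewrite /rker normrM normrM -mulrA ler_wpM2l//.
rewrite (ger0_norm (powR_ge0 _ _)).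
have s0 := sqd0_gt0 z0.
have zs : `|z.1| <= sqd 0 z `^ 2^-1.
  rewrite powR12_sqrt ?(ltW s0)// -sqrtr_sqr ler_wsqrtr// /sqd -addrA lerDl.
  by rewrite addr_ge0 ?sqr_ge0.
rewrite addrC powRD_gt0// ler_pM ?powR_ge0//.
by rewrite npowR_le// le_sqd.
Qed.

Lemma rker_lipschitz_e1 c b d x t : 0 < d -> - 3 / 2 <= b <= 0 ->
  `|rker c b d (x + t *: e1) - rker c b d x| <= 4 * `|c| * (d ^+ 2) `^ b * `|t|.
Proof.
move=> d0 /andP[b1 b0]; apply: lipschitz_line => y.
  by case: (is_derive_rker_e1 c b (sqd_gt0 y d0)).
have s0 := sqd_gt0 y d0.
have [_ ->] := is_derive_rker_e1 c b s0.
rewrite normrM [4 * _]mulrC -[leRHS]mulrA ler_wpM2l//.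
apply: (@le_trans _ _ (4 * sqd d y `^ b)); last by rewrite ler_wpM2l ?powR_le_sqd.
rewrite powR_subr1//.
have -> : sqd d y `^ b + y.1 * (b * (2 * y.1) * (sqd d y `^ b / sqd d y)) =
  (1 + 2 * b * (y.1 ^+ 2 / sqd d y)) * sqd d y `^ b by field; rewrite gt_eqF.
rewrite normrM (ger0_norm (powR_ge0 _ _)) ler_wpM2r ?powR_ge0//.
have r0 : 0 <= y.1 ^+ 2 / sqd d y by rewrite divr_ge0 ?sqr_ge0// ltW.
have r1 : y.1 ^+ 2 / sqd d y <= 1.
  by rewrite ler_pdivrMr// mul1r /sqd -addrA lerDl addr_ge0 ?sqr_ge0.
by rewrite ler_norml; apply/andP; split; nra.
Qed.

Lemma rker_lipschitz_e2 c b d x t : 0 < d -> - 3 / 2 <= b <= 0 ->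
  `|rker c b d (x + t *: e2) - rker c b d x| <= 4 * `|c| * (d ^+ 2) `^ b * `|t|.
Proof.
move=> d0 /andP[b1 b0]; apply: lipschitz_line => y.
  by case: (is_derive_rker_e2 c b (sqd_gt0 y d0)).
have s0 := sqd_gt0 y d0.
have [_ ->] := is_derive_rker_e2 c b s0.
rewrite normrM [4 * _]mulrC -[leRHS]mulrA ler_wpM2l//.
apply: (@le_trans _ _ (4 * sqd d y `^ b)); last by rewrite ler_wpM2l ?powR_le_sqd.
rewrite powR_subr1//.
have -> : y.1 * (b * (2 * y.2) * (sqd d y `^ b / sqd d y)) =
  (b * ((2 * y.1 * y.2) / sqd d y)) * sqd d y `^ b by field; rewrite gt_eqF.
rewrite normrM (ger0_norm (powR_ge0 _ _)) ler_wpM2r ?powR_ge0//.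
have r1 : `|2 * y.1 * y.2 / sqd d y| <= 1.
  rewrite normrM normfV (gtr0_norm s0) ler_pdivrMr// mul1r ler_norml /sqd.
  have := sqr_ge0 (y.1 + y.2); have := sqr_ge0 (y.1 - y.2); have := sqr_ge0 d.
  by move=> h1 h2 h3; apply/andP; split; nra.
rewrite normrM; have : `|b| <= 3 / 2 by rewrite ler_norml; apply/andP; split; lra.
by move: r1; have := normr_ge0 b; have := normr_ge0 (2 * y.1 * y.2 / sqd d y); nra.
Qed.

Lemma rker_diff c b d k z : z != 0 -> 0 < d -> - 2 <= b <= 0 -> 0 < k <= 2 ->
  `|rker c b 0 z - rker c b d z| <= 2 * `|c| * d `^ k * sqd 0 z `^ (b + 2^-1 - k / 2).
Proof.
move=> z0 d0 /andP[b2 b0] /andP[k0 k2].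
have s0 := sqd0_gt0 z0; have sd := sqd_gt0 z d0.
set E := sqd 0 z in s0 *; set S := sqd d z in sd *.
have SE : S = E + d ^+ 2 by rewrite /S /E /sqd expr0n addr0.
have zs : `|z.1| <= E `^ 2^-1.
  rewrite powR12_sqrt ?(ltW s0)// -sqrtr_sqr ler_wsqrtr// /E /sqd -addrA lerDl.
  by rewrite addr_ge0 ?sqr_ge0.
pose r := E / S.
have r0 : 0 < r by rewrite divr_gt0.
have r1 : r <= 1 by rewrite ler_pdivrMr// mul1r SE lerDl sqr_ge0.
have rE : 1 - r = d ^+ 2 / S by rewrite /r SE; field; rewrite -SE gt_eqF.
have Sb : S `^ b = E `^ b * r `^ (- b).
  rewrite /r powRM ?invr_ge0 ?(ltW s0) ?(ltW sd)// mulrA -powRD_gt0// subrr.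
  by rewrite powRr0 mul1r -powR_inv1 ?(ltW sd)// -powRrM mulrNN mul1r.
have rb : r ^+ 2 <= r `^ (- b).
  by rewrite -powR_mulrn ?(ltW r0)// ger_powR ?r0//; lra.
have rb1 : r `^ (- b) <= 1.
  by have := @ger_powR _ r _ 0 (- b); rewrite powRr0; apply; [rewrite r0 r1|lra].
have dS : d ^+ 2 / S <= d `^ k * E `^ (- (k / 2)).
  apply: (@le_trans _ _ ((d ^+ 2 / S) `^ (k / 2))).
    rewrite -[leLHS]powRr1 ?divr_ge0 ?sqr_ge0 ?(ltW sd)// ger_powR//; last by lra.
    by rewrite -rE subr_gt0 lerBlDr lerDl (ltW r0) andbT -subr_gt0 rE divr_gt0 ?exprn_gt0.
  rewrite powRM ?invr_ge0 ?sqr_ge0 ?(ltW sd)// -powR_mulrn ?(ltW d0)// -powRrM.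
  have -> : 2%:R * (k / 2) = k by field.
  rewrite ler_wpM2l ?powR_ge0// -powR_inv1 ?(ltW sd)// -powRrM mulN1r npowR_le//.
    by rewrite SE lerDl sqr_ge0.
  by rewrite oppr_le0 divr_ge0// ltW.
rewrite /rker -/E -/S -mulrBr normrM normrM Sb -{1}[E `^ b]mulr1 -mulrBr normrM.
rewrite (ger0_norm (powR_ge0 _ _)) (ger0_norm (_ : 0 <= 1 - r `^ (- b))) ?subr_ge0//.
have -> : 2 * `|c| * d `^ k * E `^ (b + 2^-1 - k / 2) =
   `|c| * E `^ 2^-1 * (E `^ b * (2 * (d `^ k * E `^ (- (k / 2))))).
  by rewrite !powRD_gt0//; ring.
rewrite ler_pM ?mulr_ge0 ?powR_ge0 ?subr_ge0 ?normr_ge0//.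
  by rewrite ler_wpM2l.
rewrite ler_wpM2l ?powR_ge0//.
apply: (@le_trans _ _ (2 * (1 - r))); last by rewrite rE ler_wpM2l.
by nra.
Qed.

(** If a coordinate exceeds 1 in absolute value, the left side is at most 1. In the unit square
    |z.1| |z.2| <= |z|^2 bounds it by a product of one-variable powers, which is what makes the
    weight split. *)
Lemma sqd_le_ppow a z : 0 < a -> z != 0 -> ((sqd 0 z `^ (- a))%:E <= ppow a z + 1)%E.
Proof.
move=> a0 z0; have s0 := sqd0_gt0 z0.
have E0 : sqd 0 z = z.1 ^+ 2 + z.2 ^+ 2 by rewrite /sqd expr0n addr0.
have big (t : R) : 1 < `|t| -> t ^+ 2 <= sqd 0 z -> ((sqd 0 z `^ (- a))%:E <= ppow a z + 1)%E.
  move=> t1 ts; apply: (@le_trans _ _ 1%E); last by rewrite leeDr// ppow_ge0.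
  rewrite lee_fin powRN invf_le1 ?powR_gt0//.
  have s1 : 1 <= sqd 0 z.
    by rewrite (le_trans _ ts)// -real_normK ?num_real// exprn_ege1// ltW.
  by have := @ler_powR _ (sqd 0 z) s1 0 a (ltW a0); rewrite powRr0.
have [h1|h1] := ltP 1 `|z.1|.
  by apply: (big _ h1); rewrite E0 lerDl sqr_ge0.
have [h2|h2] := ltP 1 `|z.2|.
  by apply: (big _ h2); rewrite E0 lerDr sqr_ge0.
have sp (s : R) : s != 0 -> `|s| <= 1 -> (((`|s|) `^ (- a))%:E <= spow a s)%E.
  move=> s_neq0 s1; rewrite /spow /hpow oppr_eq0 (negbTE s_neq0).
  case: (ltgtP s 0) => [s_lt0|s_gt0|/eqP]; last by rewrite (negbTE s_neq0).
    by rewrite oppr_gt0 s_lt0 andTb -(ltr0_norm s_lt0) s1 add0e.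
  by rewrite (gtr0_norm s_gt0) in s1 *; rewrite s1 oppr_gt0 ltNge (ltW s_gt0) andFb adde0.
(* On an axis one factor of [ppow] is +oo; strict positivity of the other excludes the convention 0
   * oo = 0. *)
have spgt (s : R) : `|s| <= 1 -> (0 < spow a s)%E.
  move=> s1; have [->|s_neq0] := eqVneq s 0.
    by rewrite /spow /hpow oppr0 eqxx addye// ltry.
  by rewrite (lt_le_trans _ (sp _ s_neq0 s1))// lte_fin powR_gt0// normr_gt0.
have sp0 : spow a 0 = +oo%E by rewrite /spow /hpow oppr0 eqxx addye.
have [z1|z1] := eqVneq z.1 0.
  by rewrite /ppow z1 sp0 gt0_mulye ?spgt// addye// leey.
have [z2|z2] := eqVneq z.2 0.
  by rewrite /ppow z2 sp0 gt0_muley ?spgt// addye// leey.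
rewrite (@le_trans _ _ (ppow a z))//; last by rewrite leeDl.
rewrite (@le_trans _ _ ((`|z.1| `^ (- a))%:E * (`|z.2| `^ (- a))%:E)%E)//; last first.
  by apply: lee_pmul; rewrite ?lee_fin ?powR_ge0//; exact: sp.
rewrite -EFinM lee_fin -powRM// npowR_le ?mulr_gt0 ?normr_gt0 ?oppr_le0 ?(ltW a0)// E0.
rewrite -(real_normK (num_real z.1)) -(real_normK (num_real z.2)).
by have := sqr_ge0 (`|z.1| - `|z.2|); have := normr_ge0 z.1; have := normr_ge0 z.2; nra.
Qed.

End Kernels.

(** * The kernel k_m and its regularizations *)

Section RieszKernel.
Variable R : realType.
Variable m : R.
Hypotheses (m1 : 1 < m) (m2 : m < 2).
Implicit Types (x z : R * R) (t d h r : R).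
Local Notation e1 := ((1 : R), (0 : R)).
Local Notation e2 := ((0 : R), (1 : R)).

Definition gam : R := Gamma ((2 - m) / 2) / (2 `^ (m / 2) * pi * `|Gamma (m / 2)|).
Definition kcst : R := gam * (m - 2).
Definition kdeg : R := (m - 4) / 2.
(* [Gd d] is G_m with |x|^2 replaced by |x|^2 + d^2, and [(K1 d, K2 d)] is its
   perpendicular gradient; [d = 0] gives [km m] off the origin. *)
Definition Gd d z : R := gam * sqd d z `^ ((m - 2) / 2).
(** The exchange of coordinates turns the second derivative direction into the first, so that one
    function [rker] serves both components of the kernel. *)
Definition swp z : R * R := (z.2, z.1).
Definition K2 d z : R := rker kcst kdeg d z.
Definition K1 d z : R := - rker kcst kdeg d (swp z).
(** The summand 1 gives positivity without computing [gam]; a positive constant is needed for [kC]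
    times the value +oo of [ppow] at the origin to dominate. *)
Definition kC : R := `|kcst| + 1.
Definition kL d : R := 4 * `|kcst| * (d ^+ 2) `^ kdeg.
Definition kB d : R := `|kcst| * (d ^+ 2) `^ (kdeg + 2^-1).

Local Ltac mlra := have ? := m1; have ? := m2; lra.

Lemma kC_gt0 : 0 < kC. Proof. by rewrite /kC ltr_wpDl. Qed.
Lemma kL_ge0 d : 0 <= kL d. Proof. by rewrite !mulr_ge0// powR_ge0. Qed.
Lemma kB_ge0 d : 0 <= kB d. Proof. by rewrite !mulr_ge0// powR_ge0. Qed.

Lemma sqd_swp d z : sqd d (swp z) = sqd d z.
Proof. by rewrite /sqd /swp /= [z.2 ^+ 2 + _]addrC. Qed.

Lemma swp_eq0 z : (swp z == 0) = (z == 0).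
Proof. by case: z => a b; rewrite /swp /=; apply/eqP/eqP => -[-> ->]. Qed.

Lemma swp_e1 z t : swp (z + t *: e1) = swp z + t *: e2.
Proof. by rewrite shift_e1 shift_e2. Qed.

Lemma swp_e2 z t : swp (z + t *: e2) = swp z + t *: e1.
Proof. by rewrite shift_e1 shift_e2. Qed.

Lemma kdeg_itv : - 3 / 2 <= kdeg <= 0.
Proof. have [h1 h2] : - 3 / 2 <= (m - 4) / 2 /\ (m - 4) / 2 <= 0 by split; mlra. by rewrite /kdeg h1 h2. Qed.

Lemma measurable_swp : measurable_fun setT swp.
Proof.
apply: (@measurable_fun_pair _ _ _ _ _ _ (fun y : measurableTypeR R * measurableTypeR R => y.2 : R) (fun y => y.1 : R)).
  exact: measurable_snd.
exact: measurable_fst.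
Qed.

Lemma measurable_sqd d : measurable_fun setT (sqd d).
Proof.
rewrite /sqd; apply: measurable_funD => //; apply: measurable_funD; apply: measurable_funX.
  exact: (@measurable_fst _ _ (measurableTypeR R) (measurableTypeR R)).
exact: (@measurable_snd _ _ (measurableTypeR R) (measurableTypeR R)).
Qed.

Lemma measurable_rker c b d : measurable_fun setT (rker c b d).
Proof.
apply: measurable_funM.
  by apply: measurable_funM.
by apply: (measurableT_comp (measurable_powR _)); exact: measurable_sqd.
Qed.

Lemma measurable_K2 d : measurable_fun setT (K2 d).
Proof. exact: measurable_rker. Qed.

Lemma measurable_K1 d : measurable_fun setT (K1 d).
Proof.
apply: measurable_funN; apply: (measurableT_comp (measurable_rker _ _ _)).
exact: measurable_swp.
Qed.

Lemma measurable_Gd d : measurable_fun setT (Gd d).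
Proof.
apply: measurable_funM => //.
by apply: (measurableT_comp (measurable_powR _)); exact: measurable_sqd.
Qed.

Lemma GmE : Gm m = Gd 0.
Proof.
apply/funext => z; rewrite /Gm /Gd; congr (_ * _).
rewrite /enorm /sqd expr0n addr0 -powR12_sqrt ?addr_ge0 ?sqr_ge0//.
by rewrite -powRrM; congr (_ `^ _); field.
Qed.

Lemma is_derive_Gd_e1 d z : 0 < sqd d z -> is_derive z e1 (Gd d) (K2 d z).
Proof.
move=> h; have H := is_deriveZ gam (is_derive_powR_e1 ((m - 2) / 2) h).
apply: (is_derive_eq H); rewrite /K2 /rker /kcst /kdeg /GRing.scale /=.
have -> : (m - 2) / 2 - 1 = (m - 4) / 2 by field.
by field.
Qed.

Lemma is_derive_Gd_e2 d z : 0 < sqd d z -> is_derive z e2 (Gd d) (- K1 d z).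
Proof.
move=> h; have H := is_deriveZ gam (is_derive_powR_e2 ((m - 2) / 2) h).
apply: (is_derive_eq H); rewrite /K1 opprK /rker sqd_swp /kcst /kdeg /GRing.scale /=.
have -> : (m - 2) / 2 - 1 = (m - 4) / 2 by field.
by field.
Qed.

Lemma kmE z : z != 0 -> km m z = (K1 0 z, K2 0 z).
Proof.
move=> /sqd0_gt0 z0; rewrite /km /d1 /d2 GmE.
have [_ ->] := is_derive_Gd_e1 z0; have [_ ->] := is_derive_Gd_e2 z0.
by rewrite opprK.
Qed.

(** The formula for [km] holds off the origin only; the value there, a derivative that need not
    exist, affects a single measurable point. *)
Lemma measurable_offzero (f g : R * R -> R) : measurable_fun setT g ->
  (forall z, z != 0 -> f z = g z) -> measurable_fun setT f.
Proof.
move=> mg fg.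
rewrite (_ : f = fun z => if (z.1 == 0) && (z.2 == 0) then f 0 else g z).
  by apply: measurable_fun_ifT => //=; apply: measurable_and; exact: measurable_fun_eqr.
apply/funext => -[a b] /=; have [->|a0] := eqVneq a 0; last first.
  by apply: fg; apply: contra a0 => /eqP[->].
have [->//|b0] := eqVneq b 0.
by apply: fg; apply: contra b0 => /eqP[->].
Qed.

Definition km1 z : R := (km m z).1.
Definition km2 z : R := (km m z).2.

Lemma measurable_km1 : measurable_fun setT km1.
Proof. by apply: (measurable_offzero (measurable_K1 0)) => z z0; rewrite /km1 kmE. Qed.

Lemma measurable_km2 : measurable_fun setT km2.
Proof. by apply: (measurable_offzero (measurable_K2 0)) => z z0; rewrite /km2 kmE. Qed.

(** These are exponents of 1/|z|^2, integrable near 0 when below 1. [ka0] is that of k_m; [kap] is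
    the rate in d of the regularization error, and [ka1 = ka0 + kap / 2] is the worsened exponent it
    costs, still below 1 because m > 1. *)
Definition ka0 : R := (3 - m) / 2.
Definition kap : R := (m - 1) / 2.
Definition ka1 : R := (5 - m) / 4.

Lemma ka0_itv : 0 < ka0 < 1. Proof. by rewrite /ka0; apply/andP; split; mlra. Qed.
Lemma ka1_itv : 0 < ka1 < 1. Proof. by rewrite /ka1; apply/andP; split; mlra. Qed.

Lemma kdom_offzero (a C : R) (f : R * R -> R) : 0 < a -> 0 < C -> measurable_fun setT f ->
  (forall z, z != 0 -> `|f z| <= C * sqd 0 z `^ (- a)) -> kdom a C f.
Proof.
move=> a0 C0 mf fC; split => // z; have [->|z0] := eqVneq z 0.
  have -> : ppow a 0 = +oo%E.
    by rewrite /ppow /= /spow /hpow oppr0 eqxx addye// mulyy.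
  by rewrite addye// gt0_muley ?lte_fin// leey.
apply: (@le_trans _ _ (C%:E * (sqd 0 z `^ (- a))%:E)%E).
  by rewrite -EFinM lee_fin fC.
by rewrite lee_wpmul2l ?lee_fin ?(ltW C0)// sqd_le_ppow.
Qed.

Lemma rker_dom_kdeg d z : z != 0 -> `|rker kcst kdeg d z| <= kC * sqd 0 z `^ (- ka0).
Proof.
move=> z0; have [_ b0] := andP kdeg_itv.
apply: (le_trans (rker_dom _ _ z0 b0)).
have -> : kdeg + 2^-1 = - ka0 by rewrite /kdeg /ka0; field.
by rewrite ler_wpM2r ?powR_ge0// lerDl.
Qed.

Lemma rker_diff_kdeg d z : z != 0 -> 0 < d ->
  `|rker kcst kdeg 0 z - rker kcst kdeg d z| <= 2 * kC * d `^ kap * sqd 0 z `^ (- ka1).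
Proof.
move=> z0 d0; have [b1 b0] := andP kdeg_itv.
apply: le_trans (rker_diff _ z0 d0 _ (_ : 0 < kap <= 2)) _.
- by apply/andP; split; mlra.
- by rewrite /kap; apply/andP; split; mlra.
have -> : kdeg + 2^-1 - kap / 2 = - ka1 by rewrite /kdeg /kap /ka1; field.
rewrite ler_wpM2r ?powR_ge0// ler_wpM2r ?powR_ge0// ler_wpM2l//.
by rewrite lerDl.
Qed.

Lemma kdom_K2 d : kdom ka0 kC (K2 d).
Proof.
apply: kdom_offzero; rewrite ?kC_gt0//; [by have /andP[] := ka0_itv|exact: measurable_K2|].
by move=> z z0; exact: rker_dom_kdeg.
Qed.

Lemma kdom_K1 d : kdom ka0 kC (K1 d).
Proof.
apply: kdom_offzero; rewrite ?kC_gt0//; [by have /andP[] := ka0_itv|exact: measurable_K1|].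
by move=> z z0; rewrite normrN -(sqd_swp 0) rker_dom_kdeg// swp_eq0.
Qed.

Lemma kdom_km1 : kdom ka0 kC km1.
Proof.
apply: kdom_offzero; rewrite ?kC_gt0//; [by have /andP[] := ka0_itv|exact: measurable_km1|].
by move=> z z0; rewrite /km1 kmE//= normrN -(sqd_swp 0) rker_dom_kdeg// swp_eq0.
Qed.

Lemma kdom_km2 : kdom ka0 kC km2.
Proof.
apply: kdom_offzero; rewrite ?kC_gt0//; [by have /andP[] := ka0_itv|exact: measurable_km2|].
by move=> z z0; rewrite /km2 kmE//= rker_dom_kdeg.
Qed.

Lemma kdom_diff1 d : 0 < d -> kdom ka1 (2 * kC * d `^ kap) (fun z => km1 z - K1 d z).
Proof.
move=> d0; apply: kdom_offzero.
- by have /andP[] := ka1_itv.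
- by rewrite !mulr_gt0 ?kC_gt0 ?powR_gt0.
- by apply: measurable_funB; [exact: measurable_km1|exact: measurable_K1].
move=> z z0; rewrite /km1 kmE//= /K1 -opprD normrN -(sqd_swp 0).
by apply: rker_diff_kdeg => //; rewrite swp_eq0.
Qed.

Lemma kdom_diff2 d : 0 < d -> kdom ka1 (2 * kC * d `^ kap) (fun z => km2 z - K2 d z).
Proof.
move=> d0; apply: kdom_offzero.
- by have /andP[] := ka1_itv.
- by rewrite !mulr_gt0 ?kC_gt0 ?powR_gt0.
- by apply: measurable_funB; [exact: measurable_km2|exact: measurable_K2].
by move=> z z0; rewrite /km2 kmE//=; exact: rker_diff_kdeg.
Qed.

Definition lip (L : R) (k : R * R -> R) := forall z t,
  `|k (z + t *: e1) - k z| <= L * `|t| /\ `|k (z + t *: e2) - k z| <= L * `|t|.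

Lemma lip_K2 d : 0 < d -> lip (kL d) (K2 d).
Proof.
move=> d0 z t; split.
  by apply: rker_lipschitz_e1 => //; exact: kdeg_itv.
by apply: rker_lipschitz_e2 => //; exact: kdeg_itv.
Qed.

Lemma lip_K1 d : 0 < d -> lip (kL d) (K1 d).
Proof.
move=> d0 z t; split; rewrite /K1 -opprD normrN ?swp_e1 ?swp_e2.
  by apply: rker_lipschitz_e2 => //; exact: kdeg_itv.
by apply: rker_lipschitz_e1 => //; exact: kdeg_itv.
Qed.

Lemma K2_bound d z : 0 < d -> `|K2 d z| <= kB d.
Proof. by move=> d0; apply: rker_bound => //; rewrite /kdeg; mlra. Qed.

Lemma K1_bound d z : 0 < d -> `|K1 d z| <= kB d.
Proof. by move=> d0; rewrite normrN; apply: rker_bound => //; rewrite /kdeg; mlra. Qed.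

(** Outside the box |z| >= r, and the decay exponent [2 * ka0 = 3 - m] exceeds 1 because m < 2. *)
Lemma box_decay r z : 1 <= r -> ~ box r z -> sqd 0 z `^ (- ka0) <= r^-1.
Proof.
move=> r1 nb; have r0 : 0 < r by mlra.
have rs : r ^+ 2 <= sqd 0 z.
  rewrite leNgt; apply/negP => sr; apply: nb.
  have : z.1 ^+ 2 < r ^+ 2.
    by apply: le_lt_trans sr; rewrite /sqd expr0n addr0 lerDl sqr_ge0.
  have : z.2 ^+ 2 < r ^+ 2.
    by apply: le_lt_trans sr; rewrite /sqd expr0n addr0 lerDr sqr_ge0.
  rewrite -[z.1 ^+ 2]real_normK ?num_real// -[z.2 ^+ 2]real_normK ?num_real//.
  rewrite !ltr_pXn2r ?nnegrE ?normr_ge0 ?(ltW r0)// => h2 h1.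
  by split; rewrite /= in_itv /= -ler_norml ltW.
have /andP[a0 a1] := ka0_itv.
apply: (@le_trans _ _ ((r ^+ 2) `^ (- ka0))).
  by rewrite npowR_le ?exprn_gt0// oppr_le0 ltW.
rewrite -powR_mulrn ?(ltW r0)// -powRrM -powR_inv1 ?(ltW r0)//.
by apply: ler_powR => //; rewrite /ka0; mlra.
Qed.

Lemma box0 r : 0 <= r -> box r 0.
Proof. by move=> r0; split; rewrite /= in_itv /= oppr_le0 r0. Qed.

Lemma K2_decay d r z : 1 <= r -> ~ box r z -> `|K2 d z| <= kC / r.
Proof.
move=> r1 nb; have z0 : z != 0.
  by apply/eqP => z0; apply: nb; rewrite z0; apply: box0; mlra.
apply: le_trans (rker_dom_kdeg d z0) _.
by rewrite ler_wpM2l ?(ltW kC_gt0)// box_decay.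
Qed.

Lemma K1_decay d r z : 1 <= r -> ~ box r z -> `|K1 d z| <= kC / r.
Proof.
move=> r1 nb; have z0 : z != 0.
  by apply/eqP => z0; apply: nb; rewrite z0; apply: box0; mlra.
rewrite normrN; apply: (le_trans (rker_dom_kdeg d (_ : swp z != 0))).
  by rewrite swp_eq0.
by rewrite ler_wpM2l ?(ltW kC_gt0)// sqd_swp box_decay.
Qed.

Lemma Gd_bound d z : 0 < d -> `|Gd d z| <= `|gam| * (d ^+ 2) `^ ((m - 2) / 2).
Proof.
move=> d0; rewrite normrM ler_wpM2l// ger0_norm ?powR_ge0//.
by apply: powR_le_sqd => //; mlra.
Qed.

(** Convolution with [Kh1] and [Kh2] produces the two components of the discrete velocity. *)
Definition Kh2 h d z : R := (Gd d (z + h *: e1) - Gd d (z - h *: e1)) / (2 * h).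
Definition Kh1 h d z : R := - ((Gd d (z + h *: e2) - Gd d (z - h *: e2)) / (2 * h)).

Lemma Kh2_close h d z : 0 < d -> 0 < h -> `|Kh2 h d z - K2 d z| <= kL d * h.
Proof.
move=> d0 h0.
have dG y : is_derive y e1 (Gd d) (K2 d y) by apply: is_derive_Gd_e1; exact: sqd_gt0.
have E y : 'D_e1 (Gd d) y = K2 d y by case: (dG y).
rewrite -E; apply: central_difference_line => //; last exact: kL_ge0.
by move=> x t; rewrite !E; case: (lip_K2 d0 x t).
Qed.

Lemma Kh1_close h d z : 0 < d -> 0 < h -> `|Kh1 h d z - K1 d z| <= kL d * h.
Proof.
move=> d0 h0.
have dG y : is_derive y e2 (Gd d) (- K1 d y) by apply: is_derive_Gd_e2; exact: sqd_gt0.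
have E y : 'D_e2 (Gd d) y = - K1 d y by case: (dG y).
rewrite /Kh1 -[K1 d z]opprK -opprD normrN -E.
apply: central_difference_line => //; last exact: kL_ge0.
by move=> x t; rewrite !E -opprD normrN; case: (lip_K1 d0 x t).
Qed.

End RieszKernel.

(** * The random-walk scheme *)

Section PowerTangent.
Variable R : realType.
Implicit Types (p a b s t : R).

(** This is Young's inequality for t and s^(p-1) with exponents p and p/(p-1), multiplied by p. The
    case p = 1, without finite conjugate exponent, is an equality. *)
Lemma powR_tangent_pos p s t : 1 <= p -> 0 < s -> 0 <= t ->
  s `^ p + p * s `^ (p - 1) * (t - s) <= t `^ p.
Proof.
move=> p1 s0 t0; have [p_gt1|p_le1] := ltP 1 p; last first.
  have -> : p = 1 by apply/eqP; rewrite eq_le p_le1.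
  by rewrite subrr powRr0 !powRr1 ?(ltW s0)// !mul1r addrC subrK.
have p0 : 0 < p by rewrite (lt_trans _ p_gt1).
have q0 : 0 < p - 1 by rewrite subr_gt0.
have ss : s `^ (p - 1) * s = s `^ p by rewrite mulrC mulr_powRB1// ltW.
have pp : (s `^ (p - 1)) `^ (p / (p - 1)) = s `^ p.
  by rewrite -powRrM; congr (_ `^ _); field; rewrite gt_eqF.
have := @conjugate_powR _ t (s `^ (p - 1)) p (p / (p - 1)) t0 (powR_ge0 _ _) p0 (divr_gt0 p0 q0).
have -> : p^-1 + (p / (p - 1))^-1 = 1 by field; rewrite !gt_eqF.
move=> /(_ erefl); rewrite pp => young.
rewrite mulrBr -[X in _ - X]mulrA ss.
have : p * (t * s `^ (p - 1)) <= p * (t `^ p / p + s `^ p / (p / (p - 1))) by rewrite ler_wpM2l ?(ltW p0).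
have -> : p * (t `^ p / p + s `^ p / (p / (p - 1))) = t `^ p + (p - 1) * s `^ p.
  by field; rewrite !gt_eqF.
have -> : p * s `^ (p - 1) * t = p * (t * s `^ (p - 1)) by ring.
by lra.
Qed.

(** A subgradient of |.|^p at b. The sign selects the slope 0 at b = 0, also for p = 1 where |.| has
    a corner. *)
Definition powR_slope p b : R := p * `|b| `^ (p - 1) * Num.sg b.

Lemma powR_tangent p a b : 1 <= p ->
  `|b| `^ p + powR_slope p b * (a - b) <= `|a| `^ p.
Proof.
move=> p1; have p0 : 0 < p by rewrite (lt_le_trans _ p1).
have [->|b0] := eqVneq b 0.
  by rewrite /powR_slope sgr0 mulr0 mul0r addr0 normr0 powR0 ?gt_eqF// powR_ge0.
have nb : 0 < `|b| by rewrite normr_gt0.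
apply: le_trans (powR_tangent_pos p1 nb (normr_ge0 a)).
rewrite lerD2l /powR_slope -mulrA ler_wpM2l ?mulr_ge0 ?powR_ge0 ?(ltW p0)//.
rewrite mulrBr -normrEsg lerD2r.
by rewrite (le_trans (ler_norm _))// normrM normr_sg b0 mul1r.
Qed.

Lemma measurable_powR_slope p : measurable_fun setT (powR_slope p).
Proof.
apply: measurable_funM.
  apply: measurable_funM => //.
  by apply: (measurableT_comp (measurable_powR _)); exact: normr_measurable.
rewrite (_ : Num.sg = fun b : R => if b == 0 then 0 else if b < 0 then -1 else 1); last first.
  apply/funext => b; case: (ltrgt0P b) => [b0|b0|->]; last by rewrite sgr0.
    by rewrite gtr0_sg.
  by rewrite ltr0_sg.
apply: measurable_fun_ifT => //; first exact: measurable_fun_eqr.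
by apply: measurable_fun_ifT => //; exact: measurable_fun_ltr.
Qed.

Lemma powR_slope_bound p (M b : R) : 1 <= p -> `|b| <= M ->
  `|powR_slope p b| <= p * M `^ (p - 1).
Proof.
move=> p1 bM; have p0 : 0 < p by rewrite (lt_le_trans _ p1).
rewrite /powR_slope !normrM (gtr0_norm p0) (ger0_norm (powR_ge0 _ _)) -mulrA ler_wpM2l ?(ltW p0)//.
rewrite -[leRHS]mulr1 ler_pM ?powR_ge0//; last by rewrite normr_sg; case: eqP.
by rewrite ge0_ler_powR ?nnegrE ?subr_ge0// (le_trans _ bM).
Qed.

End PowerTangent.

(** * One step of the walk with a frozen velocity *)

Section Step.
Variable R : realType.
Implicit Types (h l M N C L : R) (u f g th : R * R -> R) (x : R * R).
Local Notation e1 := ((1 : R), (0 : R)).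
Local Notation e2 := ((0 : R), (1 : R)).
Local Notation mu := (@leb2 R).

Lemma measurable_fun_translate g x : measurable_fun setT g ->
  measurable_fun setT (fun y : R * R => g (y + x)).
Proof. by move=> mg; exact: measurable_fun_shift. Qed.

Lemma bddL1_mul M N C th g : bddL1 M N th -> measurable_fun setT g -> 0 <= C ->
  (forall x, `|g x| <= C) ->
  mu.-integrable setT (fun x => (th x * g x)%:E) /\ `|\int[mu]_x (th x * g x)| <= C * N.
Proof.
move=> [mth _ thN] mg C0 gC.
have mth' : measurable_fun setT (fun y : R * R => (`|th y|)%:E).
  by apply/measurable_EFinP; exact: measurableT_comp.
apply: (@Rintegral_dominated _ (fun x => th x * g x) (fun x => C%:E * (`|th x|)%:E)%E).
- exact: measurable_funM.
- exact: measurable_funeM.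
- by move=> x; rewrite -EFinM lee_fin normrM mulrC ler_wpM2r.
- rewrite ge0_integralZl//.
  by rewrite EFinM lee_wpmul2l.
Qed.

Section fixed_velocity.
Variables (h l : R) (u1 u2 : R * R -> R).
Hypotheses (mu1 : measurable_fun setT u1) (mu2 : measurable_fun setT u2).
Hypotheses (u1l : forall x, `|l * u1 x| <= 4^-1) (u2l : forall x, `|l * u2 x| <= 4^-1).
(* Discrete incompressibility: the incoming probabilities at [x] also sum to 1. *)
Hypothesis divfree : forall x,
  u1 (x - h *: e1) - u1 (x + h *: e1) + (u2 (x - h *: e2) - u2 (x + h *: e2)) = 0.

Let p1 x := 4^-1 + l * u1 x.
Let p2 x := 4^-1 - l * u1 x.
Let p3 x := 4^-1 + l * u2 x.
Let p4 x := 4^-1 - l * u2 x.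

(* Pushforward of [th] under the walk jumping by [+-h e] with probability [1/4 +- l u . e]. *)
Definition step th x : R :=
  p1 (x - h *: e1) * th (x - h *: e1) + p2 (x + h *: e1) * th (x + h *: e1) +
  (p3 (x - h *: e2) * th (x - h *: e2) + p4 (x + h *: e2) * th (x + h *: e2)).

Let p1_ge0 x : 0 <= p1 x. Proof. by have := u1l x; rewrite ler_norml /p1 => /andP[]; lra. Qed.
Let p2_ge0 x : 0 <= p2 x. Proof. by have := u1l x; rewrite ler_norml /p2 => /andP[]; lra. Qed.
Let p3_ge0 x : 0 <= p3 x. Proof. by have := u2l x; rewrite ler_norml /p3 => /andP[]; lra. Qed.
Let p4_ge0 x : 0 <= p4 x. Proof. by have := u2l x; rewrite ler_norml /p4 => /andP[]; lra. Qed.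

Let psum x : p1 x + p2 x + (p3 x + p4 x) = 1.
Proof. by rewrite /p1 /p2 /p3 /p4; field. Qed.

Let psum_shift x : p1 (x - h *: e1) + p2 (x + h *: e1) + (p3 (x - h *: e2) + p4 (x + h *: e2)) = 1.
Proof.
rewrite /p1 /p2 /p3 /p4.
rewrite (_ : _ + _ = 1 + l * (u1 (x - h *: e1) - u1 (x + h *: e1) + (u2 (x - h *: e2) - u2 (x + h *: e2)))).
  by rewrite divfree mulr0 addr0.
by field.
Qed.

Let mp1 : measurable_fun setT p1.
Proof. by apply: measurable_funD => //; exact: measurable_funM. Qed.
Let mp2 : measurable_fun setT p2.
Proof. by apply: measurable_funB => //; exact: measurable_funM. Qed.
Let mp3 : measurable_fun setT p3.
Proof. by apply: measurable_funD => //; exact: measurable_funM. Qed.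
Let mp4 : measurable_fun setT p4.
Proof. by apply: measurable_funB => //; exact: measurable_funM. Qed.

Lemma measurable_step th : measurable_fun setT th -> measurable_fun setT (step th).
Proof.
move=> mth.
have m (p : R * R -> R) (a : R * R) : measurable_fun setT p -> measurable_fun setT (fun x : R * R => p (x + a) * th (x + a)).
  by move=> mp; apply: measurable_funM; exact: measurable_fun_translate.
by rewrite /step; apply: measurable_funD; apply: measurable_funD; apply: m.
Qed.

Lemma step_bound M th : (forall x, `|th x| <= M) -> forall x, `|step th x| <= M.
Proof.
move=> thM x.
have b (p : R * R -> R) y : 0 <= p y -> `|p y * th y| <= p y * M.
  by move=> p0; rewrite normrM (ger0_norm p0) ler_wpM2l.
apply: (@le_trans _ _ (p1 (x - h *: e1) * M + p2 (x + h *: e1) * M +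
  (p3 (x - h *: e2) * M + p4 (x + h *: e2) * M))); last first.
  have := congr1 ( *%R^~ M) (psum_shift x); rewrite mul1r.
  move: (p1 _) (p2 _) (p3 _) (p4 _) => a1 a2 a3 a4 /= E.
  by rewrite -[leRHS]E le_eqVlt; apply/orP; left; apply/eqP; ring.
rewrite /step; apply: (le_trans (ler_normD _ _)); apply: lerD.
  by apply: (le_trans (ler_normD _ _)); apply: lerD; exact: b.
by apply: (le_trans (ler_normD _ _)); apply: lerD; exact: b.
Qed.

(** Jensen's inequality for the incoming weights, whose sum is 1 by [psum_shift]; convexity enters
    as a supporting line at every point. *)
Lemma step_convex (Phi : R -> R) th x :
  (forall b, exists c, forall a, Phi b + c * (a - b) <= Phi a) ->
  Phi (step th x) <= step (Phi \o th) x.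
Proof.
move=> /(_ (step th x))[c cP].
set b := step th x in cP *.
rewrite /step /comp.
have k (p : R * R -> R) y : 0 <= p y -> p y * (Phi b + c * (th y - b)) <= p y * Phi (th y).
  by move=> p0; rewrite ler_wpM2l.
apply: (@le_trans _ _ (
  p1 (x - h *: e1) * (Phi b + c * (th (x - h *: e1) - b)) +
  p2 (x + h *: e1) * (Phi b + c * (th (x + h *: e1) - b)) +
  (p3 (x - h *: e2) * (Phi b + c * (th (x - h *: e2) - b)) +
   p4 (x + h *: e2) * (Phi b + c * (th (x + h *: e2) - b))))).
  rewrite [leRHS](_ : _ =
    (p1 (x - h *: e1) + p2 (x + h *: e1) + (p3 (x - h *: e2) + p4 (x + h *: e2))) * (Phi b - c * b)
    + c * step th x); last by rewrite /step; ring.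
  by rewrite psum_shift mul1r -/b subrK.
by apply: lerD; apply: lerD; exact: k.
Qed.

(** Translating each of the four terms back to its point of departure leaves the outgoing
    probabilities, whose sum is 1 for any velocity. Together with [step_convex] this gives every L^p
    bound with finite p. *)
Lemma integral_step_ge0 f : measurable_fun setT f -> (forall x, 0 <= f x) ->
  (\int[mu]_x (step f x)%:E = \int[mu]_x (f x)%:E)%E.
Proof.
move=> mf f0.
have m (p : R * R -> R) (a : R * R) : measurable_fun setT p -> measurable_fun setT (fun x : R * R => (p (x + a) * f (x + a))%:E).
  by move=> mp; apply/measurable_EFinP; apply: measurable_funM; exact: measurable_fun_translate.
have m0 (p : R * R -> R) : measurable_fun setT p -> measurable_fun setT (fun x : R * R => (p x * f x)%:E).
  by move=> mp; apply/measurable_EFinP; apply: measurable_funM.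
have s (p : R * R -> R) (a : R * R) : measurable_fun setT p -> (forall x, 0 <= p x) ->
  (\int[mu]_x (p ((x : R * R) + a) * f ((x : R * R) + a))%R%:E = \int[mu]_x (p x * f x)%R%:E)%E.
  move=> mp p0; apply: (@ge0_integral_shift _ a (fun x => (p x * f x)%:E)); first exact: m0.
  by move=> x; rewrite lee_fin mulr_ge0.
have g0 (p : R * R -> R) x : (forall x, 0 <= p x) -> (0 <= (p x * f x)%:E)%E.
  by move=> p0; rewrite lee_fin mulr_ge0.
rewrite /step; under eq_integral do rewrite 2!EFinD.
rewrite ge0_integralD//; first last.
- by under eq_fun do rewrite EFinD; apply: emeasurable_funD; exact: m.
- by move=> x _; rewrite lee_fin addr_ge0// mulr_ge0.
- by apply: emeasurable_funD; exact: m.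
- by move=> x _; apply: adde_ge0; exact: g0.
under [X in (_ + X)%E]eq_integral do rewrite EFinD.
do 2 (rewrite ge0_integralD//; first last; try exact: m; try by move=> x _; exact: g0).
rewrite !s//.
rewrite -[LHS]/(_ + _)%E.
do 2 (rewrite -ge0_integralD//; first last; try exact: m0; try by move=> x _; exact: g0).
rewrite -ge0_integralD//; first last.
- by apply: emeasurable_funD; exact: m0.
- by move=> x _; apply: adde_ge0; exact: g0.
- by apply: emeasurable_funD; exact: m0.
- by move=> x _; apply: adde_ge0; exact: g0.
by apply: eq_integral => x _; rewrite -!EFinD -!mulrDl psum mul1r.
Qed.

(** The expected value of g after one jump from x. *)
Definition adjoint_step g x : R :=
  p1 x * g (x + h *: e1) + p2 x * g (x - h *: e1) +
  (p3 x * g (x + h *: e2) + p4 x * g (x - h *: e2)).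

Lemma step_bddL1 M N th : bddL1 M N th -> bddL1 M N (step th).
Proof.
move=> [mth thM thN]; split; [exact: measurable_step|exact: step_bound|].
apply: le_trans thN.
rewrite -(@integral_step_ge0 (fun x => `|th x|)) ?normr_ge0//; last exact: measurableT_comp.
apply: ge0_le_integral => //.
- by apply/measurable_EFinP; apply: measurableT_comp => //; exact: measurable_step.
- by apply/measurable_EFinP; apply: measurable_step; exact: measurableT_comp.
move=> x _; rewrite lee_fin; apply: (step_convex (Phi := fun a => `|a|)) => b.
exists (Num.sg b) => a; rewrite mulrBr -normrEsg addrC subrK.
apply: le_trans (ler_norm _) _; rewrite normrM normr_sg; case: eqP => _ /=.
  by rewrite mul0r.
by rewrite mul1r.
Qed.

Lemma measurable_adjoint_step g : measurable_fun setT g -> measurable_fun setT (adjoint_step g).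
Proof.
move=> mg.
have m (p : R * R -> R) (a : R * R) : measurable_fun setT p -> measurable_fun setT (fun x : R * R => p x * g (x + a)).
  by move=> mp; apply: measurable_funM => //; exact: measurable_fun_translate.
by rewrite /adjoint_step; apply: measurable_funD; apply: measurable_funD; apply: m.
Qed.

Lemma adjoint_step_bound C g : (forall x, `|g x| <= C) -> forall x, `|adjoint_step g x| <= C.
Proof.
move=> gC x.
have b (p : R * R -> R) y z : 0 <= p z -> `|p z * g y| <= p z * C.
  by move=> p0; rewrite normrM (ger0_norm p0) ler_wpM2l.
apply: (@le_trans _ _ (p1 x * C + p2 x * C + (p3 x * C + p4 x * C))); last first.
  by rewrite -!mulrDl psum mul1r.
rewrite /adjoint_step; apply: (le_trans (ler_normD _ _)); apply: lerD.
  by apply: (le_trans (ler_normD _ _)); apply: lerD; exact: b.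
by apply: (le_trans (ler_normD _ _)); apply: lerD; exact: b.
Qed.

Lemma step_dual M N C th g : bddL1 M N th -> measurable_fun setT g -> 0 <= C ->
  (forall x, `|g x| <= C) ->
  \int[mu]_x (step th x * g x) = \int[mu]_x (th x * adjoint_step g x).
Proof.
move=> bth mg C0 gC; have [mth thM thN] := bth.
have p4_le (p : R * R -> R) x : 0 <= p x -> p x <= 2^-1 -> `|p x| <= 1.
  by move=> p0 ph; rewrite ger0_norm//; lra.
have q1 x : `|p1 x| <= 1.
  by apply: p4_le => //; have := u1l x; rewrite ler_norml /p1 => /andP[]; lra.
have q2 x : `|p2 x| <= 1.
  by apply: p4_le => //; have := u1l x; rewrite ler_norml /p2 => /andP[]; lra.
have q3 x : `|p3 x| <= 1.
  by apply: p4_le => //; have := u2l x; rewrite ler_norml /p3 => /andP[]; lra.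
have q4 x : `|p4 x| <= 1.
  by apply: p4_le => //; have := u2l x; rewrite ler_norml /p4 => /andP[]; lra.
have I (p : R * R -> R) (a : R * R) : measurable_fun setT p -> (forall x, `|p x| <= 1) ->
    mu.-integrable setT (EFin \o (fun x : R * R => th x * (p x * g (x + a)))).
  move=> mp pl; apply: (proj1 (@bddL1_mul M N C th (fun x : R * R => p x * g (x + a)) bth _ C0 _)).
    by apply: measurable_funM => //; exact: measurable_fun_translate.
  by move=> x; rewrite normrM -[C]mul1r ler_pM.
have I' (p : R * R -> R) (a : R * R) : measurable_fun setT p -> (forall x, `|p x| <= 1) ->
    mu.-integrable setT (EFin \o (fun x : R * R => p (x - a) * th (x - a) * g x)).
  move=> mp pl; have := integrable_shift (- a) (I p a mp pl).
  congr (integrable _ _ _); apply/funext => x /=; congr EFin.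
  by rewrite addrAC -addrA addrN addr0; ring.
have E (p : R * R -> R) (a : R * R) : measurable_fun setT p -> (forall x, `|p x| <= 1) ->
    \int[mu]_x (p ((x : R * R) - a) * th ((x : R * R) - a) * g x) =
    \int[mu]_x (th x * (p x * g ((x : R * R) + a))).
  move=> mp pl; have := integral_shift (- a) (I p a mp pl).
  rewrite /Rintegral => <-; congr fine; apply: eq_integral => x _ /=; congr EFin.
  by rewrite addrAC -addrA addrN addr0; ring.
transitivity (\int[mu]_x (
   (p1 ((x : R * R) - h *: e1) * th ((x : R * R) - h *: e1) * g x +
    p2 ((x : R * R) - - (h *: e1)) * th ((x : R * R) - - (h *: e1)) * g x) +
   (p3 ((x : R * R) - h *: e2) * th ((x : R * R) - h *: e2) * g x +
    p4 ((x : R * R) - - (h *: e2)) * th ((x : R * R) - - (h *: e2)) * g x))).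
  by apply: eq_Rintegral => x _; rewrite /step !opprK; ring.
transitivity (\int[mu]_x (
   (th x * (p1 x * g ((x : R * R) + h *: e1)) +
    th x * (p2 x * g ((x : R * R) + - (h *: e1)))) +
   (th x * (p3 x * g ((x : R * R) + h *: e2)) +
    th x * (p4 x * g ((x : R * R) + - (h *: e2)))))); last first.
  by apply: eq_Rintegral => x _; rewrite /adjoint_step; ring.
have iD (f1 f2 : R * R -> R) : mu.-integrable setT (EFin \o f1) -> mu.-integrable setT (EFin \o f2) ->
    mu.-integrable setT (EFin \o (fun x => f1 x + f2 x)).
  by move=> i1 i2; exact: (integrableD measurableT i1 i2).
rewrite RintegralD//; [|by apply: iD; exact: I'..].
rewrite RintegralD//; [|by exact: I'..].
rewrite [X in _ + X]RintegralD//; [|by exact: I'..].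
rewrite [RHS]RintegralD//; [|by apply: iD; exact: I..].
rewrite [X in _ = X + _]RintegralD//; [|by exact: I..].
rewrite [X in _ = _ + X]RintegralD//; [|by exact: I..].
by rewrite !E.
Qed.

(** By duality a pointwise estimate on the smooth function g replaces any regularity of [th], of
    which only the mass N is used. *)
Lemma step_dual_diff M N C (B : R) th g (w : R * R -> R) : bddL1 M N th -> measurable_fun setT g -> 0 <= C ->
  (forall x, `|g x| <= C) -> measurable_fun setT w -> (forall x, `|w x| <= C) -> 0 <= B ->
  (forall x, `|adjoint_step g x - g x - w x| <= B) ->
  `|\int[mu]_x (step th x * g x) - \int[mu]_x (th x * g x) - \int[mu]_x (th x * w x)| <= B * N.
Proof.
move=> bth mg C0 gC mw wC B0 dB.
have ma := measurable_adjoint_step mg.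
have I f : measurable_fun setT f -> (forall x, `|f x| <= C) -> mu.-integrable setT (EFin \o (fun x => th x * f x)).
  by move=> mf fC; exact: (proj1 (bddL1_mul bth mf C0 fC)).
have Ia := I _ ma (adjoint_step_bound gC).
have Ig := I _ mg gC; have Iw := I _ mw wC.
rewrite (step_dual bth mg C0 gC) -RintegralB// -RintegralB//; last first.
  exact: (integrableB measurableT Ia Ig).
have [_] := @bddL1_mul M N B th (fun x => adjoint_step g x - g x - w x) bth
  (measurable_funB (measurable_funB ma mg) mw) B0 dB.
congr (`| _ | <= _); apply: eq_Rintegral => x _; ring.
Qed.

Lemma step_lipschitz M N C L th g : bddL1 M N th -> measurable_fun setT g -> 0 <= C ->
  (forall x, `|g x| <= C) -> 0 <= L -> 0 <= h -> lip L g ->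
  `|\int[mu]_x (step th x * g x) - \int[mu]_x (th x * g x)| <= L * h * N.
Proof.
move=> bth mg C0 gC L0 h0 lg.
have := @step_dual_diff M N C (L * h) th g (fun=> 0) bth mg C0 gC.
have -> : \int[mu]_x (th x * 0) = 0.
  by under eq_Rintegral do rewrite mulr0; rewrite Rintegral_cst// mul0r.
rewrite subr0; apply=> //.
- by move=> x; rewrite normr0.
- by rewrite mulr_ge0.
move=> x; rewrite subr0.
have [a1 a3] := lg x h; have [a2 a4] := lg x (- h).
rewrite normrN (ger0_norm h0) !scaleNr in a1 a2 a3 a4.
rewrite (_ : adjoint_step g x - g x =
  p1 x * (g (x + h *: e1) - g x) + p2 x * (g (x - h *: e1) - g x) +
  (p3 x * (g (x + h *: e2) - g x) + p4 x * (g (x - h *: e2) - g x))); last first.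
  by rewrite /adjoint_step /p1 /p2 /p3 /p4; field.
have b (p : R * R -> R) y : 0 <= p x -> `|y| <= L * h -> `|p x * y| <= p x * (L * h).
  by move=> p0 yL; rewrite normrM (ger0_norm p0) ler_wpM2l.
apply: (@le_trans _ _ (p1 x * (L * h) + p2 x * (L * h) + (p3 x * (L * h) + p4 x * (L * h)))); last first.
  by rewrite -!mulrDl psum mul1r.
apply: (le_trans (ler_normD _ _)); apply: lerD.
  by apply: (le_trans (ler_normD _ _)); apply: lerD; exact: b.
by apply: (le_trans (ler_normD _ _)); apply: lerD; exact: b.
Qed.

(** The mean displacement is [2 * l * h] times the velocity, which accounts for the first-order
    terms. The Taylor remainders are averaged with weights of sum 1, so their bound [L * h ^+ 2] is
    kept. *)
Lemma step_consistent M N C L th g (g1 g2 : R * R -> R) : bddL1 M N th -> measurable_fun setT g -> 0 <= C ->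
  (forall x, `|g x| <= C) -> 0 <= L -> 0 <= h ->
  measurable_fun setT (fun x => 2 * l * h * (u1 x * g1 x + u2 x * g2 x)) ->
  (forall x, `|2 * l * h * (u1 x * g1 x + u2 x * g2 x)| <= C) ->
  (forall x t, `|g (x + t *: e1) - g x - t * g1 x| <= L * t ^+ 2) ->
  (forall x t, `|g (x + t *: e2) - g x - t * g2 x| <= L * t ^+ 2) ->
  `|\int[mu]_x (step th x * g x) - \int[mu]_x (th x * g x) -
    \int[mu]_x (th x * (2 * l * h * (u1 x * g1 x + u2 x * g2 x)))| <= L * h ^+ 2 * N.
Proof.
move=> bth mg C0 gC L0 h0 mw wC t1 t2.
apply: (@step_dual_diff M N C (L * h ^+ 2) th g) => //.
  by rewrite mulr_ge0 ?sqr_ge0.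
move=> x.
have a1 := t1 x h; have a2 := t1 x (- h); have a3 := t2 x h; have a4 := t2 x (- h).
rewrite sqrrN !scaleNr in a1 a2 a3 a4.
rewrite (_ : adjoint_step g x - g x - _ =
  p1 x * (g (x + h *: e1) - g x - h * g1 x) + p2 x * (g (x - h *: e1) - g x - - h * g1 x) +
  (p3 x * (g (x + h *: e2) - g x - h * g2 x) + p4 x * (g (x - h *: e2) - g x - - h * g2 x))); last first.
  by rewrite /adjoint_step /p1 /p2 /p3 /p4; field.
have b (p : R * R -> R) y : 0 <= p x -> `|y| <= L * h ^+ 2 -> `|p x * y| <= p x * (L * h ^+ 2).
  by move=> p0 yL; rewrite normrM (ger0_norm p0) ler_wpM2l.
apply: (@le_trans _ _ (p1 x * (L * h ^+ 2) + p2 x * (L * h ^+ 2) + (p3 x * (L * h ^+ 2) + p4 x * (L * h ^+ 2)))); last first.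
  by rewrite -!mulrDl psum mul1r.
apply: (le_trans (ler_normD _ _)); apply: lerD.
  by apply: (le_trans (ler_normD _ _)); apply: lerD; exact: b.
by apply: (le_trans (ler_normD _ _)); apply: lerD; exact: b.
Qed.

End fixed_velocity.
End Step.

(** * Lipschitz estimates for convolutions and products *)

Section Convolution.
Variable R : realType.
Implicit Types (C M N L : R) (k th g : R * R -> R) (x : R * R).
Local Notation e1 := ((1 : R), (0 : R)).
Local Notation e2 := ((0 : R), (1 : R)).
Local Notation mu := (@leb2 R).

Lemma conv_integrable_bounded C M N k th x : 0 <= C -> measurable_fun setT k ->
  (forall z, `|k z| <= C) -> bddL1 M N th ->
  mu.-integrable setT (EFin \o (fun y : R * R => k (x - y) * th y)) /\ `|convol k th x| <= C * N.
Proof.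
move=> C0 mk kC bth.
have := @bddL1_mul R M N C th (fun y : R * R => k (x - y)) bth _ C0 _.
have E : (fun y : R * R => th y * k (x - y)) = (fun y => k (x - y) * th y).
  by apply/funext => y; rewrite mulrC.
have mk' : measurable_fun setT (fun y : R * R => k (x - y)).
  by apply: (measurableT_comp mk); exact: measurable_subl.
move=> /(_ mk' (fun y => kC _)) []; rewrite /convol.
rewrite (_ : (fun x0 : R * R => (th x0 * k (x - x0))%:E) = EFin \o (fun y : R * R => k (x - y) * th y)).
  by move=> i b; split => //; move: b; under eq_Rintegral do rewrite mulrC.
by apply/funext => y /=; rewrite mulrC.
Qed.

Lemma convB k1 k2 th x :
  mu.-integrable setT (EFin \o (fun y : R * R => k1 (x - y) * th y)) ->
  mu.-integrable setT (EFin \o (fun y : R * R => k2 (x - y) * th y)) ->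
  convol k1 th x - convol k2 th x = convol (fun z => k1 z - k2 z) th x.
Proof.
move=> i1 i2; rewrite /convol -RintegralB//.
by apply: eq_Rintegral => y _; rewrite mulrBl.
Qed.

Lemma conv_lip C L M N k th : 0 <= C -> 0 <= L -> measurable_fun setT k ->
  (forall z, `|k z| <= C) -> lip L k -> bddL1 M N th -> lip (L * N) (convol k th).
Proof.
move=> C0 L0 mk kC lk bth x t.
have main v : (forall z, `|k (z + t *: v) - k z| <= L * `|t|) ->
    `|convol k th (x + t *: v) - convol k th x| <= L * N * `|t|.
  move=> kv.
  have mkv : measurable_fun setT (fun z : R * R => k (z + t *: v)) by exact: measurable_fun_shift.
  have -> : convol k th (x + t *: v) = convol (fun z => k (z + t *: v)) th x.
    by rewrite /convol; apply: eq_Rintegral => y _; rewrite addrAC.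
  rewrite convB; last 2 first.
  - exact: (proj1 (conv_integrable_bounded x C0 mkv (fun z => kC _) bth)).
  - exact: (proj1 (conv_integrable_bounded x C0 mk kC bth)).
  rewrite mulrAC.
  by have [] := @conv_integrable_bounded (L * `|t|) M N _ th x _ (measurable_funB mkv mk) kv bth; rewrite ?mulr_ge0.
by split; apply: main => z; case: (lk z t).
Qed.

Lemma lipM C1 C2 L1 L2 f g : (forall x, `|f x| <= C1) -> (forall x, `|g x| <= C2) ->
  lip L1 f -> lip L2 g -> lip (C1 * L2 + L1 * C2) (fun x : R * R => f x * g x).
Proof.
move=> fC gC lf lg x t.
have main y : `|f y - f x| <= L1 * `|t| -> `|g y - g x| <= L2 * `|t| ->
    `|f y * g y - f x * g x| <= (C1 * L2 + L1 * C2) * `|t|.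
  move=> hf hg.
  have -> : f y * g y - f x * g x = f y * (g y - g x) + (f y - f x) * g x by ring.
  apply: (le_trans (ler_normD _ _)); rewrite !normrM mulrDl -mulrA [_ * C2 * _]mulrAC.
  by apply: lerD; apply: ler_pM.
by case: (lf x t) (lg x t) => [f1 f2] [g1 g2]; split; apply: main.
Qed.

Lemma lipD L1 L2 f g : lip L1 f -> lip L2 g -> lip (L1 + L2) (fun x : R * R => f x + g x).
Proof.
move=> lf lg x t.
have main y : `|f y - f x| <= L1 * `|t| -> `|g y - g x| <= L2 * `|t| ->
    `|f y + g y - (f x + g x)| <= (L1 + L2) * `|t|.
  move=> hf hg.
  have -> : f y + g y - (f x + g x) = (f y - f x) + (g y - g x) by ring.
  by rewrite mulrDl (le_trans (ler_normD _ _))// lerD.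
by case: (lf x t) (lg x t) => [f1 f2] [g1 g2]; split; apply: main.
Qed.

(** A convolution at x is an integral against this reflected kernel, so the Lipschitz estimate for
    one step also bounds the change of the velocity at x. *)
Lemma lip_reflect L k x : lip L k -> lip L (fun y : R * R => k (x - y)).
Proof.
move=> lk y t.
by have [h1 h2] := lk (x - y) (- t); rewrite normrN !scaleNr in h1 h2; rewrite !opprD !addrA.
Qed.

(** The quantitative content of a test function and its two partial derivatives [g1], [g2], freed
    from the recursive definition of smoothness. *)
Record test_data C L (g g1 g2 : R * R -> R) : Prop := TestData {
  td_m : measurable_fun setT g;
  td_m1 : measurable_fun setT g1;
  td_m2 : measurable_fun setT g2;
  td_b : forall x, `|g x| <= C;
  td_b1 : forall x, `|g1 x| <= C;
  td_b2 : forall x, `|g2 x| <= C;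
  td_l1 : lip L g1;
  td_l2 : lip L g2;
  td_t1 : forall x t, `|g (x + t *: e1) - g x - t * g1 x| <= L * t ^+ 2;
  td_t2 : forall x t, `|g (x + t *: e2) - g x - t * g2 x| <= L * t ^+ 2 }.

End Convolution.

(** * The scheme driven by its own velocity *)

Section Scheme.
Variable R : realType.
Variable m : R.
Hypotheses (m1 : 1 < m) (m2 : m < 2).
Implicit Types (h d : R) (th g : R * R -> R) (x : R * R).
Local Notation e1 := ((1 : R), (0 : R)).
Local Notation e2 := ((0 : R), (1 : R)).
Local Notation mu := (@leb2 R).
Variables (M N : R).
Hypotheses (M0 : 0 <= M) (N0 : 0 <= N).
Local Notation bdd := (bddL1 M N).

(* Both components are central differences of one stream function, and these
   commute; this is what makes the discrete divergence vanish exactly. *)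
Definition v1 h d th x : R :=
  - ((convol (Gd m d) th (x + h *: e2) - convol (Gd m d) th (x - h *: e2)) / (2 * h)).
Definition v2 h d th x : R :=
  (convol (Gd m d) th (x + h *: e1) - convol (Gd m d) th (x - h *: e1)) / (2 * h).

Lemma v_divfree h d th x : h != 0 ->
  v1 h d th (x - h *: e1) - v1 h d th (x + h *: e1) +
  (v2 h d th (x - h *: e2) - v2 h d th (x + h *: e2)) = 0.
Proof.
move=> h0.
have gen (f : R * R -> R) (a b y : R * R) :
    - ((f (y - a + b) - f (y - a - b)) / (2 * h)) - - ((f (y + a + b) - f (y + a - b)) / (2 * h)) +
    ((f (y - b + a) - f (y - b - a)) / (2 * h) - (f (y + b + a) - f (y + b - a)) / (2 * h)) = 0.
  rewrite [y - b + a]addrAC [y - b - a]addrAC [y + b + a]addrAC [y + b - a]addrAC.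
  move: (f (y - a + b)) (f (y - a - b)) (f (y + a + b)) (f (y + a - b)) => q1 q2 q3 q4.
  by field.
exact: gen.
Qed.

Let GB d := `|gam m| * (d ^+ 2) `^ ((m - 2) / 2).

Lemma GB_ge0 d : 0 <= GB d. Proof. by rewrite mulr_ge0// powR_ge0. Qed.

Lemma Gd_conv_shift d th x v : 0 < d -> bdd th ->
  convol (Gd m d) th (x + v) = convol (fun z => Gd m d (z + v)) th x /\
  mu.-integrable setT (EFin \o (fun y : R * R => Gd m d (x - y + v) * th y)).
Proof.
move=> d0 bth; split.
  by rewrite /convol; apply: eq_Rintegral => y _; rewrite addrAC.
have mG : measurable_fun setT (fun z : R * R => Gd m d (z + v)).
  by apply: measurable_fun_shift; exact: measurable_Gd.
exact: (proj1 (conv_integrable_bounded x (GB_ge0 d) mG (fun z => Gd_bound m1 m2 _ d0) bth)).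
Qed.

(** Moves the difference quotient from the stream function onto the kernel, where it can be compared
    with the exact derivative. *)
Lemma conv_difference_quotient d th x v h : 0 < d -> bdd th ->
  (convol (Gd m d) th (x + v) - convol (Gd m d) th (x - v)) / (2 * h) =
  convol (fun z => (Gd m d (z + v) - Gd m d (z - v)) / (2 * h)) th x /\
  mu.-integrable setT (EFin \o (fun y : R * R => (Gd m d (x - y + v) - Gd m d (x - y - v)) / (2 * h) * th y)).
Proof.
move=> d0 bth.
have [E1 I1] := Gd_conv_shift x v d0 bth; have [E2 I2] := Gd_conv_shift x (- v) d0 bth.
have I3 := integrableB measurableT I1 I2.
have I4 := integrableZl measurableT (2 * h)^-1 I3.
split.
  rewrite E1 E2 (convB I1 I2) mulrC /convol -RintegralZl; [|exact: measurableT|].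
    by apply: eq_Rintegral => y _; rewrite mulrA; congr (_ * _); rewrite mulrC.
  move: I3; congr (integrable _ _ _); apply/funext => y /=.
  by rewrite -EFinB mulrBl.
move: I4; congr (integrable _ _ _); apply/funext => y /=.
by rewrite -EFinB -EFinM -mulrBl mulrA; congr (_ * _)%:E; rewrite mulrC.
Qed.

Lemma v2_close h d th x : 0 < h -> 0 < d -> bdd th ->
  `|v2 h d th x - convol (K2 m d) th x| <= kL m d * h * N.
Proof.
move=> h0 d0 bth; rewrite /v2.
have [-> I] := conv_difference_quotient x (h *: e1) h d0 bth.
have [K0 _] := conv_integrable_bounded x (kB_ge0 m d) (measurable_K2 m d) (fun z => K2_bound m1 m2 z d0) bth.
rewrite convB//.
have LL : 0 <= kL m d * h by rewrite mulr_ge0 ?kL_ge0 ?ltW.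
refine (proj2 (conv_integrable_bounded x LL _ _ bth)).
  apply: measurable_funB; last exact: measurable_K2.
  apply: measurable_funM => //; apply: measurable_funB; apply: measurable_fun_shift; exact: measurable_Gd.
by move=> z; exact: (Kh2_close m1 m2 z d0 h0).
Qed.

Lemma v1_close h d th x : 0 < h -> 0 < d -> bdd th ->
  `|v1 h d th x - convol (K1 m d) th x| <= kL m d * h * N.
Proof.
move=> h0 d0 bth; rewrite /v1.
have [-> I] := conv_difference_quotient x (h *: e2) h d0 bth.
have mKh : measurable_fun setT (fun z : R * R => (Gd m d (z + h *: e2) - Gd m d (z - h *: e2)) / (2 * h)).
  by apply: measurable_funM => //; apply: measurable_funB; apply: measurable_fun_shift; exact: measurable_Gd.
have mK1' : measurable_fun setT (fun z : R * R => - K1 m d z).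
  by apply: measurable_funN; exact: measurable_K1.
have K1B (z : R * R) : `|- K1 m d z| <= kB m d by rewrite normrN; exact: K1_bound.
have [K0 _] := conv_integrable_bounded x (kB_ge0 m d) mK1' K1B bth.
have [K0' _] := conv_integrable_bounded x (kB_ge0 m d) (measurable_K1 m d) (fun z => K1_bound m1 m2 z d0) bth.
have E : convol (K1 m d) th x = - convol (fun z => - K1 m d z) th x.
  rewrite /convol -mulN1r -RintegralZl//; apply: eq_Rintegral => y _; ring.
rewrite E -opprD normrN convB//.
have LL : 0 <= kL m d * h by rewrite mulr_ge0 ?kL_ge0 ?ltW.
refine (proj2 (conv_integrable_bounded x LL _ _ bth)); first exact: measurable_funB.
move=> z; rewrite -normrN opprB addrC; exact: (Kh1_close m1 m2 z d0 h0).
Qed.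

Lemma measurable_v1 h d th : measurable_fun setT th -> measurable_fun setT (v1 h d th).
Proof.
move=> mth; apply: measurable_funN; apply: measurable_funM => //.
by apply: measurable_funB; apply: measurable_fun_shift; apply: measurable_conv => //; exact: measurable_Gd.
Qed.

Lemma measurable_v2 h d th : measurable_fun setT th -> measurable_fun setT (v2 h d th).
Proof.
move=> mth; apply: measurable_funM => //.
by apply: measurable_funB; apply: measurable_fun_shift; apply: measurable_conv => //; exact: measurable_Gd.
Qed.

(** The first summand bounds the velocity of every regularized kernel; the spare 1 absorbs the error
    of the difference quotients, at most [dn n <= 1]. *)
Definition Vmax : R := kC m * (ppow_mass (ka0 m) * M + N) + 1.

Definition dn (n : nat) : R := n.+1%:R^-1.
(* So small that replacing a derivative of the kernel by a difference quotient of
   step [hn n] changes the velocity by at most [dn n] (see [kL_hn]). *)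
Definition hn (n : nat) : R := n.+1%:R^-1 / ((1 + kL m (dn n)) * (1 + N)).
(** With this value [lam * |u| <= 1/4], the condition for nonnegative jump probabilities. A jump has
    mean [2 * lam * hn n * u], so [tau n] is the time that one step represents. *)
Definition lam : R := (4 * Vmax)^-1.
Definition tau (n : nat) : R := 2 * lam * hn n.

Lemma dn_gt0 n : 0 < dn n. Proof. by rewrite invr_gt0. Qed.

Lemma ppow_mass_ge0 (a : R) : 0 <= ppow_mass a.
Proof. by rewrite fine_ge0// integral_ge0// => z _; exact: ppow_ge0. Qed.

Lemma Vmax_gt0 : 0 < Vmax.
Proof. by rewrite ltr_wpDl// mulr_ge0 ?(ltW (kC_gt0 m))// addr_ge0// mulr_ge0// ppow_mass_ge0. Qed.

Lemma lam_gt0 : 0 < lam. Proof. by rewrite invr_gt0 mulr_gt0// Vmax_gt0. Qed.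

Lemma hn_gt0 n : 0 < hn n.
Proof. by rewrite divr_gt0 ?invr_gt0// mulr_gt0// ltr_wpDr ?kL_ge0. Qed.

Lemma tau_gt0 n : 0 < tau n.
Proof. by rewrite /tau mulr_gt0 ?hn_gt0// mulr_gt0 ?lam_gt0. Qed.

Lemma hn_tau n : hn n = 2 * Vmax * tau n.
Proof. by rewrite /tau /lam; field; rewrite gt_eqF ?Vmax_gt0. Qed.

Lemma hn_le n : hn n <= dn n.
Proof.
rewrite /hn /dn ler_pdivrMr ?mulr_gt0 ?ltr_wpDr ?kL_ge0// ler_peMr ?invr_ge0//.
by rewrite -[X in X <= _]mulr1 ler_pM ?lerDl ?kL_ge0.
Qed.

Lemma kL_hn n : kL m (dn n) * hn n * N <= dn n.
Proof.
rewrite /hn; have k0 := kL_ge0 m (dn n).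
have D : 0 < (1 + kL m (dn n)) * (1 + N) by rewrite mulr_gt0 ?ltr_wpDr.
have -> : kL m (dn n) * (n.+1%:R^-1 / ((1 + kL m (dn n)) * (1 + N))) * N =
  dn n * ((kL m (dn n) * N) / ((1 + kL m (dn n)) * (1 + N))).
  by rewrite /dn; ring.
rewrite ler_piMr ?(ltW (dn_gt0 n))// ler_pdivrMr// mul1r.
by have := N0; nra.
Qed.

Lemma convK1_bound d th x : bdd th -> `|convol (K1 m d) th x| <= Vmax - 1.
Proof.
by move=> bth; rewrite /Vmax addrK; exact: (proj2 (kdom_conv x (ka0_itv m1 m2) (ltW (kC_gt0 m)) M0 (kdom_K1 m1 m2 d) bth)).
Qed.

Lemma convK2_bound d th x : bdd th -> `|convol (K2 m d) th x| <= Vmax - 1.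
Proof.
by move=> bth; rewrite /Vmax addrK; exact: (proj2 (kdom_conv x (ka0_itv m1 m2) (ltW (kC_gt0 m)) M0 (kdom_K2 m1 m2 d) bth)).
Qed.

Lemma v1_bound n th x : bdd th -> `|v1 (hn n) (dn n) th x| <= Vmax.
Proof.
move=> bth; have := v1_close x (hn_gt0 n) (dn_gt0 n) bth.
have := convK1_bound (dn n) x bth; have := kL_hn n.
have d1 : dn n <= 1 by rewrite invf_le1// ler1n.
move=> a b c; rewrite -[v1 _ _ _ _](subrK (convol (K1 m (dn n)) th x)).
by rewrite (le_trans (ler_normD _ _))//; lra.
Qed.

Lemma v2_bound n th x : bdd th -> `|v2 (hn n) (dn n) th x| <= Vmax.
Proof.
move=> bth; have := v2_close x (hn_gt0 n) (dn_gt0 n) bth.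
have := convK2_bound (dn n) x bth; have := kL_hn n.
have d1 : dn n <= 1 by rewrite invf_le1// ler1n.
move=> a b c; rewrite -[v2 _ _ _ _](subrK (convol (K2 m (dn n)) th x)).
by rewrite (le_trans (ler_normD _ _))//; lra.
Qed.

Definition sstep n th := step (hn n) lam (v1 (hn n) (dn n) th) (v2 (hn n) (dn n) th) th.

Fixpoint scheme th0 n (k : nat) : R * R -> R :=
  if k is k'.+1 then sstep n (scheme th0 n k') else th0.

Let lamV (v : R * R -> R) : (forall x, `|v x| <= Vmax) -> forall x, `|lam * v x| <= 4^-1.
Proof.
move=> vV x; rewrite normrM (gtr0_norm lam_gt0) /lam invfM -mulrA ler_piMr ?invr_ge0//.
by rewrite mulrC ler_pdivrMr ?Vmax_gt0// mul1r.
Qed.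

Lemma sstep_bdd n th : bdd th -> bdd (sstep n th).
Proof.
move=> bth; have [mth _ _] := bth; apply: step_bddL1 => //.
- exact: measurable_v1.
- exact: measurable_v2.
- by apply: lamV => x; exact: v1_bound.
- by apply: lamV => x; exact: v2_bound.
- by move=> x; apply: v_divfree; rewrite gt_eqF ?hn_gt0.
Qed.

Lemma scheme_bdd th0 n k : bdd th0 -> bdd (scheme th0 n k).
Proof. by move=> b0; elim: k => [//|k IH]; exact: sstep_bdd. Qed.

(** Jensen bounds |step th|^p by the step of |th|^p, whose integral is conserved. *)
Lemma sstep_powR n th p : bdd th -> 1 <= p ->
  (\int[mu]_x (`|sstep n th x| `^ p)%:E <= \int[mu]_x (`|th x| `^ p)%:E)%E.
Proof.
move=> bth p1; have [mth _ _] := bth; have [msth _ _] := sstep_bdd n bth.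
have mp (f : R * R -> R) : measurable_fun setT f -> measurable_fun setT (fun x => `|f x| `^ p).
  by move=> mf; apply: (measurableT_comp (measurable_powR _)); exact: measurableT_comp.
have V1 := lamV (fun x => v1_bound n x bth); have V2 := lamV (fun x => v2_bound n x bth).
have DF (x : R * R) := v_divfree (dn n) th x (lt0r_neq0 (hn_gt0 n)).
have mv1 := measurable_v1 (hn n) (dn n) mth; have mv2 := measurable_v2 (hn n) (dn n) mth.
rewrite -(integral_step_ge0 (hn n) mv1 mv2 V1 V2 (mp _ mth)); last by move=> x; exact: powR_ge0.
apply: ge0_le_integral => //.
- by apply/measurable_EFinP; exact: mp.
- by apply/measurable_EFinP; apply: measurable_step => //; exact: mp.
move=> x _; rewrite lee_fin.
apply: (step_convex V1 V2 DF (Phi := fun a => `|a| `^ p)) => b.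
by exists (powR_slope p b) => a; exact: powR_tangent.
Qed.

Lemma scheme_powR th0 n k p : bdd th0 -> 1 <= p ->
  (\int[mu]_x (`|scheme th0 n k x| `^ p)%:E <= \int[mu]_x (`|th0 x| `^ p)%:E)%E.
Proof.
move=> b0 p1; elim: k => [//|k IH]; apply: le_trans IH.
by apply: sstep_powR => //; exact: scheme_bdd.
Qed.

Lemma sstep_lipschitz n th g C L : bdd th -> measurable_fun setT g -> 0 <= C ->
  (forall x, `|g x| <= C) -> 0 <= L -> lip L g ->
  `|\int[mu]_x (sstep n th x * g x) - \int[mu]_x (th x * g x)| <= L * hn n * N.
Proof.
move=> bth mg C0 gC L0 lg; have [mth _ _] := bth.
have V1 := lamV (fun x => v1_bound n x bth); have V2 := lamV (fun x => v2_bound n x bth).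
have mv1 := measurable_v1 (hn n) (dn n) mth; have mv2 := measurable_v2 (hn n) (dn n) mth.
exact: (step_lipschitz mv1 mv2 V1 V2 bth mg C0 gC L0 (ltW (hn_gt0 n)) lg).
Qed.

Definition flux_n n th (g1 g2 : R * R -> R) : R :=
  \int[mu]_x (th x * (v1 (hn n) (dn n) th x * g1 x + v2 (hn n) (dn n) th x * g2 x)).

Lemma sstep_consistent n th g (g1 g2 : R * R -> R) C L : bdd th -> 0 <= C -> 0 <= L -> test_data C L g g1 g2 ->
  `|\int[mu]_x (sstep n th x * g x) - \int[mu]_x (th x * g x) - tau n * flux_n n th g1 g2|
   <= L * hn n ^+ 2 * N.
Proof.
move=> bth C0 L0 td; have [mth _ _] := bth.
have V1 := lamV (fun x => v1_bound n x bth); have V2 := lamV (fun x => v2_bound n x bth).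
have mv1 := measurable_v1 (hn n) (dn n) mth; have mv2 := measurable_v2 (hn n) (dn n) mth.
set w := fun x : R * R => v1 (hn n) (dn n) th x * g1 x + v2 (hn n) (dn n) th x * g2 x.
have mw : measurable_fun setT w.
  by apply: measurable_funD; apply: measurable_funM => //; [exact: (td_m1 td)|exact: (td_m2 td)].
have wC x : `|w x| <= Vmax * C + Vmax * C.
  rewrite (le_trans (ler_normD _ _))//.
  apply: lerD; rewrite normrM; apply: ler_pM; rewrite ?normr_ge0//.
  - exact: v1_bound.
  - exact: (td_b1 td).
  - exact: v2_bound.
  - exact: (td_b2 td).
have V0 := ltW Vmax_gt0; have t0 := ltW (tau_gt0 n).
(* [step_consistent] asks for one constant bounding both g and the drift term; it only ensures
   integrability and does not enter the error. *)
have [C' C'0 [CC' wC']] : exists2 C', 0 <= C' & C <= C' /\ forall x, `|tau n * w x| <= C'.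
  exists (C + tau n * (Vmax * C + Vmax * C)).
    by rewrite addr_ge0// mulr_ge0// addr_ge0// mulr_ge0.
  split; first by rewrite lerDl mulr_ge0// addr_ge0// mulr_ge0.
  move=> x; rewrite normrM (ger0_norm t0); apply: (@le_trans _ _ (tau n * (Vmax * C + Vmax * C))).
    by rewrite ler_wpM2l.
  by rewrite lerDr.
have -> : tau n * flux_n n th g1 g2 = \int[mu]_x (th x * (2 * lam * hn n * w x)).
  rewrite /flux_n -RintegralZl//; first by apply: eq_Rintegral => x _; rewrite /tau /w; ring.
  by apply: (proj1 (bddL1_mul bth mw _ wC)); rewrite addr_ge0// mulr_ge0.
have gC' x : `|g x| <= C' by rewrite (le_trans _ CC')// (td_b td).
apply: (step_consistent mv1 mv2 V1 V2 bth (td_m td) C'0 gC' L0 (ltW (hn_gt0 n)) _ wC' (td_t1 td) (td_t2 td)).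
exact: measurable_funM.
Qed.

End Scheme.

(** * Fluxes of the scheme, of a regularized kernel and of k_m *)

Section Flux.
Variable R : realType.
Variable m : R.
Hypotheses (m1 : 1 < m) (m2 : m < 2).
Implicit Types (h d e C L : R) (th g a b : R * R -> R) (x : R * R).
Local Notation mu := (@leb2 R).
Variables (M N : R).
Hypotheses (M0 : 0 <= M) (N0 : 0 <= N).
Local Notation bdd := (bddL1 M N).
Local Notation scheme := (scheme m M N).
Local Notation upd := (sstep m M N).
Local Notation hn := (hn m N).
Local Notation tau := (tau m M N).
Local Notation flux_n := (flux_n m N).
Local Notation dn := (@dn R).

Definition gflux (a1 a2 : R * R -> R) th (g1 g2 : R * R -> R) : R :=
  \int[mu]_x (th x * (a1 x * g1 x + a2 x * g2 x)).

(** The intermediate flux, with a scale e chosen independently of n. *)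
Definition Fe e th (g1 g2 : R * R -> R) : R :=
  gflux (convol (K1 m e) th) (convol (K2 m e) th) th g1 g2.

Definition F0 th (g1 g2 : R * R -> R) : R :=
  gflux (convol (km1 m) th) (convol (km2 m) th) th g1 g2.

(** The uniform error in the velocity when k_m is regularized at scale d, obtained from [kdom_conv]
    with the exponent [ka1]. *)
Definition eta d : R := 2 * kC m * d `^ kap m * (ppow_mass (ka1 m) * M + N).

Lemma eta_ge0 d : 0 <= eta d.
Proof.
rewrite !mulr_ge0 ?powR_ge0 ?(ltW (kC_gt0 m))// addr_ge0// mulr_ge0//.
exact: ppow_mass_ge0.
Qed.

Lemma gflux_integrable (a1 a2 g1 g2 : R * R -> R) th C V : bdd th -> 0 <= C -> 0 <= V ->
  measurable_fun setT a1 -> measurable_fun setT a2 ->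
  measurable_fun setT g1 -> measurable_fun setT g2 ->
  (forall x, `|a1 x| <= V) -> (forall x, `|a2 x| <= V) ->
  (forall x, `|g1 x| <= C) -> (forall x, `|g2 x| <= C) ->
  mu.-integrable setT (EFin \o (fun x => th x * (a1 x * g1 x + a2 x * g2 x))) /\
  `|gflux a1 a2 th g1 g2| <= 2 * V * C * N.
Proof.
move=> bth C0 V0 ma1 ma2 mg1 mg2 a1V a2V g1C g2C.
apply: (bddL1_mul bth).
- by apply: measurable_funD; exact: measurable_funM.
- by rewrite !mulr_ge0.
- move=> x; rewrite (le_trans (ler_normD _ _))// -mulrA mulrDl mul1r.
  by apply: lerD; rewrite normrM; apply: ler_pM.
Qed.

Lemma gflux_close (a1 a2 b1 b2 g1 g2 : R * R -> R) th C V e : bdd th -> 0 <= C -> 0 <= V -> 0 <= e ->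
  measurable_fun setT a1 -> measurable_fun setT a2 ->
  measurable_fun setT b1 -> measurable_fun setT b2 ->
  measurable_fun setT g1 -> measurable_fun setT g2 ->
  (forall x, `|a1 x| <= V) -> (forall x, `|a2 x| <= V) ->
  (forall x, `|b1 x| <= V) -> (forall x, `|b2 x| <= V) ->
  (forall x, `|g1 x| <= C) -> (forall x, `|g2 x| <= C) ->
  (forall x, `|a1 x - b1 x| <= e) -> (forall x, `|a2 x - b2 x| <= e) ->
  `|gflux a1 a2 th g1 g2 - gflux b1 b2 th g1 g2| <= 2 * e * C * N.
Proof.
move=> bth C0 V0 e0 ma1 ma2 mb1 mb2 mg1 mg2 a1V a2V b1V b2V g1C g2C ab1 ab2.
have [Ia _] := gflux_integrable bth C0 V0 ma1 ma2 mg1 mg2 a1V a2V g1C g2C.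
have [Ib _] := gflux_integrable bth C0 V0 mb1 mb2 mg1 mg2 b1V b2V g1C g2C.
have [_] := gflux_integrable bth C0 e0 (measurable_funB ma1 mb1) (measurable_funB ma2 mb2) mg1 mg2 ab1 ab2 g1C g2C.
rewrite /gflux -RintegralB//.
by congr (`|_| <= _); apply: eq_Rintegral => x _ /=; ring.
Qed.

Lemma convol_km1_bound th x : bdd th -> `|convol (km1 m) th x| <= Vmax m M N.
Proof.
move=> bth; apply: (@le_trans _ _ (Vmax m M N - 1)); last by rewrite gerBl.
by rewrite /Vmax addrK; exact: (proj2 (kdom_conv x (ka0_itv m1 m2) (ltW (kC_gt0 m)) M0 (kdom_km1 m1 m2) bth)).
Qed.

Lemma convol_km2_bound th x : bdd th -> `|convol (km2 m) th x| <= Vmax m M N.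
Proof.
move=> bth; apply: (@le_trans _ _ (Vmax m M N - 1)); last by rewrite gerBl.
by rewrite /Vmax addrK; exact: (proj2 (kdom_conv x (ka0_itv m1 m2) (ltW (kC_gt0 m)) M0 (kdom_km2 m1 m2) bth)).
Qed.

Lemma convol_K1_bound d th x : bdd th -> `|convol (K1 m d) th x| <= Vmax m M N.
Proof.
move=> bth; apply: (@le_trans _ _ (Vmax m M N - 1)); last by rewrite gerBl.
exact: convK1_bound.
Qed.

Lemma convol_K2_bound d th x : bdd th -> `|convol (K2 m d) th x| <= Vmax m M N.
Proof.
move=> bth; apply: (@le_trans _ _ (Vmax m M N - 1)); last by rewrite gerBl.
exact: convK2_bound.
Qed.

Lemma convol_km1_close d th x : 0 < d -> bdd th ->
  `|convol (km1 m) th x - convol (K1 m d) th x| <= eta d.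
Proof.
move=> d0 bth.
have c0 : 0 <= 2 * kC m * d `^ kap m by rewrite !mulr_ge0 ?powR_ge0// (ltW (kC_gt0 m)).
rewrite convB.
- exact: (proj2 (kdom_conv x (ka1_itv m1 m2) c0 M0 (kdom_diff1 m1 m2 d0) bth)).
- exact: (proj1 (kdom_conv x (ka0_itv m1 m2) (ltW (kC_gt0 m)) M0 (kdom_km1 m1 m2) bth)).
- exact: (proj1 (kdom_conv x (ka0_itv m1 m2) (ltW (kC_gt0 m)) M0 (kdom_K1 m1 m2 d) bth)).
Qed.

Lemma convol_km2_close d th x : 0 < d -> bdd th ->
  `|convol (km2 m) th x - convol (K2 m d) th x| <= eta d.
Proof.
move=> d0 bth.
have c0 : 0 <= 2 * kC m * d `^ kap m by rewrite !mulr_ge0 ?powR_ge0// (ltW (kC_gt0 m)).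
rewrite convB.
- exact: (proj2 (kdom_conv x (ka1_itv m1 m2) c0 M0 (kdom_diff2 m1 m2 d0) bth)).
- exact: (proj1 (kdom_conv x (ka0_itv m1 m2) (ltW (kC_gt0 m)) M0 (kdom_km2 m1 m2) bth)).
- exact: (proj1 (kdom_conv x (ka0_itv m1 m2) (ltW (kC_gt0 m)) M0 (kdom_K2 m1 m2 d) bth)).
Qed.

Section test_functions.
Variables (C L : R) (g g1 g2 : R * R -> R).
Hypotheses (C0 : 0 <= C) (L0 : 0 <= L) (td : test_data C L g g1 g2).

Let V0 : 0 <= Vmax m M N. Proof. exact: ltW (Vmax_gt0 _ _ _). Qed.

Lemma F0_close e th : 0 < e -> bdd th ->
  `|F0 th g1 g2 - Fe e th g1 g2| <= 2 * eta e * C * N.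
Proof.
move=> e0 bth; have [mth _ _] := bth.
apply: (gflux_close bth C0 V0 (eta_ge0 e)).
- by apply: measurable_conv => //; exact: measurable_km1.
- by apply: measurable_conv => //; exact: measurable_km2.
- by apply: measurable_conv => //; exact: measurable_K1.
- by apply: measurable_conv => //; exact: measurable_K2.
- exact: td_m1 td.
- exact: td_m2 td.
- by move=> x; exact: convol_km1_bound.
- by move=> x; exact: convol_km2_bound.
- by move=> x; exact: convol_K1_bound.
- by move=> x; exact: convol_K2_bound.
- exact: td_b1 td.
- exact: td_b2 td.
- by move=> x; exact: convol_km1_close.
- by move=> x; exact: convol_km2_close.
Qed.

(** The three errors come from the chain: discrete velocity, kernel at scale [dn n], exact kernel,
    kernel at scale e. *)
Lemma flux_n_close n e th : 0 < e -> bdd th ->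
  `|flux_n n th g1 g2 - Fe e th g1 g2| <= 2 * (dn n + eta (dn n) + eta e) * C * N.
Proof.
move=> e0 bth; have [mth _ _] := bth.
have tri (p q r s : R) (w1 w2 w3 : R) : `|p - q| <= w1 -> `|r - q| <= w2 -> `|r - s| <= w3 ->
    `|p - s| <= w1 + w2 + w3.
  move=> h1 h2 h3; rewrite (_ : p - s = (p - q) - (r - q) + (r - s)); last by ring.
  by rewrite (le_trans (ler_normD _ _))// lerD// (le_trans (ler_normB _ _))// lerD.
apply: (gflux_close bth C0 V0).
- by rewrite !addr_ge0 ?eta_ge0 ?ltW ?dn_gt0.
- exact: measurable_v1.
- exact: measurable_v2.
- by apply: measurable_conv => //; exact: measurable_K1.
- by apply: measurable_conv => //; exact: measurable_K2.
- exact: td_m1 td.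
- exact: td_m2 td.
- by move=> x; exact: (v1_bound m1 m2 M0 N0 n x bth).
- by move=> x; exact: (v2_bound m1 m2 M0 N0 n x bth).
- by move=> x; exact: convol_K1_bound.
- by move=> x; exact: convol_K2_bound.
- exact: td_b1 td.
- exact: td_b2 td.
- move=> x; apply: (tri _ (convol (K1 m (dn n)) th x) (convol (km1 m) th x)).
  + by apply: le_trans (kL_hn m N0 n); apply: (v1_close m1 m2 x (hn_gt0 m N0 n) (dn_gt0 _ n) bth).
  + by apply: convol_km1_close => //; exact: dn_gt0.
  + exact: convol_km1_close.
- move=> x; apply: (tri _ (convol (K2 m (dn n)) th x) (convol (km2 m) th x)).
  + by apply: le_trans (kL_hn m N0 n); apply: (v2_close m1 m2 x (hn_gt0 m N0 n) (dn_gt0 _ n) bth).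
  + by apply: convol_km2_close => //; exact: dn_gt0.
  + exact: convol_km2_close.
Qed.

(** The change of [Fe e] per unit of jump length. The first term moves the transported density
    against the Lipschitz field u . grad g, the second moves the density that generates u. It may
    blow up as e tends to 0 but does not depend on n. *)
Definition Alip e : R := (kB m e * N * L + kL m e * N * C + (kB m e * N * L + kL m e * N * C)) * N +
  2 * (kL m e * N) * C * N.

Lemma Alip_ge0 e : 0 <= Alip e.
Proof.
have k0 := kB_ge0 m e; have l0 := kL_ge0 m e.
rewrite /Alip; move: (kB m e) (kL m e) k0 l0 => a b a0 b0.
by repeat (done || apply: addr_ge0 || apply: mulr_ge0).
Qed.

Lemma Fe_sstep n e th : 0 < e -> bdd th ->
  `|Fe e (upd n th) g1 g2 - Fe e th g1 g2| <= Alip e * hn n.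
Proof.
move=> e0 bth; have bth' := sstep_bdd m1 m2 M0 N0 n bth.
have [mth _ _] := bth; have [mth' _ _] := bth'.
have h0 := ltW (hn_gt0 m N0 n).
set th' := upd n th in bth' mth' *.
have kb0 := kB_ge0 m e; have kl0 := kL_ge0 m e.
have mK1e := measurable_K1 m e; have mK2e := measurable_K2 m e.
have bK1 (z : R * R) := K1_bound m1 m2 z e0; have bK2 (z : R * R) := K2_bound m1 m2 z e0.
have lK1 := lip_K1 m1 m2 e0; have lK2 := lip_K2 m1 m2 e0.
set w' := fun x : R * R => convol (K1 m e) th' x * g1 x + convol (K2 m e) th' x * g2 x.
have mw' : measurable_fun setT w'.
  apply: measurable_funD; apply: measurable_funM.
  - exact: measurable_conv.
  - exact: td_m1 td.
  - exact: measurable_conv.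
  - exact: td_m2 td.
have lw' : lip (kB m e * N * L + kL m e * N * C + (kB m e * N * L + kL m e * N * C)) w'.
  apply: lipD; apply: lipM.
  - by move=> x; exact: (proj2 (conv_integrable_bounded x kb0 mK1e bK1 bth')).
  - exact: td_b1 td.
  - exact: (conv_lip kb0 kl0 mK1e bK1 lK1 bth').
  - exact: td_l1 td.
  - by move=> x; exact: (proj2 (conv_integrable_bounded x kb0 mK2e bK2 bth')).
  - exact: td_b2 td.
  - exact: (conv_lip kb0 kl0 mK2e bK2 lK2 bth').
  - exact: td_l2 td.
have bw' x : `|w' x| <= 2 * Vmax m M N * C.
  rewrite (le_trans (ler_normD _ _))// -mulrA mulrDl mul1r.
  apply: lerD; rewrite normrM; apply: ler_pM; rewrite ?normr_ge0//.
  - exact: convol_K1_bound.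
  - exact: td_b1 td _.
  - exact: convol_K2_bound.
  - exact: td_b2 td _.
have Vc0 : 0 <= 2 * Vmax m M N * C by rewrite !mulr_ge0.
have s1 := sstep_lipschitz m1 m2 M0 N0 n bth mw' Vc0 bw' (_ : 0 <= _) lw'.
have {}s1 := s1 (addr_ge0 (addr_ge0 (mulr_ge0 (mulr_ge0 kb0 N0) L0) (mulr_ge0 (mulr_ge0 kl0 N0) C0))
  (addr_ge0 (mulr_ge0 (mulr_ge0 kb0 N0) L0) (mulr_ge0 (mulr_ge0 kl0 N0) C0))).
have dconv (k : R * R -> R) : measurable_fun setT k -> (forall z, `|k z| <= kB m e) -> lip (kL m e) k ->
    forall x, `|convol k th' x - convol k th x| <= kL m e * hn n * N.
  move=> mk bk lk x.
  have mkx : measurable_fun setT (fun y : R * R => k (x - y)).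
    by apply: (measurableT_comp mk); exact: measurable_subl.
  have := sstep_lipschitz m1 m2 M0 N0 n bth mkx kb0 (fun y => bk _) kl0 (lip_reflect x lk).
  rewrite /convol -/th'; congr (`|_ - _| <= _); apply: eq_Rintegral => y _; exact: mulrC.
have s2 : `|gflux (convol (K1 m e) th') (convol (K2 m e) th') th g1 g2 -
           gflux (convol (K1 m e) th) (convol (K2 m e) th) th g1 g2| <= 2 * (kL m e * hn n * N) * C * N.
  apply: (gflux_close bth C0 V0).
  - exact: mulr_ge0 (mulr_ge0 kl0 h0) N0.
  - exact: measurable_conv.
  - exact: measurable_conv.
  - exact: measurable_conv.
  - exact: measurable_conv.
  - exact: td_m1 td.
  - exact: td_m2 td.
  - by move=> x; exact: convol_K1_bound.
  - by move=> x; exact: convol_K2_bound.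
  - by move=> x; exact: convol_K1_bound.
  - by move=> x; exact: convol_K2_bound.
  - exact: td_b1 td.
  - exact: td_b2 td.
  - exact: dconv.
  - exact: dconv.
rewrite /Fe (_ : gflux _ _ th' g1 g2 - _ =
  (gflux (convol (K1 m e) th') (convol (K2 m e) th') th' g1 g2 -
   gflux (convol (K1 m e) th') (convol (K2 m e) th') th g1 g2) +
  (gflux (convol (K1 m e) th') (convol (K2 m e) th') th g1 g2 -
   gflux (convol (K1 m e) th) (convol (K2 m e) th) th g1 g2)); last by rewrite addrA subrK.
apply: (le_trans (ler_normD _ _)).
apply: (le_trans (lerD s1 s2)); rewrite /Alip.
rewrite le_eqVlt; apply/orP; left; apply/eqP.
move: (kL m e) (kB m e) (hn n) => a b c; ring.
Qed.

Variable th0 : R * R -> R.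
Hypothesis b0 : bdd th0.

Lemma Fe_scheme e n k i : 0 < e ->
  `|Fe e (scheme th0 n (k + i)%N) g1 g2 - Fe e (scheme th0 n k) g1 g2| <= Alip e * hn n * i%:R.
Proof.
move=> e0; elim: i => [|i IH]; first by rewrite addn0 subrr normr0 mulr0.
rewrite addnS /= -natr1 mulrDr mulr1 [leRHS]addrC.
rewrite (_ : _ - _ = (Fe e (upd n (scheme th0 n (k + i)%N)) g1 g2 - Fe e (scheme th0 n (k + i)%N) g1 g2) +
  (Fe e (scheme th0 n (k + i)%N) g1 g2 - Fe e (scheme th0 n k) g1 g2)); last by rewrite addrA subrK.
apply: (le_trans (ler_normD _ _)); apply: lerD => //.
by apply: Fe_sstep => //; exact: (scheme_bdd m1 m2 M0 N0 n _ b0).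
Qed.

(** The consistency estimate summed over j steps, with all fluxes replaced by one frozen value
    [Fs]. *)
Lemma scheme_increment n k j (Fs e : R) :
  (forall i, (i < j)%N -> `|flux_n n (scheme th0 n (k + i)%N) g1 g2 - Fs| <= e) ->
  `|\int[mu]_x (scheme th0 n (k + j)%N x * g x) - \int[mu]_x (scheme th0 n k x * g x) - j%:R * tau n * Fs|
    <= j%:R * (tau n * e + L * hn n ^+ 2 * N).
Proof.
elim: j => [|j IH] H; first by rewrite addn0 subrr !mul0r subr0 normr0.
have {}IH := IH (fun i ij => H i (ltnW ij)); have {}H := H j (ltnSn j).
set t := scheme th0 n (k + j)%N in IH H.
have bt : bdd t by exact: (scheme_bdd m1 m2 M0 N0 n _ b0).
have S := sstep_consistent m1 m2 M0 N0 n bt C0 L0 td.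
rewrite addnS /= -/t.
have t0 := ltW (tau_gt0 m M0 N0 n).
have Ht : `|tau n * flux_n n t g1 g2 - tau n * Fs| <= tau n * e.
  by rewrite -mulrBr normrM (ger0_norm t0) ler_wpM2l.
move: IH S Ht; rewrite /sstep -/(upd n t).
move: (\int[mu]_x (upd n t x * g x)) (\int[mu]_x (t x * g x)) (\int[mu]_x (scheme th0 n k x * g x)) => A B D.
rewrite -natr1 !mulrDl !mul1r => IH S Ht.
rewrite (_ : A - D - _ = (A - B - tau n * flux_n n t g1 g2) + (tau n * flux_n n t g1 g2 - tau n * Fs) +
  (B - D - j%:R * tau n * Fs)); last by ring.
apply: (le_trans (ler_normD _ _)); rewrite addrC; apply: lerD => //.
by apply: (le_trans (ler_normD _ _)); rewrite addrC; apply: lerD.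
Qed.

End test_functions.
End Flux.

(** * Weak limits along an ultrafilter *)

Section UltrafilterLimit.
Variable R : realType.
Variable U : set_system nat.
Hypothesis UU : UltraFilter U.

Definition ulim (s : nat -> R) : R := lim (s @ U).

(** Compactness of [-C, C] gives a cluster point l. For a neighbourhood of l, either its preimage or
    the complement of it lies in U, and the second is impossible at a cluster point. *)
Lemma ulim_cvg (s : nat -> R) (C : R) : (forall n, `|s n| <= C) -> s @ U --> ulim s.
Proof.
move=> sC.
have FF : ProperFilter (s @ U) by exact: fmap_proper_filter.
have [|l [_ cl]] := @segment_compact R (- C) C (s @ U) FF.
  apply: (@filterS _ U _ setT) => //; last exact: filterT.
  by move=> n _ /=; rewrite in_itv /= -ler_norml.
have cvl : s @ U --> l.
  move=> V Vl; have [//|UnV] := in_ultra_setVsetC (s @^-1` V) UU.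
  by have [y [nVy Vy]] := cl (~` V) V UnV Vl.
by rewrite /ulim (cvg_lim _ cvl).
Qed.

Lemma ulim_unique (s : nat -> R) (l : R) : s @ U --> l -> ulim s = l.
Proof. by move=> sl; rewrite /ulim (cvg_lim _ sl). Qed.

End UltrafilterLimit.

(** * Weak-star limits of bounded sequences, first against weighted indicators *)

Section WeakLimit.
Variable R : realType.
Variable U : set_system nat.
Hypothesis UU : UltraFilter U.
Context d (T : measurableType d) (mu : {sigma_finite_measure set T -> \bar R}).
Variables (w : T -> R) (M : R) (f : nat -> T -> R).
Hypotheses (w0 : forall x, 0 < w x) (iw : mu.-integrable setT (EFin \o w)).
Hypotheses (M0 : 0 <= M) (mf : forall n, measurable_fun setT (f n)).
Hypothesis fM : forall n x, `|f n x| <= M.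
Implicit Types (A B : set T) (g h : T -> R).

(** Adding M makes the density nonnegative, and the integrable weight makes its total mass finite on
    a space of possibly infinite measure. *)
Let J n A : R := \int[mu]_(x in A) ((f n x + M) * w x).
Let W A : R := \int[mu]_(x in A) w x.

Let mw : measurable_fun setT w.
Proof. by apply/measurable_EFinP; exact: measurable_int iw. Qed.

Let fp n x : 0 <= f n x + M <= 2 * M.
Proof. by have := fM n x; rewrite ler_norml => /andP[]; lra. Qed.

Let ifw n : mu.-integrable setT (EFin \o (fun x => (f n x + M) * w x)).
Proof.
apply: (@le_integrable _ _ _ mu setT measurableT _ (fun x => (2 * M)%:E * (w x)%:E)%E).
- by apply/measurable_EFinP; apply: measurable_funM => //; apply: measurable_funD.
- move=> x _; rewrite -EFinM /= lee_fin !normrM (gtr0_norm (w0 x)).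
  have /andP[a b] := fp n x.
  by rewrite ler_wpM2r ?(ltW (w0 x))// !ger0_norm// mulr_ge0.
- exact: integrableZl.
Qed.

Let iwA A : measurable A -> mu.-integrable A (EFin \o w).
Proof. by move=> mA; exact: integrableS iw. Qed.

Let ifwA n A : measurable A -> mu.-integrable A (EFin \o (fun x => (f n x + M) * w x)).
Proof. by move=> mA; exact: integrableS (ifw n). Qed.

Let J_ge0 n A : 0 <= J n A.
Proof.
apply: Rintegral_ge0 => x _; have /andP[a b] := fp n x.
by rewrite mulr_ge0// ltW.
Qed.

Let J_le n A : measurable A -> J n A <= 2 * M * W A.
Proof.
move=> mA; rewrite /J /W -RintegralZl//; last exact: iwA.
apply: le_Rintegral => //; first exact: ifwA.
  exact: (integrableZl mA (2 * M) (iwA mA)).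
by move=> x _; have /andP[a b] := fp n x; rewrite ler_wpM2r// ltW.
Qed.

Let nu0 A : R := ulim U (fun n => J n A).

Let nu0_cvg A : measurable A -> (fun n => J n A) @ U --> nu0 A.
Proof.
move=> mA; apply: (ulim_cvg UU (C := 2 * M * W A)) => n.
by rewrite ger0_norm// J_le.
Qed.

Let nu0_ge0 A : measurable A -> 0 <= nu0 A.
Proof.
by move=> mA; apply: (cvgr_to_ge (nu0_cvg mA)); exact: nearW.
Qed.

Let nu0_le A : measurable A -> nu0 A <= 2 * M * W A.
Proof.
by move=> mA; apply: (cvgr_to_le (nu0_cvg mA)); apply: nearW => n; exact: J_le.
Qed.

Let nu0U A B : measurable A -> measurable B -> A `&` B = set0 -> nu0 (A `|` B) = nu0 A + nu0 B.
Proof.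
move=> mA mB AB; apply: ulim_unique.
have -> : (fun n => J n (A `|` B)) = (fun n => J n A + J n B).
  apply/funext => n; rewrite /J Rintegral_setU//; first exact: ifwA (measurableU _ _ _ _).
  by rewrite disj_set2E; apply/eqP.
by apply: cvgD; exact: nu0_cvg.
Qed.

Let WU A B : measurable A -> measurable B -> A `&` B = set0 -> W (A `|` B) = W A + W B.
Proof.
move=> mA mB AB; rewrite /W Rintegral_setU//; first exact: iwA (measurableU _ _ _ _).
by rewrite disj_set2E; apply/eqP.
Qed.

(* [nu0] is only known to be nonnegative on measurable sets, while a measure has to
   be nonnegative on all sets. *)
Definition wnu A : \bar R := (Num.max 0 (nu0 A))%:E.

Let wnuE A : measurable A -> wnu A = (nu0 A)%:E.
Proof. by move=> mA; rewrite /wnu; congr EFin; apply/max_idPr; exact: nu0_ge0. Qed.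

Let wnu0 : wnu set0 = 0%E.
Proof.
rewrite wnuE//; congr EFin; apply: ulim_unique.
rewrite (_ : (fun n => _) = fun=> 0); first exact: cvg_cst.
by apply/funext => n; rewrite /J Rintegral_set0.
Qed.

Let wnu_ge0 A : (0 <= wnu A)%E.
Proof. by rewrite lee_fin le_max lexx. Qed.

(** A limit of measures along an ultrafilter is a priori only finitely additive. Here the remainder
    of a countable union has [nu0]-mass at most [2 * M] times its [W]-mass, and that tends to 0
    because [W] is countably additive. *)
Let wnu_sigma : semi_sigma_additive wnu.
Proof.
move=> F mF tF mUF.
pose P n := \big[setU/set0]_(0 <= i < n) F i.
have mP n : measurable (P n) by exact: bigsetU_measurable.
have dP n : P n `&` F n = set0.
  rewrite /P big_distrl /= big_nat big1// => i /andP[_ ni].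
  move/trivIsetP : tF => /(_ i n Logic.I Logic.I); apply.
  by rewrite ltn_eqF.
have Pn n : P n.+1 = P n `|` F n by rewrite /P big_nat_recr.
have Wsum n : W (P n) = \sum_(0 <= i < n) W (F i).
  elim: n => [|n IH]; first by rewrite /P !big_nil /W Rintegral_set0.
  by rewrite Pn WU// IH big_nat_recr.
have nsum n : (\sum_(0 <= i < n) wnu (F i))%E = (nu0 (P n))%:E.
  elim: n => [|n IH]; first by rewrite /P !big_nil -(wnuE measurable0) wnu0.
  by rewrite Pn nu0U// big_nat_recr//= IH wnuE.
have WE A : measurable A -> (\int[mu]_(x in A) (w x)%:E)%E = (W A)%:E.
  by move=> mA; rewrite /W /Rintegral fineK//; exact: (integrable_fin_num mA (iwA mA)).
have WF : (fun n => W (P n)) @ \oo --> W (\bigcup_n F n).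
  have := @semi_sigma_additive_nng_induced _ _ _ mu (EFin \o w) (measurable_int _ iw)
    (fun x => ltW (w0 x : (0 < (w x)%:E)%E)) F mF tF mUF.
  rewrite /= WE// => /fine_cvg /= WF.
  rewrite (_ : (fun n => W (P n)) = (fun n => fine (\sum_(0 <= i < n) \int[mu]_(x in F i) (w x)%:E)%E)) //.
  apply/funext => n; under eq_bigr do rewrite WE//.
  by rewrite sumEFin /= Wsum.
have PF n : P n `<=` \bigcup_n F n.
  by rewrite /P big_mkord -bigcup_mkord => x [i _ Fx]; exists i.
have split n : \bigcup_n F n = P n `|` (\bigcup_n F n `\` P n).
  by rewrite setDUK.
have mD n : measurable (\bigcup_n F n `\` P n) by exact: measurableD.
have disj n : P n `&` (\bigcup_n F n `\` P n) = set0 by rewrite setDIK.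
have E1 n : nu0 (\bigcup_n F n) = nu0 (P n) + nu0 (\bigcup_n F n `\` P n).
  by rewrite {1}(split n) nu0U.
have E2 n : W (\bigcup_n F n) = W (P n) + W (\bigcup_n F n `\` P n).
  by rewrite {1}(split n) WU.
rewrite wnuE//; under eq_fun do rewrite nsum.
apply: cvg_EFin; first exact: nearW.
apply: (@squeeze_cvgr _ _ _ _ (fun n => nu0 (\bigcup_n F n) - 2 * M * (W (\bigcup_n F n) - W (P n)))
   (fun=> nu0 (\bigcup_n F n))).
- apply: nearW => n /=; have := nu0_ge0 (mD n); have := nu0_le (mD n).
  have := E1 n; have := E2 n; set a := W (_ `\` _); set b := nu0 (_ `\` _) => -> -> h1 h2.
  by apply/andP; split; lra.
- rewrite -[X in _ --> X]subr0; apply: cvgB; first exact: cvg_cst.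
  rewrite -(mulr0 (2 * M)); apply: cvgM; first exact: cvg_cst.
  rewrite -(subrr (W (\bigcup_n F n))); apply: cvgB => //; exact: cvg_cst.
- exact: cvg_cst.
Qed.

HB.instance Definition _ := isMeasure.Build _ _ _ wnu wnu0 wnu_ge0 wnu_sigma.

Let wnu_fin : fin_num_fun wnu. Proof. by move=> A mA. Qed.

HB.instance Definition _ := Measure_isFinite.Build _ _ _ wnu wnu_fin.

Let wnu_dom : wnu `<< mu.
Proof.
apply/null_content_dominatesP => A mA A0; rewrite wnuE//; congr EFin; apply/eqP.
rewrite eq_le nu0_ge0// andbT (le_trans (nu0_le mA))//.
rewrite /W /Rintegral (_ : (\int[mu]_(x in A) (w x)%:E)%E = 0%E) ?mulr0//.
by apply: null_set_integral => //; exact: measurable_int (iwA mA).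
Qed.

(* [nu0] is the limit of the finite measures [(f n + M) w dmu]; Radon-Nikodym gives
   its density. *)
Lemma weak_limit_density : exists F : T -> R, [/\ measurable_fun setT F,
  forall x, `|F x| <= M &
  forall A, measurable A ->
    (fun n => \int[mu]_(x in A) (f n x * w x)) @ U --> \int[mu]_(x in A) (F x * w x)].
Proof.
have [r [r0 rfin ir rE]] := radon_nikodym_sigma_finite wnu_dom.
pose rr x := fine (r x).
have rrE x : (rr x)%:E = r x by rewrite /rr fineK.
have rr0 x : 0 <= rr x by rewrite fine_ge0.
have irr : mu.-integrable setT (EFin \o rr).
  by move: ir; congr (integrable _ _ _); apply/funext => x /=; rewrite rrE.
have mrr : measurable_fun setT rr by apply/measurable_EFinP; exact: measurable_int irr.
(* The density [rr] obeys the upper bound only almost everywhere; the minimum obeys it everywhere.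
   It still represents [nu0]: on B it equals [rr], and off B it equals the bound, which dominates
   [nu0] by [nu0_le]. *)
pose q x := Num.min (rr x) (2 * M * w x).
have q0 x : 0 <= q x by rewrite le_min rr0 mulr_ge0 ?mulr_ge0// ltW.
have mq : measurable_fun setT q by apply: measurable_minr => //; exact: measurable_funM.
have iq : mu.-integrable setT (EFin \o q).
  apply: (@le_integrable _ _ _ mu setT measurableT _ (EFin \o rr)) => //.
    exact/measurable_EFinP.
  by move=> x _ /=; rewrite lee_fin !ger0_norm// ge_min lexx.
have nurr A : measurable A -> nu0 A = \int[mu]_(x in A) rr x.
  move=> mA; have h : wnu A = (\int[mu]_(x in A) r x)%E := rE A mA; rewrite wnuE// in h.
  by rewrite /Rintegral; under eq_integral do rewrite rrE; rewrite -h.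
have iS g A : measurable A -> mu.-integrable setT (EFin \o g) -> mu.-integrable A (EFin \o g).
  by move=> mA ig; exact: integrableS ig.
have nuq A : measurable A -> nu0 A = \int[mu]_(x in A) q x.
  move=> mA; apply/eqP; rewrite eq_le; apply/andP; split; last first.
    rewrite nurr//; apply: le_Rintegral => //; [exact: iS|exact: iS|].
    by move=> x _; rewrite ge_min lexx.
  pose B := [set x | rr x <= 2 * M * w x].
  have mB : measurable B.
    have mb : measurable_fun setT (fun x => rr x <= 2 * M * w x).
      by apply: measurable_fun_ler => //; exact: measurable_funM.
    by have := mb measurableT [set true] Logic.I; rewrite setTI; congr measurable; apply/seteqP; split.
  have mAB : measurable (A `&` B) by exact: measurableI.
  have mADB : measurable (A `\` B) by exact: measurableD.
  have dAB : A `&` B `&` (A `\` B) = set0.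
    by rewrite setDE setIACA setICr setI0.
  have EA : A = (A `&` B) `|` (A `\` B) by rewrite setUIDK.
  have -> : nu0 A = nu0 (A `&` B) + nu0 (A `\` B) by rewrite -nu0U// -EA.
  have -> : \int[mu]_(x in A) q x = \int[mu]_(x in A `&` B) q x + \int[mu]_(x in A `\` B) q x.
    rewrite -Rintegral_setU -?EA//; first exact: iS.
    by rewrite disj_set2E; apply/eqP.
  apply: lerD.
    rewrite nurr// le_eqVlt; apply/orP; left; apply/eqP; apply: eq_Rintegral => x.
    by rewrite inE => -[_ /= h]; rewrite /q; apply/esym/min_idPl.
  apply: (le_trans (nu0_le mADB)); rewrite /W -RintegralZl//; last exact: iwA.
  rewrite le_eqVlt; apply/orP; left; apply/eqP; apply: eq_Rintegral => x.
  rewrite inE => -[_ /= /negP]; rewrite -ltNge => h.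
  by rewrite /q; apply/esym/min_idPr/ltW.
(* Undoes the passage from f to [(f + M) * w]. *)
exists (fun x => q x / w x - M); split.
- apply: measurable_funB => //; apply: measurable_funM => //.
  rewrite (_ : (fun x => (w x)^-1) = (fun x => w x `^ (- 1))).
    by apply: (measurableT_comp (measurable_powR _)).
  by apply/funext => x; rewrite powR_inv1// ltW.
- move=> x; have h0 : 0 <= q x / w x by rewrite divr_ge0// ltW.
  have h1 : q x / w x <= 2 * M by rewrite ler_pdivrMr// /q ge_min lexx orbT.
  by rewrite ler_norml; apply/andP; split; lra.
move=> A mA.
have iMw : mu.-integrable A (EFin \o (fun x => M * w x)).
  exact: (integrableZl mA M (iwA mA)).
rewrite (_ : (fun n => _) = (fun n => J n A - M * W A)); last first.
  apply/funext => n; rewrite /J /W -RintegralZl//; last exact: iwA.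
  rewrite -RintegralB//; last exact: ifwA.
  by apply: eq_Rintegral => x _; ring.
rewrite (_ : \int[mu]_(x in A) _ = nu0 A - M * W A); last first.
  rewrite nuq// /W -RintegralZl//; last exact: iwA.
  rewrite -RintegralB//; last exact: iS.
  by apply: eq_Rintegral => x _; field; rewrite gt_eqF.
by apply: cvgB; [exact: nu0_cvg|exact: cvg_cst].
Qed.

End WeakLimit.

Section WeakLimitL1.
Import HBNNSimple.
Variable R : realType.
Variable U : set_system nat.
Hypothesis UU : UltraFilter U.
Context d (T : measurableType d) (mu : {sigma_finite_measure set T -> \bar R}).
Variables (w : T -> R) (M : R) (f : nat -> T -> R).
Hypotheses (w0 : forall x, 0 < w x) (iw : mu.-integrable setT (EFin \o w)).
Hypotheses (M0 : 0 <= M) (mf : forall n, measurable_fun setT (f n)).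
Hypothesis fM : forall n x, `|f n x| <= M.
Implicit Types (A B : set T) (g h : T -> R).

Let bounded_mul g (F : T -> R) : mu.-integrable setT (EFin \o g) -> measurable_fun setT F ->
  (forall x, `|F x| <= M) -> mu.-integrable setT (EFin \o (fun x => F x * g x)) /\
  `|\int[mu]_x (F x * g x)| <= M * \int[mu]_x `|g x|.
Proof.
move=> ig mF FM.
have mg : measurable_fun setT g by apply/measurable_EFinP; exact: measurable_int ig.
have ign : mu.-integrable setT (EFin \o (fun x => `|g x|)) by exact: integrable_norm.
have iF : mu.-integrable setT (EFin \o (fun x => F x * g x)).
  apply: (@le_integrable _ _ _ mu setT measurableT _ (fun x => M%:E * (`|g x|)%:E)%E).
  - by apply/measurable_EFinP; exact: measurable_funM.
  - by move=> x _; rewrite -EFinM /= lee_fin !normrM normr_id (ger0_norm M0) ler_wpM2r.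
  - exact: (integrableZl measurableT M ign).
split => //; apply: (le_trans (le_normr_Rintegral measurableT iF)).
rewrite -RintegralZl//; apply: le_Rintegral => //.
- exact: integrable_norm.
- exact: (integrableZl measurableT M ign).
- by move=> x _; rewrite normrM ler_wpM2r.
Qed.

(** The good test functions [P] form a vector space containing [w * 1_A], and they are closed in L^1
    because all [f n] and F share the bound M. Simple functions times w, then nonnegative g, then
    general g follow. *)
Lemma weak_limit : exists F : T -> R, [/\ measurable_fun setT F,
  forall x, `|F x| <= M &
  forall g, mu.-integrable setT (EFin \o g) ->
    (fun n => \int[mu]_x (f n x * g x)) @ U --> \int[mu]_x (F x * g x)].
Proof.
have [F [mF FM FA]] := weak_limit_density UU w0 iw M0 mf fM.
exists F; split => //.
pose P g := mu.-integrable setT (EFin \o g) /\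
  (fun n => \int[mu]_x (f n x * g x)) @ U --> \int[mu]_x (F x * g x).
have PD g h : P g -> P h -> P (fun x => g x + h x).
  move=> [ig cg] [ih ch]; split; first exact: (integrableD measurableT ig ih).
  have E (k : T -> R) : measurable_fun setT k -> (forall x, `|k x| <= M) ->
    \int[mu]_x (k x * (g x + h x)) = \int[mu]_x (k x * g x) + \int[mu]_x (k x * h x).
    move=> mk kM; rewrite -RintegralD//; [|exact: (proj1 (bounded_mul ig mk kM))|exact: (proj1 (bounded_mul ih mk kM))].
    by apply: eq_Rintegral => x _; rewrite mulrDr.
  rewrite E//; under eq_fun do rewrite E//.
  exact: cvgD.
have PZ c g : P g -> P (fun x => c * g x).
  move=> [ig cg]; split; first exact: (integrableZl measurableT c ig).
  have E (k : T -> R) : measurable_fun setT k -> (forall x, `|k x| <= M) ->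
    \int[mu]_x (k x * (c * g x)) = c * \int[mu]_x (k x * g x).
    move=> mk kM; rewrite -RintegralZl//; last exact: (proj1 (bounded_mul ig mk kM)).
    by apply: eq_Rintegral => x _; rewrite mulrCA.
  rewrite E//; under eq_fun do rewrite E//.
  by apply: cvgM => //; exact: cvg_cst.
have PA A : measurable A -> P (fun x => w x * \1_A x).
  move=> mA.
  have E (k : T -> R) : \int[mu]_x (k x * (w x * \1_A x)) = \int[mu]_(x in A) (k x * w x).
    rewrite [RHS]Rintegral_mkcond; apply: eq_Rintegral => x _.
    by rewrite patchE indicE; case: ifP => _; rewrite ?mulr1 ?mulr0.
  split; last first.
    by rewrite E; under eq_fun do rewrite E; exact: FA.
  apply: (@le_integrable _ _ _ mu setT measurableT _ (EFin \o w)) => //.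
    apply/measurable_EFinP; apply: measurable_funM; last exact: measurable_indic.
    by apply/measurable_EFinP; exact: measurable_int iw.
  move=> x _; rewrite /= lee_fin normrM indicE; case: (x \in A); rewrite ?normr1 ?normr0 ?mulr1 ?mulr0//.
have PS (s : {nnsfun T >-> R}) : P (fun x => w x * s x).
  rewrite (_ : (fun x => w x * s x) =
    (fun x => \sum_(y <- finmap.enum_fset (fset_set (range s))) y * (w x * \1_(s @^-1` [set y]) x))); last first.
    apply/funext => x; rewrite {1}(fimfunE s x) fsbig_finite//= mulr_sumr.
    by apply: eq_bigr => y _; rewrite mulrCA.
  elim: (finmap.enum_fset _) => [|y r IH].
    under [X in P X]eq_fun do rewrite big_nil.
    by have := PZ 0 _ (PA _ measurable0); under [X in P X]eq_fun do rewrite mul0r.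
  under [X in P X]eq_fun do rewrite big_cons.
  apply: PD => //; apply: PZ; apply: PA; exact: measurable_funPTI.
have PL g : mu.-integrable setT (EFin \o g) ->
    (forall e : R, 0 < e -> exists2 g', P g' & \int[mu]_x `|g x - g' x| <= e) -> P g.
  move=> ig H; split => //; apply/cvgrPdist_le => e e0.
  (* M may be 0, so a positive bound is taken for the division. *)
  have [M1 M10] : exists2 M1, 0 < M1 & M <= M1 by exists (M + 1); rewrite ?lerDl// ltr_wpDl.
  move=> MM1.
  have [g' [ig' cg'] gg'] := H (e / (3 * M1)) (divr_gt0 e0 (mulr_gt0 (ltr0n _ 3) M10)).
  have igg : mu.-integrable setT (EFin \o (fun x => g x - g' x)).
    exact: (integrableB measurableT ig ig').
  have bnd (k : T -> R) : measurable_fun setT k -> (forall x, `|k x| <= M) ->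
    `|\int[mu]_x (k x * g x) - \int[mu]_x (k x * g' x)| <= e / 3.
    move=> mk kM; have [i1 _] := bounded_mul ig mk kM; have [i2 _] := bounded_mul ig' mk kM.
    have [_ b] := bounded_mul igg mk kM.
    rewrite -RintegralB//.
    under eq_Rintegral do rewrite -mulrBr.
    apply: (le_trans b); apply: (@le_trans _ _ (M1 * (e / (3 * M1)))).
      by apply: ler_pM => //; apply: Rintegral_ge0.
    by rewrite le_eqVlt; apply/orP; left; apply/eqP; field; rewrite gt_eqF.
  move/cvgrPdist_le: cg' => /(_ (e / 3) (divr_gt0 e0 (ltr0n _ 3))).
  apply: filterS => n h1; have h2 := bnd _ mF FM; have h3 := bnd _ (mf n) (fM n).
  rewrite (_ : _ - _ = (\int[mu]_x (F x * g x) - \int[mu]_x (F x * g' x)) +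
    (\int[mu]_x (F x * g' x) - \int[mu]_x (f n x * g' x)) -
    (\int[mu]_x (f n x * g x) - \int[mu]_x (f n x * g' x))); last by ring.
  apply: (le_trans (ler_normB _ _)).
  have := ler_normD (\int[mu]_x (F x * g x) - \int[mu]_x (F x * g' x)) (\int[mu]_x (F x * g' x) - \int[mu]_x (f n x * g' x)).
  by lra.
have Ppos g : mu.-integrable setT (EFin \o g) -> (forall x, 0 <= g x) -> P g.
  move=> ig g0; apply: PL => // e e0.
  have mw : measurable_fun setT w by apply/measurable_EFinP; exact: measurable_int iw.
  have mg : measurable_fun setT g by apply/measurable_EFinP; exact: measurable_int ig.
  (* The functions known to satisfy [P] are w times simple ones, so it is g / w that is
     approximated; g dominates the errors. *)
  pose h x := g x / w x.
  have h0 x : (0 <= (h x)%:E)%E by rewrite lee_fin divr_ge0// ltW.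
  have mh : measurable_fun setT (EFin \o h).
    apply/measurable_EFinP; apply: measurable_funM => //.
    rewrite (_ : (fun x => (w x)^-1) = (fun x => w x `^ (- 1))).
      by apply: (measurableT_comp (measurable_powR _)).
    by apply/funext => x; rewrite powR_inv1// ltW.
  pose s := nnsfun_approx measurableT mh.
  have sh n x : s n x <= h x.
    by have := @le_approx _ _ _ setT (EFin \o h) n x (fun x _ => h0 x) Logic.I; rewrite lee_fin /s nnsfun_approxE.
  have sc x : (fun n => s n x) @ \oo --> h x.
    have := @cvg_nnsfun_approx _ _ _ setT measurableT _ mh (fun x _ => h0 x) x Logic.I.
    by move/fine_cvg.
  have s0 n x : 0 <= s n x by exact: fun_ge0.
  have gE x : g x = w x * h x by rewrite /h mulrC divfK// gt_eqF.
  have ws n x : w x * s n x <= g x by rewrite gE ler_wpM2l// ltW.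
  have [] := @dominated_convergence _ _ _ mu setT measurableT
    (fun n x => (g x - w x * s n x)%:E) (cst 0%E) (EFin \o g).
  - move=> n; apply/measurable_EFinP; apply: measurable_funB => //; exact: measurable_funM.
  - exact: measurable_cst.
  - apply: aeW => x _; apply: cvg_EFin; first exact: nearW.
    rewrite (_ : 0 = g x - w x * h x); last by rewrite -gE subrr.
    by apply: cvgB; [exact: cvg_cst|apply: cvgM; [exact: cvg_cst|exact: sc]].
  - exact: ig.
  - apply: aeW => x n _ /=; rewrite lee_fin ger0_norm ?subr_ge0//.
    by rewrite gerBl mulr_ge0// ltW.
  move=> _ _ dc; have {}dc : (\int[mu]_x (g x - w x * s n x)%:E)%E @[n --> \oo] --> 0%E.
    by move: dc; rewrite integral0.
  move/fine_cvgP : dc => [_ /cvgrPdist_le /(_ e e0)][n _ /(_ n (leqnn n))] /= hn.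
  exists (fun x => w x * s n x); first exact: PS.
  apply: le_trans hn; rewrite sub0r normrN.
  rewrite (_ : \int[mu]_x `|g x - w x * s n x| = \int[mu]_x (g x - w x * s n x)); first exact: ler_norm.
  by apply: eq_Rintegral => x _; rewrite ger0_norm// subr_ge0.
move=> g ig; suff [] : P g by [].
have Pp := Ppos _ (integrable_funrpos measurableT ig) (fun x => funrpos_ge0 g x).
have Pn := PZ (- 1) _ (Ppos _ (integrable_funrneg measurableT ig) (fun x => funrneg_ge0 g x)).
rewrite (_ : g = (fun x => g^\+ x + -1 * g^\- x)); first exact: PD.
by apply/funext => x; rewrite mulN1r; exact: (congr1 (fun k => k x) (esym (funrposBneg g))).
Qed.

End WeakLimitL1.

(** * Passage to the limit *)

Section TestFunctions.
Variable R : realType.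
Implicit Types (f phi : R * R -> R) (x : R * R).
Local Notation e1 := ((1 : R), (0 : R)).
Local Notation e2 := ((0 : R), (1 : R)).
Local Notation mu := (@leb2 R).

Definition vanishes_off (K : set (R * R)) f := forall x, ~ K x -> f x = 0.

Lemma vanishes_off_derive (K : set (R * R)) f v : closed K -> vanishes_off K f -> v != 0 ->
  vanishes_off K (fun x => 'D_v f x).
Proof.
move=> cK fK v0 x nKx.
rewrite (@near_eq_derive _ _ _ f (cst 0)) ?derive_cst//.
have : nbhs x (~` K) by apply: open_nbhs_nbhs; split => //; exact: closed_openC.
by apply: filterS => y; exact: fK.
Qed.

Lemma compact_support_bounded (K : set (R * R)) f : compact K -> continuous f -> vanishes_off K f ->
  exists2 C, 0 <= C & forall x, `|f x| <= C.
Proof.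
move=> cK cf fK.
have /compact_bounded [C0 [_ /(_ (`|C0| + 1))]] : compact (f @` K).
  by apply: continuous_compact => //; exact: continuous_subspaceT.
rewrite (le_lt_trans (ler_norm _))// ?ltrDl// => /(_ isT) H.
exists (`|C0| + 1); first by rewrite addr_ge0.
move=> x; have [Kx|nKx] := pselect (K x).
  by apply: H; exists x.
by rewrite fK// normr0 addr_ge0.
Qed.

Lemma compact_subset_box (K : set (R * R)) : compact K -> exists2 r, 0 <= r & K `<=` box r.
Proof.
move=> cK; have [C [_ /(_ (`|C| + 1))]] := compact_bounded cK.
rewrite (le_lt_trans (ler_norm _))// ?ltrDl// => /(_ isT) H.
exists (`|C| + 1); first by rewrite addr_ge0.
move=> x Kx; have := H x Kx; rewrite /= prod_normE ge_max => /andP[h1 h2].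
by split; rewrite /= in_itv /= -ler_norml.
Qed.

(** Derivatives vanish off the closed support K because its complement is open. Being continuous,
    those of order up to two are bounded on K, hence everywhere, and the second-order bounds yield
    the Lipschitz and Taylor constants. *)
Lemma test_funP phi : test_fun phi -> exists K C L, [/\ compact K, 0 <= C, 0 <= L,
  test_data C L phi (d1 phi) (d2 phi) &
  [/\ vanishes_off K phi, vanishes_off K (d1 phi) & vanishes_off K (d2 phi)]].
Proof.
move=> [ck cK]; set K := closure _ in cK.
have clK : closed K by exact: closed_closure.
have v0 : vanishes_off K phi.
  move=> x nKx; apply/eqP; apply: contra_notT nKx => h; exact: subset_closure.
have e10 : e1 != 0 :> R * R by apply/eqP => -[/eqP]; rewrite oner_eq0.
have e20 : e2 != 0 :> R * R by apply/eqP => -[/eqP]; rewrite oner_eq0.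
have vd1 f : vanishes_off K f -> vanishes_off K (d1 f) by move=> h; exact: vanishes_off_derive.
have vd2 f : vanishes_off K f -> vanishes_off K (d2 f) by move=> h; exact: vanishes_off_derive.
have [cphi [dphi [[cd1 [dd1 [[c11 _] [c12 _]]]] [cd2 [dd2 [[c21 _] [c22 _]]]]]]] := ck 2.
have [C0 C00 hC0] := compact_support_bounded cK cphi v0.
have [C1 C10 hC1] := compact_support_bounded cK cd1 (vd1 _ v0).
have [C2 C20 hC2] := compact_support_bounded cK cd2 (vd2 _ v0).
have [L1 L10 hL1] := compact_support_bounded cK c11 (vd1 _ (vd1 _ v0)).
have [L2 L20 hL2] := compact_support_bounded cK c12 (vd2 _ (vd1 _ v0)).
have [L3 L30 hL3] := compact_support_bounded cK c21 (vd1 _ (vd2 _ v0)).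
have [L4 L40 hL4] := compact_support_bounded cK c22 (vd2 _ (vd2 _ v0)).
pose L := L1 + L2 + L3 + L4.
have LL x : [/\ `|d1 (d1 phi) x| <= L, `|d2 (d1 phi) x| <= L, `|d1 (d2 phi) x| <= L & `|d2 (d2 phi) x| <= L].
  by split; [apply: le_trans (hL1 x) _|apply: le_trans (hL2 x) _|apply: le_trans (hL3 x) _|apply: le_trans (hL4 x) _]; rewrite /L; lra.
have L0 : 0 <= L by rewrite !addr_ge0.
have l1 : lip L (d1 phi).
  move=> x t; split; apply: lipschitz_line => y.
  - exact: (proj1 (dd1 y)).
  - have [h _ _ _] := LL y; exact: h.
  - exact: (proj2 (dd1 y)).
  - have [_ h _ _] := LL y; exact: h.
have l2 : lip L (d2 phi).
  move=> x t; split; apply: lipschitz_line => y.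
  - exact: (proj1 (dd2 y)).
  - have [_ _ h _] := LL y; exact: h.
  - exact: (proj2 (dd2 y)).
  - have [_ _ _ h] := LL y; exact: h.
exists K, (C0 + C1 + C2), L; split => //.
- by rewrite !addr_ge0.
- split.
  + exact: continuous_measurable_fun2.
  + exact: continuous_measurable_fun2.
  + exact: continuous_measurable_fun2.
  + by move=> x; apply: le_trans (hC0 x) _; lra.
  + by move=> x; apply: le_trans (hC1 x) _; lra.
  + by move=> x; apply: le_trans (hC2 x) _; lra.
  + exact: l1.
  + exact: l2.
  + by apply: taylor_line L0 => [y|x t]; [exact: (proj1 (dphi y))|exact: (proj1 (l1 x t))].
  + by apply: taylor_line L0 => [y|x t]; [exact: (proj2 (dphi y))|exact: (proj2 (l2 x t))].
- by split; [|exact: vd1|exact: vd2].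
Qed.

Lemma integrable_box (r C : R) f : measurable_fun setT f -> (forall x, `|f x| <= C) ->
  vanishes_off (box r) f -> mu.-integrable setT (EFin \o f).
Proof.
move=> mf fC fb.
have C0 : 0 <= C := le_trans (normr_ge0 _) (fC 0).
have ib : mu.-integrable setT (fun x => C%:E * (\1_(box r) x)%:E)%E.
  apply: integrableZl => //.
  apply/integrableP; split; first by apply/measurable_EFinP; apply: measurable_indic; exact: measurable_box.
  under eq_integral do rewrite gee0_abs ?lee_fin//.
  by rewrite integral_indic//; [rewrite setIT; exact: leb2_box_lty|exact: measurable_box].
apply: (@le_integrable _ _ _ mu setT measurableT _ _ _ _ ib); first exact/measurable_EFinP.
move=> x _; rewrite -EFinM /= lee_fin indicE; have [xb|xb] := boolP (x \in box r).
  by rewrite mulr1 (ger0_norm C0).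
by rewrite fb ?normr0// => bx; move: xb; rewrite notin_setE.
Qed.

(** A Gaussian, chosen as a strictly positive integrable weight on the whole plane for
    [weak_limit]. *)
Definition gweight x : R := gauss_fun x.1 * gauss_fun x.2.

Lemma gweight_gt0 x : 0 < gweight x.
Proof. by rewrite mulr_gt0// expR_gt0. Qed.

Lemma integrable_gweight : mu.-integrable setT (EFin \o gweight).
Proof.
have mg : measurable_fun setT (fun x : R * R => gweight x).
  have mf := @measurable_fst _ _ (measurableTypeR R) (measurableTypeR R).
  have ms := @measurable_snd _ _ (measurableTypeR R) (measurableTypeR R).
  have mg := @measurable_gauss_fun R.
  by apply: measurable_funM; [exact: (measurableT_comp mg mf)|exact: (measurableT_comp mg ms)].
apply/integrableP; split; first exact/measurable_EFinP.
under eq_integral do rewrite /= ger0_norm ?(ltW (gweight_gt0 _))//.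
rewrite /leb2 fubini_tonelli1//=; last 2 first.
- exact/measurable_EFinP.
- by move=> x; rewrite lee_fin ltW// gweight_gt0.
rewrite /fubini_F /=.
have g0 (y : R) : 0 <= gauss_fun y by exact: gauss_fun_ge0.
have mgE : measurable_fun setT (fun y : R => (gauss_fun y)%:E).
  by apply/measurable_EFinP; exact: measurable_gauss_fun.
under eq_integral => x _.
  rewrite /gweight /=; under eq_integral do rewrite EFinM.
  rewrite ge0_integralZl//; [over|by move=> y _; rewrite lee_fin|by rewrite lee_fin].
have ifin : (\int[lebesgue_measure]_y (gauss_fun (y:R))%:E < +oo)%E.
  exact: (integrable_lty measurableT (@integrableT_gauss R)).
have i0 : (0 <= \int[lebesgue_measure]_y (gauss_fun (y : R))%:E)%E.
  by apply: integral_ge0 => y _; rewrite lee_fin.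
rewrite ge0_integralZr//; last by move=> y _; rewrite lee_fin.
by apply: lte_mul_pinfty => //; rewrite ge0_fin_numE.
Qed.

End TestFunctions.

(** * Lower semicontinuity and convergence of velocities under weak-star convergence *)

Section WeakConvergence.
Variable R : realType.
Implicit Types (f : nat -> R * R -> R) (F g : R * R -> R).
Local Notation mu := (@leb2 R).

Definition wcvg (U : set_system nat) f F := forall g, mu.-integrable setT (EFin \o g) ->
  \int[mu]_x (f n x * g x) @[n --> U] --> \int[mu]_x (F x * g x).

(* The tangent inequality at [F x] bounds [|f n x|^p] below by an affine function of
   [f n x], to which weak convergence applies. *)
Lemma weak_lsc (U : set_system nat) (FU : ProperFilter U) f F M p B :
  wcvg U f F -> (forall n, measurable_fun setT (f n)) -> measurable_fun setT F ->
  (forall n x, `|f n x| <= M) -> (forall x, `|F x| <= M) -> 1 <= p ->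
  (forall n, (\int[mu]_x (`|f n x| `^ p)%:E <= B)%E) ->
  (\int[mu]_x (`|F x| `^ p)%:E <= B)%E.
Proof.
move=> fF mf mF fM FM p1 fB.
have M0 : 0 <= M := le_trans (normr_ge0 _) (FM 0).
have p0 : 0 <= p := le_trans ler01 p1.
have mpow (h : R * R -> R) : measurable_fun setT h -> measurable_fun setT (fun x : R * R => `|h x| `^ p).
  by move=> mh; apply: (measurableT_comp (measurable_powR p)); exact: measurableT_comp.
case: B fB => [b fB|_|fB]; last 2 first.
- exact: leey.
- have : (0 <= \int[mu]_x (`|f 0%N x| `^ p)%:E)%E by apply: integral_ge0 => x _; rewrite lee_fin powR_ge0.
  by move=> /le_trans/(_ (fB 0%N)); rewrite leeNy_eq.
(* A test function must be integrable, and the slope at F is merely bounded, so the inequality is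
   proved on boxes and extended by monotone convergence. *)
have step k : (\int[mu]_(x in box k%:R) (`|F x| `^ p)%:E <= b%:E)%E.
  pose B := box (k%:R : R).
  have mB : measurable B by exact: measurable_box.
  pose s x := \1_B x * powR_slope p (F x).
  pose q (h : R * R -> R) x : R := \1_B x * (`|h x| `^ p).
  have voff (h : R * R -> R) : vanishes_off (box k%:R) (fun x => \1_B x * h x).
    by move=> x nB; rewrite indicE memNset ?mul0r.
  have m1 : measurable_fun setT (\1_B : R * R -> R) by exact: measurable_indic.
  have b1 x : `|\1_B x : R| <= 1 by rewrite indicE; case: (_ \in _); rewrite ?normr1 ?normr0.
  have iq (h : R * R -> R) : measurable_fun setT h -> (forall x, `|h x| <= M) -> mu.-integrable setT (EFin \o q h).
    move=> mh hM; apply: (@integrable_box _ k%:R (M `^ p)); [|move=> x|exact: voff].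
      by apply: measurable_funM => //; exact: mpow.
    rewrite normrM -[leRHS]mul1r; apply: ler_pM => //.
    by rewrite ger0_norm ?powR_ge0// ge0_ler_powR// nnegrE.
  have is_ : mu.-integrable setT (EFin \o s).
    apply: (@integrable_box _ k%:R (p * M `^ (p - 1))); [|move=> x|exact: voff].
      by apply: measurable_funM => //; apply: measurableT_comp => //; exact: measurable_powR_slope.
    by rewrite normrM -[leRHS]mul1r; apply: ler_pM => //; exact: powR_slope_bound.
  have prod (h : R * R -> R) : measurable_fun setT h -> (forall x, `|h x| <= M) ->
      mu.-integrable setT (EFin \o (fun x => h x * s x)).
    move=> mh hM; rewrite (_ : (fun x => h x * s x) = (fun x => \1_B x * (h x * powR_slope p (F x)))); last first.
      by apply/funext => x; rewrite /s mulrCA.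
    apply: (@integrable_box _ k%:R (M * (p * M `^ (p - 1)))); [|move=> x|exact: voff].
      apply: measurable_funM => //; apply: measurable_funM => //.
      by apply: measurableT_comp => //; exact: measurable_powR_slope.
    rewrite normrM -[leRHS]mul1r; apply: ler_pM => //.
    by rewrite normrM; apply: ler_pM => //; exact: powR_slope_bound.
  have qle n : \int[mu]_x q F x + (\int[mu]_x (f n x * s x) - \int[mu]_x (F x * s x)) <= b.
    have iF := prod F mF FM; have ifn := prod (f n) (mf n) (fM n).
    rewrite -RintegralB// -RintegralD//; [|exact: iq|]; last first.
      by have := integrableB measurableT ifn iF; apply: eq_integrable => // x _; rewrite /= EFinB.
    apply: (@le_trans _ _ (\int[mu]_x q (f n) x)).
      apply: le_Rintegral => //; [|exact: iq|].
        have iB : mu.-integrable setT (EFin \o (fun x => f n x * s x - F x * s x)).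
          by have := integrableB measurableT ifn iF; apply: eq_integrable => // x _; rewrite /= EFinB.
        by have := integrableD measurableT (iq F mF FM) iB; apply: eq_integrable.
      move=> x _; rewrite /q /s; have := powR_tangent (f n x) (F x) p1.
      move: (powR_slope _ _) (_ `^ _) (_ `^ _) => c u v.
      rewrite indicE; case: (x \in B) => /=; rewrite ?mul0r ?mul1r ?mulr0 ?subrr ?addr0 //.
      by rewrite mulrBr ![c * _]mulrC.
    rewrite -lee_fin; apply: le_trans (fB n).
    rewrite fineK; last by have /integrable_fin_num := iq (f n) (mf n) (fM n); exact.
    apply: ge0_le_integral => //.
    - by move=> x _; rewrite lee_fin mulr_ge0 ?powR_ge0// indicE.
    - by apply/measurable_EFinP; apply: measurable_funM => //; exact: mpow.
    - by apply/measurable_EFinP; exact: mpow.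
    - move=> x _; rewrite lee_fin /q indicE; case: (_ \in _); rewrite ?mul1r ?mul0r ?powR_ge0//.
  have : (\int[mu]_x q F x + (\int[mu]_x (f n x * s x) - \int[mu]_x (F x * s x))) @[n --> U] -->
     \int[mu]_x q F x + (\int[mu]_x (F x * s x) - \int[mu]_x (F x * s x)).
    apply: cvgD; first exact: cvg_cst.
    by apply: cvgB; [exact: fF|exact: cvg_cst].
  rewrite subrr addr0 => lim.
  have : \int[mu]_x q F x <= b by apply: (cvgr_to_le lim); exact: nearW.
  rewrite -lee_fin fineK; last by have /integrable_fin_num := iq F mF FM; exact.
  apply: le_trans; rewrite [leLHS]integral_mkcond.
  rewrite (_ : _ \_ _ = EFin \o q F); first exact: lexx.
  apply/funext => x.
  by rewrite patchE /= /q indicE -/B; case: (x \in B) => /=; rewrite ?mul1r ?mul0r.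
have nd : nondecreasing_seq (fun k : nat => box (k%:R : R)).
  move=> i j ij; apply/subsetPset => x; rewrite /box /= !in_itv /= => -[/andP[a b'] /andP[c d]].
  have ij' : i%:R <= j%:R :> R by rewrite ler_nat.
  split; apply/andP; split => //.
  - by rewrite (le_trans _ a)// lerN2.
  - exact: le_trans ij'.
  - by rewrite (le_trans _ c)// lerN2.
  - exact: le_trans ij'.
have := @ge0_nondecreasing_set_cvg_integral _ (measurableTypeR R * measurableTypeR R)%type R (fun k : nat => box (k%:R : R)) (fun x => (`|F x| `^ p)%:E) (leb2s R) nd.
have -> : \bigcup_k box (k%:R : R) = setT.
  apply/seteqP; split => // x _.
  have [k kx] : exists k : nat, `|x.1| + `|x.2| <= k%:R.
    exists (Num.truncn (`|x.1| + `|x.2|)).+1.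
    by have /andP[_ /ltW] := Num.Theory.truncn_itv (addr_ge0 (normr_ge0 x.1) (normr_ge0 x.2)).
  exists k => //; rewrite /box /= !in_itv /= -!ler_norml.
  by split; apply: le_trans kx; rewrite ?lerDl ?lerDr.
move=> /(_ _ _ _)/cvg_lim <-//.
- apply: lime_le; last by apply: nearW => k; exact: step.
  apply: ereal_nondecreasing_is_cvgn.
  apply: ge0_nondecreasing_set_nondecreasing_integral => //.
  + by move=> k; exact: measurable_box.
  + by move=> k; apply: measurable_funTS; apply/measurable_EFinP; exact: mpow.
- by move=> k; exact: measurable_box.
- by move=> k; apply: measurable_funTS; apply/measurable_EFinP; exact: mpow.
Qed.

Section KernelLimit.
Variables (U : set_system nat) (FU : ProperFilter U).
Variables (M N : R) (f : nat -> R * R -> R) (F : R * R -> R).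
Hypotheses (N0 : 0 <= N) (fbdd : forall n, bddL1 M N (f n)) (Fbdd : bddL1 M N F) (fF : wcvg U f F).

Section OneKernel.
Variables (B D L : R) (k : R * R -> R).
Hypotheses (B0 : 0 <= B) (D0 : 0 <= D) (L0 : 0 <= L) (mk : measurable_fun setT k).
Hypotheses (kB : forall z, `|k z| <= B) (kL : lip L k).
Hypothesis kD : forall r z, 1 <= r -> ~ box r z -> `|k z| <= D / r.

(** The kernel need not be integrable on the plane. Cut at the box of size r, its near part is an
    admissible test function, and its far part contributes at most D N / r <= eps / 4 to each of the
    two convolutions, which fixes r. *)
Lemma conv_wcvg x : convol k (f n) x @[n --> U] --> convol k F x.
Proof.
apply/cvgrPdist_le => eps eps0.
pose r := 1 + 4 * D * N / eps.
have r1 : 1 <= r by rewrite lerDl; do !(apply: mulr_ge0 => //); rewrite invr_ge0 ltW.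
have r0 : 0 < r := lt_le_trans ltr01 r1.
pose kr z := \1_(box r) z * k z.
pose kf z := k z - kr z.
have mi : measurable_fun setT (\1_(box r) : R * R -> R).
  by apply: measurable_indic; exact: measurable_box.
have mkr : measurable_fun setT kr by exact: measurable_funM.
have mkf : measurable_fun setT kf by exact: measurable_funB.
have krB z : `|kr z| <= B.
  by rewrite /kr indicE; case: (_ \in _); rewrite ?mul1r ?mul0r ?normr0.
have Dr : 0 <= D / r by rewrite divr_ge0// ltW.
have kfB z : `|kf z| <= D / r.
  rewrite /kf /kr indicE; case: (boolP (_ \in _)) => zb; first by rewrite mul1r subrr normr0.
  by rewrite mul0r subr0; apply: kD => // bz; move: zb; rewrite notin_setE.
have split th : bddL1 M N th -> convol k th x = convol kr th x + convol kf th x.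
  move=> bth.
  have [ir _] := conv_integrable_bounded x B0 mkr krB bth.
  have [i_f _] := conv_integrable_bounded x Dr mkf kfB bth.
  rewrite /convol -RintegralD//; congr (fine _); apply: eq_integral => y _.
  by rewrite -mulrDl /kf; congr ((_ * _)%:E); rewrite [RHS]addrC subrK.
have far th : bddL1 M N th -> `|convol kf th x| <= D / r * N.
  by move=> bth; have [] := conv_integrable_bounded x Dr mkf kfB bth.
have mkrx : measurable_fun setT (fun y : R * R => kr (x - y)).
  by apply: measurableT_comp => //; exact: measurable_subl.
have ikr : mu.-integrable setT (EFin \o (fun y : R * R => kr (x - y))).
  apply: (@integrable_box _ (r + `|x.1| + `|x.2|) B) => // y nb.
  rewrite /kr indicE memNset ?mul0r// => xy; apply: nb; move: xy.
  rewrite /box /= !in_itv /= -!ler_norml => -[a b].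
  have t1 : y.1 = x.1 - (x.1 - y.1) by rewrite opprB addrC subrK.
  have t2 : y.2 = x.2 - (x.2 - y.2) by rewrite opprB addrC subrK.
  have := ler_normB x.1 (x.1 - y.1); rewrite -t1.
  have := ler_normB x.2 (x.2 - y.2); rewrite -t2.
  have := normr_ge0 x.1; have := normr_ge0 x.2.
  move: `|x.1| `|x.2| `|y.1| `|y.2| `|x.1 - y.1| `|x.2 - y.2| a b => a1 a2 a3 a4 a5 a6.
  by move=> *; split; lra.
have lim := fF ikr.
have eps2 : 0 < eps / 2 by rewrite divr_gt0.
move/cvgrPdist_le : lim => /(_ _ eps2).
apply: filterS => n.
have E th : \int[mu]_y (th y * kr (x - y)) = convol kr th x.
  by congr (fine _); apply: eq_integral => y _; rewrite mulrC.
rewrite !E (split _ Fbdd) (split _ (fbdd n)).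
have := far _ Fbdd; have := far _ (fbdd n).
have small : D / r * N <= eps / 4.
  rewrite mulrAC ler_pdivrMr// /r mulrDr mulr1 mulrA.
  have -> : eps / 4 * (4 * D * N) / eps = D * N by field; rewrite gt_eqF.
  by rewrite lerDr divr_ge0// ltW.
move: small; move: (convol kr F x) (convol kf F x) (convol kr (f n) x) (convol kf (f n) x) => a b c d'.
move: (D / r * N) => q small h1 h2 h3.
have -> : a + b - (c + d') = (a - c) + (b - d') by ring.
apply: le_trans (ler_normD _ _) _; have := ler_normB b d'.
by move: `|a - c| `|b - d'| `|b| `|d'| h1 h2 h3 small eps0 => *; lra.
Qed.

(** Pointwise convergence becomes uniform on a compact set because all the convolutions share the
    Lipschitz constant [L * N]. *)
Lemma conv_wcvg_unif (K : set (R * R)) eps : compact K -> 0 < eps ->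
  \forall n \near U, forall x, K x -> `|convol k F x - convol k (f n) x| <= eps.
Proof.
move=> cK eps0.
have l2 th : bddL1 M N th -> forall x x' : R * R,
    `|convol k th x' - convol k th x| <= L * N * (`|x'.1 - x.1| + `|x'.2 - x.2|).
  move=> bth x x'; have lc := conv_lip B0 L0 mk kB kL bth.
  set y : R * R := x + (x'.1 - x.1) *: ((1 : R), (0 : R)).
  have [h1 _] := lc x (x'.1 - x.1); have [_ h2] := lc y (x'.2 - x.2).
  have -> : convol k th x' = convol k th (y + (x'.2 - x.2) *: ((0 : R), (1 : R))).
    congr (convol k th _); rewrite /y [LHS]surjective_pairing [x in x + _]surjective_pairing; congr (_, _) => /=.
      by rewrite /GRing.scale /= ; ring.
    by rewrite /GRing.scale /=; ring.
  rewrite -(subrKA (convol k th y)).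
  rewrite mulrDr (le_trans (ler_normD _ _))// addrC; apply: lerD; [exact: h1|exact: h2].
have LN : 0 <= L * N by rewrite mulr_ge0.
(* A point of the sup-norm ball is reached by two axis moves of length at most [dl], so each
   convolution varies by at most eps / 3. *)
pose dl := eps / (6 * (L * N + 1)).
have dl0 : 0 < dl by rewrite divr_gt0// mulr_gt0// ltr_wpDl.
have dl1 : L * N * (dl + dl) <= eps / 3.
  have -> : eps / 3 = (L * N + 1) * (dl + dl) by rewrite /dl; field; rewrite gt_eqF// ltr_wpDl.
  by rewrite ler_wpM2r ?lerDl// addr_ge0// ltW.
have /compact_near_coveringP/(_ nat U (fun n x => `|convol k F x - convol k (f n) x| <= eps)) H := cK.
have : \forall n \near U, K `<=` (fun x => `|convol k F x - convol k (f n) x| <= eps).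
  apply: H => z Kz.
  have eps3 : 0 < eps / 3 by rewrite divr_gt0.
  have near_n : \forall n \near U, `|convol k F z - convol k (f n) z| <= eps / 3.
    by have /cvgrPdist_le := @conv_wcvg z; exact.
  exists ([set x' : R * R | ball z dl x'], [set n | `|convol k F z - convol k (f n) z| <= eps / 3]).
    by split => //; exact: nbhsx_ballx.
  move=> [x' n] /= [[bx1 bx2] hn].
  have hF := l2 _ Fbdd z x'; have hf := l2 _ (fbdd n) z x'.
  have x1 : `|x'.1 - z.1| + `|x'.2 - z.2| <= dl + dl.
    by apply: lerD; rewrite distrC ltW.
  have hx := ler_wpM2l LN x1.
  move: hF hf hx hn; move: (convol k F z) (convol k F x') (convol k (f n) z) (convol k (f n) x') => a a' b b'.
  move: (L * N * _) (L * N * _) dl1 => q q' dl1 h1 h2 h3 h4.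
  have -> : a' - b' = (a' - a) + (a - b) + - (b' - b) by ring.
  apply: le_trans (ler_normD _ _) _; rewrite normrN.
  have := ler_normD (a' - a) (a - b).
  by move: `|a' - a + (a - b)| `|a' - a| `|a - b| `|b' - b| h1 h2 h3 h4 dl1 => *; lra.
by apply: filterS => n h x /h.
Qed.

End OneKernel.
End KernelLimit.

End WeakConvergence.

Section FluxLimit.
Variable R : realType.
Variable m : R.
Hypotheses (m1 : 1 < m) (m2 : m < 2).
Local Notation mu := (@leb2 R).
Variables (M N : R).
Hypotheses (M0 : 0 <= M) (N0 : 0 <= N).
Local Notation dn := (@dn R).
Local Notation eta := (eta m M N).

Lemma eta_le (d e : R) : 0 <= d -> d <= e -> eta d <= eta e.
Proof.
move=> d0 de; rewrite /eta ler_wpM2r//.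
  by rewrite addr_ge0// mulr_ge0// ppow_mass_ge0.
rewrite ler_wpM2l//; first by rewrite mulr_ge0// ltW// kC_gt0.
have k0 : 0 <= kap m by have ? := m1; rewrite /kap; lra.
by apply: ge0_ler_powR => //; rewrite nnegrE// (le_trans d0).
Qed.

Lemma eta_small (r : R) : 0 < r -> exists2 e, 0 < e & eta e <= r.
Proof.
move=> r0; pose c := 2 * kC m * (ppow_mass (ka1 m) * M + N).
have c0 : 0 <= c.
  apply: mulr_ge0; first by rewrite mulr_ge0// ltW// kC_gt0.
  by rewrite addr_ge0// mulr_ge0// ppow_mass_ge0.
have q0 : 0 < r / (c + 1) by rewrite divr_gt0// ltr_wpDl.
have k0 : 0 < kap m by have ? := m1; rewrite /kap; lra.
exists ((r / (c + 1)) `^ (kap m)^-1); first by rewrite powR_gt0.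
have -> : eta ((r / (c + 1)) `^ (kap m)^-1) = c * (r / (c + 1)).
  by rewrite /eta -powRrM mulVf ?gt_eqF// powRr1 ?(ltW q0)// mulrAC.
rewrite mulrA ler_pdivrMr ?ltr_wpDl// mulrC ler_wpM2l ?(ltW r0)//.
by rewrite lerDl.
Qed.

Variables (U : set_system nat) (FU : ProperFilter U).
Variables (f : nat -> R * R -> R) (F : R * R -> R).
Hypotheses (fbdd : forall n, bddL1 M N (f n)) (Fbdd : bddL1 M N F) (fF : wcvg U f F).
Variables (C L : R) (g g1 g2 : R * R -> R) (K : set (R * R)).
Hypotheses (C0 : 0 <= C) (gdata : test_data C L g g1 g2).
Hypotheses (cK : compact K) (v1 : vanishes_off K g1) (v2 : vanishes_off K g2).

(** A weak limit times a strong one: with the field frozen at F, weak convergence applies because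
    the compact support makes the test function integrable; the change of field is uniformly small
    on that support. *)
Lemma Fe_wcvg e : 0 < e -> Fe m e (f n) g1 g2 @[n --> U] --> Fe m e F g1 g2.
Proof.
move=> e0; apply/cvgrPdist_le => eps eps0.
have CN : 0 <= C * N by rewrite mulr_ge0.
pose ep := eps / (4 * (C * N + 1)).
have ep0 : 0 < ep by rewrite divr_gt0// mulr_gt0// ltr_wpDl.
have epC : 2 * ep * C * N <= eps / 2.
  have -> : eps / 2 = 2 * ep * (C * N + 1) by rewrite /ep; field; rewrite gt_eqF// ltr_wpDl.
  have -> : 2 * ep * C * N = 2 * ep * (C * N) by rewrite -!mulrA.
  by rewrite ler_wpM2l ?lerDl// mulr_ge0// ltW.
have kC0 := ltW (kC_gt0 m).
have nz := conv_wcvg_unif FU N0 fbdd Fbdd fF (kB_ge0 m e) kC0 (kL_ge0 m e) _ _ _ _ cK ep0.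
have n1 := nz _ (measurable_K1 m e) (fun z => K1_bound m1 m2 z e0) (lip_K1 m1 m2 e0)
  (fun r z => @K1_decay R m m1 m2 e r z).
have n2 := nz _ (measurable_K2 m e) (fun z => K2_bound m1 m2 z e0) (lip_K2 m1 m2 e0)
  (fun r z => @K2_decay R m m1 m2 e r z).
pose V1 th := convol (K1 m e) th; pose V2 th := convol (K2 m e) th.
pose G th x := V1 th x * g1 x + V2 th x * g2 x.
have mG th : bddL1 M N th -> measurable_fun setT (G th).
  move=> [mth _ _]; apply: measurable_funD; apply: measurable_funM.
  - by apply: measurable_conv => //; exact: measurable_K1.
  - exact: td_m1 gdata.
  - by apply: measurable_conv => //; exact: measurable_K2.
  - exact: td_m2 gdata.
have Vm0 : 0 <= Vmax m M N by exact: ltW (Vmax_gt0 _ M0 N0).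
have bG th x : bddL1 M N th -> `|G th x| <= 2 * Vmax m M N * C.
  move=> bth; rewrite /G (le_trans (ler_normD _ _))//.
  have -> : 2 * Vmax m M N * C = Vmax m M N * C + Vmax m M N * C by ring.
  apply: lerD; rewrite normrM; apply: ler_pM => //.
  - exact: convol_K1_bound.
  - exact: td_b1 gdata x.
  - exact: convol_K2_bound.
  - exact: td_b2 gdata x.
have VC0 : 0 <= 2 * Vmax m M N * C by rewrite !mulr_ge0.
have [r _ Kr] := compact_subset_box cK.
have iG : mu.-integrable setT (EFin \o G F).
  apply: (@integrable_box _ r (2 * Vmax m M N * C)); [exact: mG|by move=> x; exact: bG|].
  move=> x nb; have nK : ~ K x by move=> /Kr.
  by rewrite /G v1// v2// !mulr0 addr0.
have eps2 : 0 < eps / 2 by rewrite divr_gt0.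
have n3 : \forall n \near U, `|\int[mu]_x (F x * G F x) - \int[mu]_x (f n x * G F x)| <= eps / 2.
  by have /cvgrPdist_le/(_ _ eps2) := fF iG; exact.
near=> n.
rewrite /Fe /gflux -/(V1 F) -/(V2 F) -/(V1 (f n)) -/(V2 (f n)) -/(G F) -/(G (f n)).
rewrite -(subrKA (\int[mu]_x (f n x * G F x))).
apply: le_trans (ler_normD _ _) _.
have -> : eps = eps / 2 + eps / 2 by field.
apply: lerD; first by near: n.
have [i1 _] := bddL1_mul (fbdd n) (mG _ Fbdd) VC0 (fun x => bG _ x Fbdd).
have [i2 _] := bddL1_mul (fbdd n) (mG _ (fbdd n)) VC0 (fun x => bG _ x (fbdd n)).
have b1 : forall x, K x -> `|V1 F x - V1 (f n) x| <= ep by near: n.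
have b2 : forall x, K x -> `|V2 F x - V2 (f n) x| <= ep by near: n.
rewrite -RintegralB//.
have -> : \int[mu]_x (f n x * G F x - f n x * G (f n) x) = \int[mu]_x (f n x * (G F x - G (f n) x)).
  by congr (fine _); apply: eq_integral => x _; rewrite mulrBr.
apply: le_trans epC.
have mGG : measurable_fun setT (fun x => G F x - G (f n) x) by apply: measurable_funB; exact: mG.
have c0 : 0 <= 2 * ep * C.
  by apply: mulr_ge0; last exact: C0; apply: mulr_ge0; [exact: ler0n|exact: ltW].
have bb x : `|G F x - G (f n) x| <= 2 * ep * C.
  have [Kx|nK] := pselect (K x); last by rewrite /G v1// v2// !mulr0 addr0 subrr normr0.
  have -> : G F x - G (f n) x = (V1 F x - V1 (f n) x) * g1 x + (V2 F x - V2 (f n) x) * g2 x.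
    by rewrite /G; move: (V1 _ _) (V1 _ _) (V2 _ _) (V2 _ _) => *; ring.
  have -> : 2 * ep * C = ep * C + ep * C by ring.
  apply: le_trans (ler_normD _ _) _; rewrite !normrM.
  by apply: lerD; apply: ler_pM => //; [exact: b1|exact: td_b1 gdata x|exact: b2|exact: td_b2 gdata x].
by have [] := bddL1_mul (fbdd n) mGG c0 bb.
Unshelve. all: end_near. Qed.

End FluxLimit.

Lemma ler_dist4 (R : numDomainType) (a b c d x : R) :
  `|a - x| <= `|a - b| + `|b - c| + `|c - d| + `|d - x|.
Proof.
rewrite (le_trans (ler_distD d _ _))// lerD2r (le_trans (ler_distD c _ _))// lerD2r.
exact: ler_distD.
Qed.

(** * Increments of the limit in time *)

Section Limit.
Variable R : realType.
Variable m : R.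
Hypotheses (m1 : 1 < m) (m2 : m < 2).
Local Notation mu := (@leb2 R).
Variables (M N : R).
Hypotheses (M0 : 0 <= M) (N0 : 0 <= N).
Local Notation bdd := (bddL1 M N).
Local Notation dn := (@dn R).
Local Notation eta := (eta m M N).
Local Notation hn := (hn m N).
Local Notation tau := (tau m M N).
Variables (U : set_system nat) (UU : UltraFilter U).
Hypothesis ooU : \oo `<=` U.
Variable th0 : R * R -> R.
Hypothesis bth0 : bdd th0.

Let PU : ProperFilter U := @ultra_proper _ _ UU.

Definition kstep n (t : R) : nat := Num.truncn (t / tau n).
Definition thn n t := scheme m M N th0 n (kstep n t).

Lemma thn_bdd n t : bdd (thn n t).
Proof. exact: scheme_bdd. Qed.

Lemma thn0 n : thn n 0 = th0.
Proof. by rewrite /thn /kstep mul0r truncn0. Qed.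

(** The limit at each t is chosen separately, with the same U. Its L^1 bound does not come with the
    weak-star limit and is lower semicontinuity for p = 1. *)
Lemma scheme_limit : exists theta : R -> R * R -> R,
  forall t, bdd (theta t) /\ wcvg U (thn^~ t) (theta t).
Proof.
suff H t : exists F, bdd F /\ wcvg U (thn^~ t) F.
  by exists (fun t => projT1 (cid (H t))) => t; exact: projT2 (cid (H t)).
have mf n : measurable_fun setT (thn n t) by have [] := thn_bdd n t.
have bf n x : `|thn n t x| <= M by have [_] := thn_bdd n t.
have [F [mF FM FF]] := @weak_limit R U UU _ _ (leb2s R) _ M (thn^~ t) (@gweight_gt0 R)
  (@integrable_gweight R) M0 mf bf.
exists F; split => //; split => //.
have -> : (\int[mu]_x `|F x|%:E = \int[mu]_x (`|F x| `^ 1)%:E)%E.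
  by apply: eq_integral => x _; rewrite powRr1.
apply: (weak_lsc PU FF mf mF bf FM (lexx 1)) => n.
under eq_integral do rewrite powRr1//.
by have [] := thn_bdd n t.
Qed.

Lemma hn_cvg0 : hn n @[n --> U] --> (0 : R).
Proof.
suff : hn n @[n --> \oo] --> (0 : R) by apply: cvg_trans => A; exact: ooU.
apply: (@squeeze_cvgr _ _ _ _ (fun=> 0) dn); last 2 first.
- exact: cvg_cst.
- exact: cvg_harmonic.
by apply: nearW => n; rewrite hn_le ?(ltW (hn_gt0 _ N0 _)).
Qed.

Lemma tau_cvg0 : tau n @[n --> U] --> (0 : R).
Proof.
have V0 : 0 < Vmax m M N by exact: Vmax_gt0.
have -> : tau = (fun n => (2 * Vmax m M N)^-1 * hn n).
  by apply/funext => n; rewrite (hn_tau m M0 N0) mulKf// gt_eqF// mulr_gt0.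
by rewrite -[0](mulr0 (2 * Vmax m M N)^-1); apply: cvgMr; exact: hn_cvg0.
Qed.

Lemma kstep_tau n t : 0 <= t -> (kstep n t)%:R * tau n <= t < (kstep n t)%:R * tau n + tau n.
Proof.
move=> t0; have tn := tau_gt0 m M0 N0 n.
have /andP[a b] := Num.Theory.truncn_itv (divr_ge0 t0 (ltW tn)).
rewrite -ler_pdivlMr// a /= -[X in _ + X]mul1r -mulrDl -ltr_pdivrMr//.
by rewrite natr1.
Qed.

Lemma kstep_cvg t : 0 <= t -> (kstep n t)%:R * tau n @[n --> U] --> t.
Proof.
move=> t0; apply/cvgrPdist_le => eps eps0.
have /cvgrPdist_le/(_ _ eps0) := tau_cvg0.
apply: filterS => n; rewrite sub0r normrN ger0_norm ?(ltW (tau_gt0 m M0 N0 n))// => h.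
have /andP[a b] := kstep_tau n t0.
by rewrite ger0_norm ?subr_ge0//; apply: le_trans h; rewrite lerBlDl ltW.
Qed.

Lemma kstep_le n s t : s <= t -> (kstep n s <= kstep n t)%N.
Proof. by move=> st; apply: le_truncn; rewrite ler_pM2r// invr_gt0 tau_gt0. Qed.

Variable theta : R -> R * R -> R.
Hypotheses (bth : forall t, bdd (theta t)) (wth : forall t, wcvg U (thn^~ t) (theta t)).
Variables (C L : R) (g g1 g2 : R * R -> R) (K : set (R * R)).
Hypotheses (C0 : 0 <= C) (L0 : 0 <= L) (gdata : test_data C L g g1 g2) (cK : compact K).
Hypotheses (v0 : vanishes_off K g) (v1 : vanishes_off K g1) (v2 : vanishes_off K g2).

Local Notation F t := (F0 m (theta t) g1 g2).
Local Notation A t := (\int[mu]_x (theta t x * g x)).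

(** The order of choices matters: e makes both regularization errors small, then [dl] is fixed in
    terms of [Alip e], and only then is n taken far along U. The chain runs from [flux_n] to [Fe e]
    of the scheme, to [Fe e] at time r, to [Fe e] of the limit, to [F r]. *)
Lemma flux_modulus eps : 0 < eps -> exists2 dl, 0 < dl & forall s t r,
  0 <= s -> s <= t -> t - s <= dl -> r = s \/ r = t ->
  \forall n \near U, forall i, (i < kstep n t - kstep n s)%N ->
    `|flux_n m N n (scheme m M N th0 n (kstep n s + i)) g1 g2 - F r| <= eps.
Proof.
move=> eps0.
have e84 : eps / 8 <= eps / 4 by lra.
have e210 : 2 * (eps / 32) <= 10 * (eps / 32) by lra.
have CN : 0 <= C * N by rewrite mulr_ge0.
(* Each elementary velocity error is kept below q: [flux_n_close] then costs 6 and [F0_close] 2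
   units of eps / 32. *)
pose q := eps / (32 * (C * N + 1)).
have q0 : 0 < q by rewrite divr_gt0// mulr_gt0// ltr_wpDl.
have qC : q * (C * N) <= eps / 32.
  have -> : eps / 32 = q * (C * N + 1) by rewrite /q; field; rewrite gt_eqF// ltr_wpDl.
  by rewrite ler_wpM2l ?(ltW q0)// lerDl.
have [e e0 eq_] := eta_small m1 M0 N0 q0.
(* Since [hn n = 2 * Vmax * tau n], this is the Lipschitz constant of [Fe e] in time, the same for
   all n. *)
pose a := Alip m N C L e * (2 * Vmax m M N).
have V0 : 0 < Vmax m M N by exact: Vmax_gt0.
have a0 : 0 <= a by rewrite mulr_ge0 ?Alip_ge0// mulr_ge0// ltW.
have a10 : 0 < a + 1 by rewrite ltr_wpDl.
pose dl := eps / (8 * (a + 1)).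
have dl0 : 0 < dl by rewrite divr_gt0// mulr_gt0.
have adl : a * dl <= eps / 8.
  have -> : eps / 8 = (a + 1) * dl by rewrite /dl; field; rewrite gt_eqF.
  by rewrite ler_wpM2r ?(ltW dl0)// lerDl.
exists dl => // s t r s0 st tsdl rst.
have eps8 : 0 < eps / 8 by rewrite divr_gt0.
have n1 : \forall n \near U, `|Fe m e (theta r) g1 g2 - Fe m e (thn n r) g1 g2| <= eps / 8.
  have := @Fe_wcvg R m m1 m2 M N M0 N0 U PU (thn^~ r) (theta r) (thn_bdd^~ r) (bth r) (@wth r) C L
    g g1 g2 K C0 gdata cK v1 v2 e e0.
  by move=> /cvgrPdist_le/(_ _ eps8); exact.
have n2 : \forall n \near U, tau n <= dl.
  have /cvgrPdist_le/(_ _ dl0) := tau_cvg0.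
  by apply: filterS => n; rewrite sub0r normrN; apply: le_trans; exact: ler_norm.
have ndn (d : R) : 0 < d -> \forall n \near U, dn n <= d.
  move=> d0; apply: ooU; have := near_infty_natSinv_lt (PosNum d0).
  by apply: filterS => n /ltW.
have n3 := ndn _ e0; have n4 := ndn _ q0.
near=> n => i ij.
have h1 : `|Fe m e (theta r) g1 g2 - Fe m e (thn n r) g1 g2| <= eps / 8 by near: n.
have h2 : tau n <= dl by near: n.
have h3 : dn n <= e by near: n.
have h4 : dn n <= q by near: n.
have h5 : eta (dn n) <= q by rewrite (le_trans (eta_le m1 M0 N0 (ltW (dn_gt0 _ _)) h3)).
have c1 := F0_close m1 m2 M0 N0 C0 gdata e0 (bth r).
have c2 := flux_n_close m1 m2 M0 N0 C0 gdata n e0 (scheme_bdd m1 m2 M0 N0 n (kstep n s + i) bth0).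
(* Rounding s and t down to multiples of [tau n] may lengthen the interval by one step, itself at
   most [dl]. *)
have j1 : (kstep n t - kstep n s)%:R * tau n <= dl + dl.
  rewrite natrB ?kstep_le// mulrBl.
  have /andP[_ b1] := kstep_tau n s0.
  have /andP[b2 _] := kstep_tau n (le_trans s0 st).
  apply: (@le_trans _ _ ((t - s) + tau n)); last exact: lerD.
  rewrite lerBlDr; apply: le_trans b2 _.
  by rewrite -addrA -lerBlDl subKr addrC ltW.
have c3 : `|Fe m e (scheme m M N th0 n (kstep n s + i)) g1 g2 - Fe m e (thn n r) g1 g2| <= eps / 4.
  have key (u w : nat) : (w <= kstep n t - kstep n s)%N ->
      `|Fe m e (scheme m M N th0 n (u + w)) g1 g2 - Fe m e (scheme m M N th0 n u) g1 g2| <= eps / 4.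
    move=> wj; apply: le_trans (Fe_scheme m1 m2 M0 N0 C0 L0 gdata bth0 n u w e0) _.
    have -> : Alip m N C L e * hn n * w%:R = a * (w%:R * tau n).
      by rewrite (hn_tau m M0 N0) /a [w%:R * _]mulrC !mulrA.
    have -> : eps / 4 = eps / 8 + eps / 8 by field.
    apply: (@le_trans _ _ (a * (dl + dl))); last by rewrite mulrDr lerD.
    rewrite ler_wpM2l// (le_trans _ j1)// ler_wpM2r ?(ltW (tau_gt0 m M0 N0 n))//.
    by rewrite ler_nat.
  case: rst => ->; rewrite /thn; first by apply: key; exact: ltnW.
  have -> : kstep n t = (kstep n s + i + (kstep n t - kstep n s - i))%N.
    by rewrite -addnA subnKC ?subnKC// ?kstep_le// ltnW.
  by rewrite distrC; apply: key; exact: leq_subr.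
have B1 : 2 * eta e * C * N <= 2 * (eps / 32).
  have -> : 2 * eta e * C * N = 2 * (eta e * (C * N)) by rewrite -!mulrA.
  by rewrite ler_wpM2l// (le_trans _ qC)// ler_wpM2r.
have B2 : 2 * (dn n + eta (dn n) + eta e) * C * N <= 6 * (eps / 32).
  have -> : 2 * (dn n + eta (dn n) + eta e) * C * N = 2 * ((dn n + eta (dn n) + eta e) * (C * N)) by rewrite -!mulrA.
  have -> : 6 * (eps / 32) = 2 * (3 * (eps / 32)) by field.
  rewrite ler_wpM2l//.
  apply: (@le_trans _ _ ((3 * q) * (C * N))); last by rewrite -mulrA ler_wpM2l.
  rewrite ler_wpM2r//.
  have -> : 3 * q = q + q + q by rewrite mulr_natl -[q *+ 3]/(q + (q + q)) addrA.
  by apply: lerD => //; exact: lerD.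
have D1 := le_trans c1 B1; have D2 := le_trans c2 B2.
have -> : eps = 6 * (eps / 32) + eps / 4 + eps / 4 + 10 * (eps / 32) by field.
apply: le_trans (ler_dist4 _ (Fe m e (scheme m M N th0 n (kstep n s + i)) g1 g2)
  (Fe m e (thn n r) g1 g2) (Fe m e (theta r) g1 g2) _) _.
apply: lerD; last by rewrite distrC; exact: le_trans D1 e210.
apply: lerD; last by rewrite distrC; exact: le_trans h1 e84.
by apply: lerD; [exact: D2|exact: c3].
Unshelve. all: end_near. Qed.

(** Per unit of time the Taylor error is [L * hn^2 * N / tau = 2 * Vmax * L * hn * N], which tends
    to 0; only the flux oscillation eps remains. *)
Lemma increment_limit eps : 0 < eps -> exists2 dl, 0 < dl & forall s t r,
  0 <= s -> s <= t -> t - s <= dl -> r = s \/ r = t ->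
  `|A t - A s - (t - s) * F r| <= (t - s) * eps.
Proof.
move=> eps0; have [dl dl0 H] := flux_modulus eps0; exists dl => // s t r s0 st tsdl rst.
have near_n := H s t r s0 st tsdl rst.
pose j n := (kstep n t - kstep n s)%N.
have jcvg : (j n)%:R * tau n @[n --> U] --> t - s.
  have -> : (fun n => (j n)%:R * tau n) =
      (fun n => (kstep n t)%:R * tau n - (kstep n s)%:R * tau n).
    by apply/funext => n; rewrite natrB ?kstep_le// mulrBl.
  by apply: cvgB; apply: kstep_cvg => //; exact: le_trans st.
have [r0 _ Kr] := compact_subset_box cK.
have ig : mu.-integrable setT (EFin \o g).
  apply: (@integrable_box _ r0 C); [exact: td_m gdata|exact: td_b gdata|].
  by move=> x nb; apply: v0 => /Kr.
have Acvg u : \int[mu]_x (thn n u x * g x) @[n --> U] --> A u by exact: wth.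
pose X n := \int[mu]_x (thn n t x * g x) - \int[mu]_x (thn n s x * g x) - (j n)%:R * tau n * F r.
have Xcvg : X n @[n --> U] --> A t - A s - (t - s) * F r.
  by apply: cvgB; [exact: cvgB|apply: cvgMl].
pose Y n := (j n)%:R * tau n * (eps + L * (2 * Vmax m M N) * hn n * N).
have Ycvg : Y n @[n --> U] --> (t - s) * (eps + L * (2 * Vmax m M N) * 0 * N).
  apply: cvgM => //; apply: cvgD; first exact: cvg_cst.
  by apply: cvgMl; apply: cvgMr; exact: hn_cvg0.
have XY : \forall n \near U, `|X n| <= Y n.
  apply: filterS near_n => n jn.
  have := scheme_increment m1 m2 M0 N0 C0 L0 gdata bth0 jn.
  rewrite subnKC ?kstep_le// => h; apply: le_trans h _.
  have alg (a b c d v w : R) : w = 2 * v * b ->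
      a * (b * c + d * w ^+ 2 * N) = a * b * (c + d * (2 * v) * w * N) by move=> ->; ring.
  by rewrite (alg _ _ _ _ _ _ (hn_tau m M0 N0 n)).
have := ler_cvg_to (cvg_norm Xcvg) Ycvg XY.
by rewrite mulr0 mul0r addr0; apply.
Qed.

End Limit.

(** * The weak formulation and the norm bounds *)

Section Calculus.
Variable R : realType.
Variables (A F : R -> R).
Hypothesis incr : forall eps, 0 < eps -> exists2 dl, 0 < dl & forall x y,
  0 <= x -> 0 <= y -> `|y - x| <= dl -> `|A y - A x - (y - x) * F x| <= `|y - x| * eps.

Let locally_close (h : R -> R) := forall x eps, 0 <= x -> 0 < eps ->
  exists2 dl, 0 < dl & forall y, 0 <= y -> `|y - x| <= dl -> `|h y - h x| <= eps.

Let close_continuous h (T : R) : locally_close h -> {within `[0, T], continuous h}.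
Proof.
move=> hc; apply/subspace_continuousP => x /= /[!in_itv]/= /andP[x0 xT].
apply/cvgrPdist_le => eps eps0; have [dl dl0 H] := hc x eps x0 eps0.
rewrite near_withinE; have : \forall y \near x, `|x - y| < dl by exact: nbhsx_ballx.
apply: filterS => y xy; rewrite /= in_itv /= => /andP[y0 _].
by rewrite distrC; apply: H => //; rewrite distrC ltW.
Qed.

(** Adding the expansion of A from x to y and the one from y to x cancels A and leaves (y - x)(F y -
    F x). *)
Let F_close : locally_close F.
Proof.
move=> x eps x0 eps0; have [dl dl0 H] := incr (divr_gt0 eps0 (ltr0n R 2)).
exists dl => // y y0 xy.
have [->|yx] := eqVneq y x; first by rewrite subrr normr0 ltW.
have yx0 : 0 < `|y - x| by rewrite normr_gt0 subr_eq0.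
have h1 := H x y x0 y0 xy; have := H y x y0 x0; rewrite distrC => /(_ xy) h2.
rewrite -(ler_pM2l yx0) -normrM.
have -> : (y - x) * (F y - F x) = (A y - A x - (y - x) * F x) + (A x - A y - (x - y) * F y) by ring.
rewrite (le_trans (ler_normD _ _))// (le_trans (lerD h1 h2))// -mulrDr.
by have -> : eps / 2 + eps / 2 = eps by field.
Qed.

Let A_close : locally_close A.
Proof.
move=> x eps x0 eps0; have [dl dl0 H] := incr ltr01.
have q0 : 0 < eps / (1 + `|F x|) by rewrite divr_gt0// ltr_wpDr.
exists (Num.min dl (eps / (1 + `|F x|))); first by rewrite lt_min dl0.
move=> y y0; rewrite le_min => /andP[xy1 xy2].
have -> : A y - A x = (A y - A x - (y - x) * F x) + (y - x) * F x by rewrite subrK.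
rewrite (le_trans (ler_normD _ _))// normrM.
apply: (@le_trans _ _ (`|y - x| * (1 + `|F x|))); first by rewrite mulrDr lerD// H.
by rewrite -ler_pdivlMr// ltr_wpDr.
Qed.

Let A_derive (x : R) : 0 < x -> is_derive x 1 A (F x).
Proof.
move=> x0.
suff lim : h^-1 *: (A (h *: 1 + x) - A x) @[h --> 0^'] --> F x.
  by split; [exact: cvgP lim|exact: cvg_lim lim].
apply/cvgrPdist_le => eps eps0; have [dl dl0 H] := incr eps0.
near=> h.
have h0 : h != 0 by near: h; exact: nbhs_dnbhs_neq.
have hdl : `|h| <= dl by near: h; apply: dnbhs0_le.
(* Keeps x + h nonnegative, where [incr] speaks. *)
have hx : `|h| <= x by near: h; apply: dnbhs0_le.
have xh0 : 0 <= h *: 1 + x.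
  by rewrite /GRing.scale /= mulr1 -lerBlDr sub0r; move: hx; rewrite ler_norml => /andP[].
have := H x (h *: 1 + x) (ltW x0) xh0; rewrite addrK {1 3 4}/GRing.scale /= mulr1 => /(_ hdl) hh.
have -> : F x - h^-1 *: (A (h *: 1 + x) - A x) = - (h^-1 * (A (h *: 1 + x) - A x - h * F x)).
  by rewrite /GRing.scale /= [h^-1 * (_ - _ - _)]mulrBr mulKf// opprB.
rewrite normrN normrM normfV mulrC ler_pdivrMr ?normr_gt0// [leRHS]mulrC. exact: hh.
Unshelve. all: end_near. Qed.

Lemma integral_of_increment (T : R) : 0 < T ->
  (@leb1 R).-integrable `[0, T] (EFin \o F) /\ \int[@leb1 R]_(s in `[0, T]) F s = A T - A 0.
Proof.
move=> T0.
have cF := @close_continuous F T F_close; have cA := @close_continuous A T A_close.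
have iF : (@leb1 R).-integrable `[0, T] (EFin \o F).
  by apply: continuous_compact_integrable => //; exact: segment_compact.
split => //.
have [_ r0 lT] : [/\ {in `]0, T[, continuous A}, A x @[x --> 0^'+] --> A 0 & A x @[x --> T^'-] --> A T].
  exact/(continuous_within_itvP _ T0).
have dA : derivable_oo_LRcontinuous A 0 T.
  by split => // x /[!in_itv]/= /andP[x0 _]; have [] := A_derive x0.
have AF : {in `]0, T[, derive1 A =1 F}.
  by move=> x /[!in_itv]/= /andP[x0 _]; rewrite derive1E; have [_ ->] := A_derive x0.
by have := continuous_FTC2 T0 cF dA AF; rewrite /Rintegral => ->.
Qed.

End Calculus.

(** * Norms and bounded representatives *)

Section LnormFacts.
Context d (T : measurableType d) (R : realType) (mu : {measure set T -> \bar R}).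
Implicit Types f g : T -> R.
Local Open Scope ereal_scope.

Lemma le_Lnorm_powR f g (r : R) : (1 <= r)%R ->
  \int[mu]_x (`|f x| `^ r)%:E <= \int[mu]_x (`|g x| `^ r)%:E ->
  Lnorm mu r%:E (EFin \o f) <= Lnorm mu r%:E (EFin \o g).
Proof.
move=> r1 fg; have r0 : (0 <= r)%R := le_trans ler01 r1.
rewrite unlock; apply: gt0_ler_poweR; rewrite ?invr_ge0//.
- by rewrite in_itv /= leey andbT integral_ge0// => x _; rewrite poweR_ge0.
- by rewrite in_itv /= leey andbT integral_ge0// => x _; rewrite poweR_ge0.
Qed.

Lemma Lnormy_ae_le f : Lnorm mu +oo (EFin \o f) < +oo ->
  \forall x \ae mu, (`|f x| <= fine (Lnorm mu +oo (EFin \o f)))%R.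
Proof.
move=> fy; have ffin : Lnorm mu +oo (EFin \o f) \is a fin_num by rewrite ge0_fin_numE ?Lnorm_ge0.
have : \forall x \ae mu, `|f x|%:E <= Lnorm mu +oo (EFin \o f); last first.
  by apply: filterS => x h; rewrite -lee_fin fineK.
(* On a space of measure 0 the sup norm is 0 by convention, and the bound then holds because the
   whole space is negligible. *)
rewrite unlock; case: ifPn => [_|mu0]; first exact: ess_sup_ge.
have {}mu0 : mu setT = 0. apply/eqP; move: mu0; rewrite -leNgt => h; rewrite eq_le h; by rewrite measure_ge0.
exists setT; split => //.
Qed.

Lemma Lnormy_le f (M : R) : (0 <= M)%R -> (forall x, `|f x| <= M)%R ->
  Lnorm mu +oo (EFin \o f) <= M%:E.
Proof.
move=> M0 fM; rewrite unlock; case: ifPn => [_|_]; last by rewrite lee_fin.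
by apply/ess_supP; apply: aeW => x /=; rewrite lee_fin.
Qed.

(** Clamping to [-M, M] turns the almost everywhere bound of the initial datum into the everywhere
    bound asked by [bddL1]. *)
Lemma truncation f (M : R) : measurable_fun setT f -> (0 <= M)%R ->
  (\forall x \ae mu, (`|f x| <= M)%R) ->
  exists g, [/\ measurable_fun setT g, forall x, (`|g x| <= M)%R & \forall x \ae mu, f x = g x].
Proof.
move=> mf M0 fM; exists (fun x => Num.max (- M)%R (Num.min M (f x))); split.
- by apply: measurable_maxr => //; exact: measurable_minr.
- move=> x; rewrite ler_norml le_max lexx ge_max ge_min lexx /= andbT.
  by rewrite (le_trans _ M0)// oppr_le0.
- apply: filterS fM => x; rewrite ler_norml => /andP[h1 h2].
  by rewrite min_r// max_r.
Qed.

End LnormFacts.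

Section Solution.
Variable R : realType.
Variable m : R.
Hypotheses (m1 : 1 < m) (m2 : m < 2).
Local Notation mu := (@leb2 R).
Variables (M N : R) (th0 : R * R -> R).
Hypotheses (M0 : 0 <= M) (N0 : 0 <= N) (bth0 : bddL1 M N th0).

Lemma limit_solution : exists theta : R -> R * R -> R,
  [/\ forall t, bddL1 M N (theta t),
      forall t p, 1 <= p ->
        (\int[mu]_x (`|theta t x| `^ p)%:E <= \int[mu]_x (`|th0 x| `^ p)%:E)%E &
      forall t phi, 0 < t -> test_fun phi ->
        (@leb1 R).-integrable `[0, t] (EFin \o (fun s => F0 m (theta s) (d1 phi) (d2 phi))) /\
        \int[@leb1 R]_(s in `[0, t]) F0 m (theta s) (d1 phi) (d2 phi) =
        \int[mu]_x (theta t x * phi x) - \int[mu]_x (th0 x * phi x)].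
Proof.
have [U [UU ooU]] := @ultraFilterLemma nat \oo eventually_filter.
have PU : ProperFilter U := @ultra_proper _ _ UU.
have [theta thetaP] := scheme_limit m1 m2 M0 N0 UU bth0.
have bth t : bddL1 M N (theta t) := proj1 (thetaP t).
have wth t : wcvg U ((thn m M N th0)^~ t) (theta t) := proj2 (thetaP t).
exists theta; split; first exact: bth.
- move=> t p p1; have [mt tM _] := bth t.
  apply: (weak_lsc PU (wth t) _ mt _ tM p1) => n.
  + by have [] := thn_bdd m1 m2 M0 N0 bth0 n t.
  + by have [] := thn_bdd m1 m2 M0 N0 bth0 n t.
  + exact: scheme_powR.
- move=> t phi t0 /test_funP[K [C [L [cK C0 L0 td [v0 v1 v2]]]]].
  (* [theta 0] is a chosen weak limit of the constant sequence [th0] and need not equal it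
     pointwise; only its integrals are identified. *)
  have lim0 : \int[mu]_x (theta 0 x * phi x) = \int[mu]_x (th0 x * phi x).
    have [r _ Kr] := compact_subset_box cK.
    have iphi : mu.-integrable setT (EFin \o phi).
      apply: (@integrable_box _ r C); [exact: td_m td|exact: td_b td|].
      by move=> x nb; apply: v0 => /Kr.
    have := wth 0 _ iphi.
    under eq_fun do rewrite thn0.
    move=> l; apply: (cvg_unique _ l); first exact: norm_hausdorff.
    exact: cvg_cst.
  rewrite -lim0.
  apply: (@integral_of_increment _ (fun u => \int[mu]_x (theta u x * phi x))) => // eps eps0.
  have [dl dl0 H] := increment_limit m1 m2 M0 N0 UU ooU bth0 bth wth C0 L0 td cK v0 v1 v2 eps0.
  exists dl => // x y x0 y0 xy.
  (* The expansion needs the flux at x on either side of x, so r is the left endpoint in the first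
     case and the right one in the second. *)
  have [le_xy|/ltW le_yx] := leP x y.
    have xy' := le_trans (ler_norm _) xy.
    have := H x y x x0 le_xy xy' (or_introl erefl) => h.
    by rewrite [X in _ <= X * _]ger0_norm ?subr_ge0.
  rewrite [X in _ <= X * _]distrC [X in _ <= X * _]ger0_norm ?subr_ge0//.
  have xy' : x - y <= dl by apply: le_trans (ler_norm _) _; rewrite distrC.
  have := H y x x y0 le_yx xy' (or_intror erefl); rewrite -normrN.
  have -> // (a b c : R) : - (a - b - (x - y) * c) = b - a - (y - x) * c by ring.
Qed.

End Solution.

Unset Implicit Arguments.

Theorem theorem2p6 (R : realType) (m : R) (theta0 : R * R -> R) :
  1 < m -> m < 2 ->
  measurable_fun setT theta0 ->
  (Lnorm (@leb2 R) 1%E (EFin \o theta0) < +oo)%E ->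
  (Lnorm (@leb2 R) +oo%E (EFin \o theta0) < +oo)%E ->
  exists theta : R -> R * R -> R,
    weak_solution m theta0 theta /\
    forall (p : \bar R) (t : R), (1 <= p)%E -> 0 < t ->
      (Lnorm (@leb2 R) p (EFin \o theta t)
       <= Lnorm (@leb2 R) p (EFin \o theta0))%E.
Proof.
move=> m1 m2 mth0 L1 Loo.
pose M := fine (Lnorm (@leb2 R) +oo%E (EFin \o theta0)).
have M0 : 0 <= M by rewrite fine_ge0// Lnorm_ge0.
have ME : Lnorm (@leb2 R) +oo%E (EFin \o theta0) = M%:E.
  by rewrite fineK// ge0_fin_numE ?Lnorm_ge0.
have [th0 [mth thM thae]] := @truncation _ _ R (leb2s R) theta0 M mth0 M0 (Lnormy_ae_le Loo).
(* Carries integrals from the clamped datum [th0], which starts the scheme, back to [theta0]. *)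
have ae_int (k : R -> R * R -> R) :
    measurable_fun setT (fun x => k (theta0 x) x) -> measurable_fun setT (fun x => k (th0 x) x) ->
    (\int[leb2 (R:=R)]_x (k (theta0 x) x)%:E = \int[leb2 (R:=R)]_x (k (th0 x) x)%:E)%E.
  move=> mk0 mk; apply: ae_eq_integral; [exact: measurableT|exact/measurable_EFinP..|].
  by apply: filterS thae => x ->.
pose N := fine (\int[leb2 (R:=R)]_x `|theta0 x|%:E)%E.
have int0 : (0 <= \int[leb2 (R:=R)]_x `|theta0 x|%:E)%E.
  by apply: integral_ge0 => x _; rewrite lee_fin.
have N0 : 0 <= N by rewrite fine_ge0.
have L1E : (\int[leb2 (R:=R)]_x `|theta0 x|%:E < +oo)%E by move: L1; rewrite Lnorm1.
have NE : (\int[leb2 (R:=R)]_x `|theta0 x|%:E = N%:E)%E.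
  by rewrite fineK// ge0_fin_numE.
have bth0 : bddL1 M N th0.
  split => //; rewrite -NE.
  rewrite (ae_int (fun y _ => `|y|))//; exact: (measurableT_comp (@normr_measurable _ _)).
have [theta [bth pth wth]] := limit_solution m1 m2 M0 N0 bth0.
exists theta; split; last first.
  move=> [r t r1 t0|t _ t0|//]; last first.
    by rewrite ME; apply: Lnormy_le => // x; have [_ +_] := bth t; exact.
  apply: le_Lnorm_powR; first by rewrite -lee_fin.
  have mpow (h : R * R -> R) : measurable_fun setT h -> measurable_fun setT (fun x => `|h x| `^ r).
    move=> mh; apply: (measurableT_comp (measurable_powR r)).
    exact: (measurableT_comp (@normr_measurable _ _)).
  by rewrite (ae_int (fun y _ => `|y| `^ r)) ?pth//; exact: mpow.
split; first by move=> s _; have [] := bth s.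
split.
  move=> s x _; split.
    exact: (proj1 (kdom_conv x (ka0_itv m1 m2) (ltW (kC_gt0 m)) M0 (kdom_km1 m1 m2) (bth s))).
  exact: (proj1 (kdom_conv x (ka0_itv m1 m2) (ltW (kC_gt0 m)) M0 (kdom_km2 m1 m2) (bth s))).
move=> t t0 phi tphi.
have [K [C [L [cK C0 L0 td [v0 v1 v2]]]]] := test_funP tphi.
have [it _] := bddL1_mul (bth t) (td_m td) C0 (td_b td).
have ith0 : (leb2 (R:=R)).-integrable setT (EFin \o theta0).
  apply/integrableP; split; first exact/measurable_EFinP.
  by [].
have i0 : (leb2 (R:=R)).-integrable setT (EFin \o (fun x => theta0 x * phi x)).
  have iC := integrableZl measurableT C ith0.
  apply: (@le_integrable _ _ _ (leb2 (R:=R)) setT measurableT _ _ _ _ iC).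
    by apply/measurable_EFinP; apply: measurable_funM => //; exact: td_m td.
  move=> x _; rewrite /= lee_fin !normrM mulrC (ger0_norm C0) ler_wpM2r//.
  exact: td_b td x.
have iB : (leb2 (R:=R)).-integrable setT (fun x => ((theta t x - theta0 x) * phi x)%:E).
  have := integrableB measurableT it i0; apply: eq_integrable => // x _.
  by rewrite /= mulrBl EFinB.
split => //; split; [|split].
- move=> s _; have V0 : 0 <= Vmax m M N by exact: ltW (Vmax_gt0 _ M0 N0).
  have [ms _ _] := bth s.
  have mk1 := measurable_conv (measurable_km1 m) ms.
  have mk2 := measurable_conv (measurable_km2 m) ms.
  exact: (proj1 (gflux_integrable (bth s) C0 V0 mk1 mk2 (td_m1 td) (td_m2 td)
    (fun x => convol_km1_bound m1 m2 M0 x (bth s)) (fun x => convol_km2_bound m1 m2 M0 x (bth s))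
    (td_b1 td) (td_b2 td))).
- exact: (proj1 (wth t phi t0 tphi)).
- have [_ E] := wth t phi t0 tphi.
  apply/eqP; rewrite subr_eq0; apply/eqP.
  transitivity (Rintegral (leb2 (R:=R)) setT (fun x => theta t x * phi x) -
    Rintegral (leb2 (R:=R)) setT (fun x => th0 x * phi x)); last by rewrite -E.
  under eq_Rintegral do rewrite mulrBl.
  rewrite RintegralB//; congr (_ - _); congr (fine _).
  by apply: (ae_int (fun y x => y * phi x)); apply: measurable_funM => //; exact: td_m td.
Qed.
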